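(* Assume Case II together with condition (H-II) and the Chen–Ledoux condition (C-L($\lambda_n$)). Then each of the sequences $$\left\{\frac{\sqrt{n/\kappa_n}}{\lambda_n}(\hat\theta_n-\theta_n^* ),\ n\ge1\right\},\qquad \left\{\frac{\sqrt{n/\kappa_n}}{\lambda_n}(\hat\rho_n-\rho_n^* ),\ n\ge1\right\}$$ satisfies the large deviation principle in $\mathbb{R}$ with speed $\lambda_n^2$ and the same good rate function $J(x)=-\frac{(\gamma_1+\gamma_2)^3x^2}{16\gamma_1\gamma_2}$, $x\in\mathbb{R}$.
   Context: Model: for each $n\ge1$, $X_{k,n}=\theta_nX_{k-1,n}+\varepsilon_{k,n}$, $\varepsilon_{k,n}=\rho_n\varepsilon_{k-1,n}+V_k$ for $k=1,\dots,n$, with $X_{0,n}=\varepsilon_{0,n}=0$. Here $(V_k)_{k\ge1}$ are i.i.d. real random variables with $E V_1=0$, $EV_1^2=\sigma^2\in(0,\infty)$, and $E\exp(t_0V_1^2)<\infty$ for some $t_0>0$. $(\kappa_n)$ is a sequence of positive numbers with $\kappa_n\to\infty$, and $\gamma_1<0,\gamma_2<0$ are constants. Case II: $\theta_n=1+\gamma_1/\kappa_n$, $\rho_n=-1-\gamma_2/\kappa_n$. (H-II): $(\lambda_n)$ is an increasing sequence of positive numbers with $\lambda_n\to\infty$, $\frac{n}{\lambda_n^6\kappa_n^6}\to\infty$, $\frac{n}{\lambda_n^2\kappa_n^{11}}\to\infty$, $\frac{n\lambda_n^2}{\kappa_n^7\log^2n}\to\infty$. (C-L($a_n$)): $\frac{1}{a_n^2}\log\big(nP(|V_1|^4>a_n\sqrt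 n)\big)\to-\infty$. Estimators: $\hat\theta_n=\frac{\sum_{k=1}^nX_{k,n}X_{k-1,n}}{\sum_{k=1}^nX_{k-1,n}^2}$; residuals $\hat\varepsilon_{k,n}=X_{k,n}-\hat\theta_nX_{k-1,n}$ ($1\le k\le n$), $\hat\varepsilon_{0,n}=0$; $\hat\rho_n=\frac{\sum_{k=1}^n\hat\varepsilon_{k,n}\hat\varepsilon_{k-1,n}}{\sum_{k=1}^n\hat\varepsilon_{k-1,n}^2}$. Centering constants: $\theta_n^*=\frac{\theta_n+\rho_n}{1+\theta_n\rho_n}$, $\rho_n^*=\theta_n\rho_n\theta_n^*$. *)

(* Defs.v *)
From HB Require Import structures.
From mathcomp Require Import all_boot all_order all_algebra.
From mathcomp Require Import all_classical all_reals all_analysis.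
Set Implicit Arguments. Unset Strict Implicit. Unset Printing Implicit Defensive.
Import Order.TTheory GRing.Theory Num.Theory.
Import numFieldNormedType.Exports.
Local Open Scope classical_set_scope.
Local Open Scope ring_scope.

Section defs.
Context {R : realType} {d : measure_display} {T : measurableType d}.

Definition elog (x : \bar R) : \bar R :=
  match x with
  | EFin r => if 0 < r then (ln r)%:E else -oo%E
  | +oo%E => +oo%E
  | -oo%E => -oo%E
  end.

Definition mutually_independent (P : probability T R) (X : nat -> T -> R) :=
  forall (m : nat) (f : 'I_m -> nat), injective f ->
  forall B : 'I_m -> set R, (forall i, measurable (B i)) ->
  P (\bigcap_(i in [set: 'I_m]) (X (f i) @^-1` B i)) =
  (\big[*%E/1%E]_(i < m) P (X (f i) @^-1` B i))%E.

Definition identically_distributed (P : probability T R) (X : nat -> T -> R) :=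
  forall k (B : set R), measurable B -> P (X k @^-1` B) = P (X 0%N @^-1` B).

(** The triangular AR(1) model with AR(1) errors; the innovation at time
    k.+1 is V k (so V 0 plays the role of V_1). *)
Fixpoint eps_ar (rho : R) (V : nat -> T -> R) (k : nat) (w : T) : R :=
  match k with
  | 0%N => 0
  | k'.+1 => rho * eps_ar rho V k' w + V k' w
  end.

Fixpoint X_ar (theta rho : R) (V : nat -> T -> R) (k : nat) (w : T) : R :=
  match k with
  | 0%N => 0
  | k'.+1 => theta * X_ar theta rho V k' w + eps_ar rho V k'.+1 w
  end.

(** least squares estimator of theta from X_0..X_n *)
Definition theta_hat (theta rho : R) (V : nat -> T -> R) (n : nat) (w : T) : R :=
  (\sum_(1 <= k < n.+1) X_ar theta rho V k w * X_ar theta rho V k.-1 w) /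
  (\sum_(1 <= k < n.+1) X_ar theta rho V k.-1 w ^+ 2).

Definition eps_hat (theta rho : R) (V : nat -> T -> R) (n k : nat) (w : T) : R :=
  if k == 0%N then 0
  else X_ar theta rho V k w - theta_hat theta rho V n w * X_ar theta rho V k.-1 w.

Definition rho_hat (theta rho : R) (V : nat -> T -> R) (n : nat) (w : T) : R :=
  (\sum_(1 <= k < n.+1) eps_hat theta rho V n k w * eps_hat theta rho V n k.-1 w) /
  (\sum_(1 <= k < n.+1) eps_hat theta rho V n k.-1 w ^+ 2).

Definition LDP (P : probability T R) (Z : nat -> T -> R) (s : nat -> R)
    (I : R -> R) :=
  (forall F : set R, closed F ->
     (limn_esup (fun n => (s n)^-1%:E * elog (P (Z n @^-1` F)))
       <= - ereal_inf [set (I x)%:E | x in F])%E) /\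
  (forall G : set R, open G ->
     (- ereal_inf [set (I x)%:E | x in G]
       <= limn_einf (fun n => (s n)^-1%:E * elog (P (Z n @^-1` G))))%E).

End defs.

Definition good_rate_function {R : realType} (I : R -> R) :=
  (forall x, 0 <= I x) /\ (forall a : R, compact [set x | I x <= a]).

(* Main.v *)
Require Import Defs.
From HB Require Import structures.
From mathcomp Require Import all_boot all_order all_algebra.
From mathcomp Require Import all_classical all_reals all_analysis.
From mathcomp Require Import measurable_realfun ring lra.
Set Implicit Arguments. Unset Strict Implicit. Unset Printing Implicit Defensive.
Import Order.TTheory GRing.Theory Num.Theory.
Import numFieldNormedType.Exports.
Local Open Scope classical_set_scope.
Local Open Scope ring_scope.

(* The least squares errors are driven by the martingale [M_n = \sum_k X_{k-1} V_k]: with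
   [S_n = \sum_k X_{k-1}^2] one has [(1 + theta rho) S_n (theta_hat - theta_star) =
   M_n + theta rho X_n X_{n-1}] exactly, and [rho_hat - rho_star] is, up to negligible terms,
   [theta rho] times [theta_hat - theta_star], where [theta rho --> -1].  Partial fractions
   write [X] as a combination of the two AR(1) processes with coefficients [theta] and [rho]
   driven by [V]; the moment generating functions of their squares and of the associated
   martingales are bounded by conditioning step by step, so that Chernoff bounds give
   [S_n / (n kappa_n) --> ell] and the boundary terms [--> 0] superexponentially fast at speed
   [lambda_n^2].  With [L] the log-Laplace transform of [V_1], the exponential martingale
   [exp (u M_n - \sum_k L (u X_{k-1}))] has mean 1, and its compensator is superexponentially
   close to [u^2 sigma^2 S_n / 2]; hence the scaled log-Laplace transform of [M_n] has a
   quadratic limit and the Gaertner-Ellis argument applies to [M_n].  The two estimators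
   inherit the LDP because they are exponentially equivalent to multiples of [M_n]. *)

(** * Independence of the past *)

(** Both roots approach the unit circle at distance of order [1 / kappa_n], so [1 + theta rho] is
    about [G / kappa_n] with [G = - (gamma1 + gamma2)]. Dividing by it amplifies [M_n / S_n] by
    [kappa_n]; the lagged martingale that enters [rho_hat] lacks this gain and drops out.

    The rate function comes out as follows: [M_n] has scaled variance [sigma^2 ell] and enters with
    coefficient [1 / (G ell)], so the limiting variance is [v = sigma^2 / (G^2 ell)]. Since
    [ell = sigma^2 G / (8 gamma1 gamma2)], this is [8 gamma1 gamma2 / G^3], and [x^2 / (2 v)] is the
    announced [J].

    The obstacle is that the square of an AR(1) process with coefficient [r] is given exponential
    moments only up to a parameter of order [1 - r^2], that is [1 / kappa_n]. The Chernoff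
    parameters for these processes have to shrink accordingly, and the growth of [n] against powers
    of [lambda_n] and [kappa_n] pays for the loss. *)

Section past.
Context {R : realType} {d : measure_display} {T : measurableType d}.
Variables (P : probability T R) (V : nat -> T -> R).

Definition cylinders k : set (set T) :=
  [set A | exists2 B : nat -> set R, (forall i, measurable (B i)) &
     A = \bigcap_(i in `I_k) V i @^-1` B i].

(* [T] equipped with the sigma-algebra generated by [V 0, ..., V (k-1)] *)
Definition past k : measurableType _ := g_sigma_algebraType (cylinders k).

Lemma setI_closed_cylinders k : setI_closed (cylinders k).
Proof.
move=> _ _ [B mB ->] [C mC ->]; exists (fun i => B i `&` C i).
  by move=> i; exact: measurableI.
by rewrite -bigcapI.
Qed.

Lemma cylinders_setT k : cylinders k setT.
Proof.
exists (fun=> setT) => //; apply/esym; rewrite -subTset => x _ i _ //.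
Qed.

Lemma measurable_past_innov k i : (i < k)%N -> measurable_fun setT (V i : past k -> R).
Proof.
move=> ik _ B mB; rewrite setTI; apply: sub_sigma_algebra.
exists (fun j => if j == i then B else setT).
  by move=> j; case: ifP.
apply/seteqP; split=> [x Bx j _ /=|x /(_ i ik)/=]; last by rewrite eqxx.
by case: eqP => // ->.
Qed.

Hypothesis mV : forall k, measurable_fun setT (V k).

Lemma cylinders_measurable k : cylinders k `<=` measurable.
Proof.
move=> _ [B mB ->]; apply: bigcap_measurableType => i _.
by rewrite -[_ @^-1` _]setTI; exact: mV.
Qed.

Lemma past_measurable k (A : set (past k)) :
  measurable A -> d.-measurable (A : set T).
Proof.
exact: (smallest_sub (@sigma_algebra_measurable _ T) (@cylinders_measurable k)).
Qed.

Lemma past_measurable_fun k d' (U : measurableType d') (f : past k -> U) :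
  measurable_fun setT f -> measurable_fun setT (f : T -> U).
Proof. by move=> mf _ B mB; apply: past_measurable; exact: mf. Qed.

Hypothesis indep : mutually_independent P V.

Lemma cylinders_indep k (A : set T) (B : set R) : cylinders k A -> measurable B ->
  P (A `&` V k @^-1` B) = (P A * P (V k @^-1` B))%E.
Proof.
move=> [C mC ->] mB.
(* [key] is used twice: with [D = B], and with [D = setT], which evaluates the probability of the
   cylinder itself. *)
have key (D : set R) : measurable D ->
   P (\bigcap_(i in `I_k) V i @^-1` C i `&` V k @^-1` D) =
   ((\big[*%E/1%E]_(i < k) P (V i @^-1` C i)) * P (V k @^-1` D))%E.
  move=> mD; pose E i := if (i == k)%N then D else C i.
  have := @indep k.+1 (fun i => val i) val_inj (fun i => E i).
  rewrite big_ord_recr /=.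
  rewrite (eq_bigr (fun i : 'I_k => P (V i @^-1` C i))); last first.
    by move=> i _; rewrite /E /= ltn_eqF.
  rewrite /E eqxx => <-; last by move=> i; case: ifP.
  congr (P _); apply/seteqP; split=> [x [Cx Dx] i _ /=|x Ex].
    by case: eqP => [->//|/eqP ik]; apply: Cx => /=; rewrite ltn_neqAle ik -ltnS /=.
  split=> [i /= ik|].
    have ik1 : (i < k.+1)%N by rewrite ltnW.
    by have := Ex (Ordinal ik1) I; rewrite /= ltn_eqF.
  by have := Ex ord_max I; rewrite /= eqxx.
rewrite key //; move: (key setT measurableT).
by rewrite preimage_setT setIT probability_setT mule1 => ->.
Qed.

(** Both sides are finite measures in [A]: [P] restricted to the event that [V k] lies in [B], and
    [P] scaled by the probability of that event. They agree on the cylinders, a pi-system generating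
    the past, hence everywhere on it. *)
Lemma past_indep k (A : set (past k)) (B : set R) : measurable A -> measurable B ->
  P ((A : set T) `&` V k @^-1` B) = (P (A : set T) * P (V k @^-1` B))%E.
Proof.
move=> mA mB.
have mVB : measurable (V k @^-1` B) by rewrite -[_ @^-1` _]setTI; exact: mV.
have finVB : (fine (P (V k @^-1` B)))%:E = P (V k @^-1` B).
  by rewrite fineK// fin_num_measure.
pose c : {nonneg R} := NngNum (fine_ge0 (measure_ge0 P (V k @^-1` B))).
have : mrestr P mVB A = mscale c P A.
  have cov : \bigcup_(i : nat) [set: T] = setT by rewrite bigcup_const//; exists 0%N.
  apply: (@g_sigma_algebra_measure_unique _ _ _ (cylinders k)
    (@cylinders_measurable k) (fun=> setT) (fun=> cylinders_setT k) cov
    (mrestr P mVB) (mscale c P) (@setI_closed_cylinders k)) => //.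
  - move=> A' cA'; rewrite [LHS]cylinders_indep//.
    transitivity ((c%:num)%:E * P A')%E => //=.
    by rewrite finVB muleC.
  - by move=> _; change (P (setT `&` V k @^-1` B) < +oo)%E; rewrite setTI -finVB ltry.
by rewrite /mrestr /mscale /= finVB muleC.
Qed.

(** Plays the role of conditional expectation given the past: by [past_indep] the joint law of the
    past and [V k] is a product measure, so Tonelli lets [V k] be integrated with the past
    frozen. *)
Lemma integral_freeze k (f : past k * R -> \bar R) :
  measurable_fun setT f -> (forall x, 0 <= f x)%E ->
  (\int[P]_w f (w, V k w) = \int[P]_w \int[P]_w' f (w, V k w'))%E.
Proof.
move=> mf f0.
(* The past as a random variable: the identity, with the coarser sigma-algebra on its target. *)
have mid : measurable_fun setT (id : T -> past k).
  by move=> _ B mB; rewrite setTI; exact: (@past_measurable k B mB).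
pose I1 : {mfun T >-> past k} := mfun_Sub (mem_set mid).
pose V1 : {mfun T >-> R} := mfun_Sub (mem_set (mV k)).
have mpair : measurable_fun setT (fun w : T => (w : past k, V k w)).
  exact: (measurable_fun_pair mid (mV k)).
pose W1 : {mfun T >-> (past k * R)%type} := mfun_Sub (mem_set mpair).
pose m1 := distribution P I1; pose m2 := distribution P V1.
have E (X : set (past k * R)) : measurable X -> (m1 \x m2)%E X = distribution P W1 X.
  apply: product_measure_unique => A B mA mB.
  by rewrite /m1 /m2 /distribution /pushforward /= -past_indep.
have EW := @ge0_integral_distribution _ _ _ _ _ P W1 f mf f0.
rewrite /comp /= in EW; rewrite -EW.
transitivity (\int[(m1 \x m2)%E]_x f x)%E.
  by apply: eq_measure_integral => A mA _; apply/esym; exact: E.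
rewrite fubini_tonelli1// /fubini_F.
have mF := @measurable_fun_fubini_tonelli_F _ _ _ _ R m2 f mf f0.
rewrite (@ge0_integral_distribution _ _ _ _ _ P I1 _ mF); last first.
  by move=> x; exact: integral_ge0.
apply: eq_integral => w _ /=.
rewrite /fubini_F (@ge0_integral_distribution _ _ _ _ _ P V1) //.
exact: measurableT_comp.
Qed.

Lemma integral_identically_distributed k (g : R -> \bar R) :
  identically_distributed P V -> measurable_fun setT g -> (forall x, 0 <= g x)%E ->
  (\int[P]_w g (V k w) = \int[P]_w g (V 0%N w))%E.
Proof.
move=> idV mg g0.
pose Vk j : {mfun T >-> R} := mfun_Sub (mem_set (mV j)).
have E j := @ge0_integral_distribution _ _ _ _ _ P (Vk j) g mg g0.
rewrite /comp /= in E; rewrite -!E.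
by apply: eq_measure_integral => A mA _; exact: idV.
Qed.

End past.

(** * Moment generating functions of the innovations *)

Section exp_inequalities.
Context {R : realType}.
Implicit Types x y : R.

(** Since [i! <= (i+3)!], the factor [|x| ^+ 3] comes out of the exponential series from its fourth
    term on, leaving partial sums of the series of [expR |x|]. *)
Lemma expR_taylor3 x :
  `|expR x - (1 + x + x ^+ 2 / 2)| <= `|x| ^+ 3 * expR `|x|.
Proof.
have cvx (y : R) : series (exp_coeff y) @ \oo --> expR y.
  exact: is_cvg_series_exp_coeff.
have le_abs n : series (exp_coeff `|x|) n <= expR `|x|.
  apply: nondecreasing_cvgn_le (is_cvg_series_exp_coeff _) n.
  apply/nondecreasing_seqP => m; rewrite seriesSr lerDl.
  by rewrite exp_coeff_ge0.
have bound n : `|series (exp_coeff x) n.+3 - (1 + x + x ^+ 2 / 2)| <=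
    `|x| ^+ 3 * expR `|x|.
  rewrite /series /= !big_nat_recl//= -!addrA.
  rewrite [X in `|X|](_ : _ = \sum_(0 <= i < n) exp_coeff x i.+3); last first.
    by rewrite /exp_coeff/= !expr0 !expr1 !fact0 factS fact0 /= !divr1; ring.
  apply: le_trans (ler_norm_sum _ _ _) _.
  apply: le_trans (ler_wpM2l (exprn_ge0 3 (normr_ge0 x)) (le_abs n)).
  rewrite /series /= mulr_sumr; apply: ler_sum => i _.
  rewrite [leRHS](_ : _ = `|x| ^+ i.+3 * (i`!%:R)^-1); last first.
    by rewrite mulrA -exprD add3n.
  rewrite /exp_coeff /= normrM normfV normrX normr_nat ler_wpM2l ?exprn_ge0//.
  by rewrite lef_pV2 ?posrE ?ltr0n ?fact_gt0// ler_nat leq_fact// -addn3 leq_addr.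
have cvd : (fun n => `|series (exp_coeff x) n.+3 - (1 + x + x ^+ 2 / 2)|) @ \oo -->
    `|expR x - (1 + x + x ^+ 2 / 2)|.
  apply: cvg_norm; apply: cvgB; last exact: cvg_cst.
  by have := cvx x; rewrite -(cvg_shiftn 3); under eq_fun do rewrite addn3.
rewrite -(cvg_lim _ cvd)//; apply: limr_le; first by apply/cvg_ex; eexists; exact: cvd.
by apply: nearW.
Qed.

(** Squaring [expR (x / 2) <= (1 - x / 2)^-1] reduces the claim to a polynomial inequality, whose
    excess over 1 is [x ^+ 2] times the nonnegative factors [1 - x] and [5 / 2 - x], halved. *)
Lemma expR_le_quadratic x : x <= 1 -> expR x <= 1 + x + 2 * x ^+ 2.
Proof.
move=> x1.
have h0 : 0 < 1 - x / 2 by lra.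
have h1 : expR (x / 2) <= (1 - x / 2)^-1.
  rewrite -[X in expR X]opprK expRN lef_pV2 ?posrE ?expR_gt0//.
  exact: expR_ge1Dx.
have -> : expR x = expR (x / 2) ^+ 2 by rewrite -expRM_natl; congr expR; field.
have h2 : expR (x / 2) ^+ 2 <= (1 - x / 2) ^- 2.
  by rewrite -exprVn lerXn2r// nnegrE ?expR_ge0// invr_ge0 ltW.
apply: le_trans h2 _.
rewrite -div1r ler_pdivrMr ?exprn_gt0//.
have -> : (1 + x + 2 * x ^+ 2) * (1 - x / 2) ^+ 2 =
  1 + x ^+ 2 * ((1 - x) * (5 / 2 - x) / 2) by field.
rewrite lerDl mulr_ge0 ?sqr_ge0//; apply: divr_ge0 => //; apply: mulr_ge0; lra.
Qed.

(** Against a centred variable the linear term integrates to 0, which leaves the exponential moment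
    of the square: this is how a Gaussian tail yields a sub-Gaussian moment generating function. *)
Lemma expR_le_linDexp_sqr x : expR x <= x + expR (2 * x ^+ 2).
Proof.
have [x1|x1] := leP x 1.
  apply: le_trans (expR_le_quadratic x1) _.
  by rewrite [1 + x]addrC -addrA lerD2l expR_ge1Dx.
rewrite -[leLHS]add0r lerD//; first by lra.
rewrite ler_expR; nra.
Qed.

Lemma expR_le_quadratic_abs x : expR x <= 1 + x + 2 * x ^+ 2 * expR `|x|.
Proof.
have [x1|x1] := leP x 1.
  apply: le_trans (expR_le_quadratic x1) _.
  have h : 1 <= expR `|x| by rewrite -[leLHS]expR0 ler_expR.
  have := sqr_ge0 x; nra.
rewrite ger0_norm; last by lra.
have := expR_ge0 x => e0.
have : expR x <= 2 * x ^+ 2 * expR x by rewrite ler_peMl//; nra.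
lra.
Qed.

(** [b * y] is the convex combination of [t * y] and 0 with weight [b / t]. The bound is affine in
    [b], so the single exponential moment at [t] controls all smaller parameters with a constant
    linear in [b]. *)
Lemma expR_convex_itv (t b y : R) : 0 < t -> 0 <= b -> b <= t ->
  expR (b * y) <= 1 - b / t + b / t * expR (t * y).
Proof.
move=> t0 b0 bt.
have h : 0 <= b / t by rewrite divr_ge0// ltW.
have h1 : b / t <= 1 by rewrite ler_pdivrMr ?mul1r.
have := @convex_expR R (Itv01 h h1) (t * y) 0.
rewrite /= !convRE /= expR0 mulr1 mulr0 addr0 => H.
rewrite -[b * y](_ : b / t * (t * y) = _); last by field; lra.
by rewrite addrC; exact: H.
Qed.

(* Young's inequality; optimising [l] replaces Hölder's inequality. *)
Lemma expRD_le_half x y (l : R) :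
  expR (x + y) <= 2^-1 * (expR l * expR (2 * x)) + 2^-1 * (expR (- l) * expR (2 * y)).
Proof.
rewrite -!expRD.
have e1 : expR (l + 2 * x) = expR (l / 2 + x) ^+ 2.
  by rewrite -expRM_natl; congr expR; field.
have e2 : expR (- l + 2 * y) = expR (- l / 2 + y) ^+ 2.
  by rewrite -expRM_natl; congr expR; field.
have e3 : expR (x + y) = expR (l / 2 + x) * expR (- l / 2 + y).
  by rewrite -expRD; congr expR; field.
rewrite e1 e2 e3.
set u := expR _; set v := expR _.
have := sqr_ge0 (u - v); nra.
Qed.

Lemma expR_gt_quadratic x : 0 <= x -> x ^+ 2 / 2 <= expR x.
Proof.
by move=> x0; have := expR_ge1Dxn 1 x0; rewrite (_ : 2`! = 2)%N// => h; lra.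
Qed.

Lemma expR_gt_cubic x : 0 <= x -> x ^+ 3 / 6 <= expR x.
Proof.
by move=> x0; have := expR_ge1Dxn 2 x0; rewrite (_ : 3`! = 6)%N// => h; lra.
Qed.


End exp_inequalities.

Section gaussian_tail.
Context {R : realType} {d : measure_display} {T : measurableType d}.
Variables (P : probability T R) (W : T -> R) (t0 s2 : R).
Hypotheses (mW : measurable_fun setT W) (t0_gt0 : 0 < t0).
Hypothesis W_exp : (\int[P]_w (expR (t0 * W w ^+ 2))%:E < +oo)%E.
Hypothesis W_mean : (\int[P]_w (W w)%:E = 0)%E.
Hypothesis W_var : (\int[P]_w (W w ^+ 2)%:E = s2%:E)%E.

Local Notation E f := (Rintegral P setT f).

Lemma measurable_exp_quad a b :
  measurable_fun setT (fun w => expR (a * W w + b * W w ^+ 2)).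
Proof.
apply: measurableT_comp => //; apply: measurable_funD => //; apply: measurable_funM => //.
exact: measurable_funX.
Qed.

Lemma integrable_exp_sqr : P.-integrable setT (EFin \o (fun w => expR (t0 * W w ^+ 2))).
Proof.
apply/integrableP; split.
  apply/measurable_EFinP; have := measurable_exp_quad 0 t0.
  by under eq_fun do rewrite mul0r add0r.
rewrite (le_lt_trans _ W_exp)//.
by under eq_integral do rewrite /= ger0_norm ?expR_ge0//.
Qed.

Lemma integrable_dominated (f : T -> R) (c : R) : measurable_fun setT f ->
  (forall w, `|f w| <= c * expR (t0 * W w ^+ 2)) -> P.-integrable setT (EFin \o f).
Proof.
move=> mf fc; have c0 : 0 <= c.
  have := le_trans (normr_ge0 _) (fc point).
  by rewrite pmulr_lge0 ?expR_gt0.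
apply: (le_integrable measurableT _ _ (integrableZl measurableT c integrable_exp_sqr)).
  exact/measurable_EFinP.
move=> w _ /=; rewrite lee_fin; apply: le_trans (fc w) _.
by rewrite ger0_norm// mulr_ge0 ?expR_ge0.
Qed.

Lemma EFin_Rintegral (f : T -> R) : P.-integrable setT (EFin \o f) ->
  (\int[P]_w (f w)%:E)%E = (E f)%:E.
Proof. by move=> fi; rewrite /Rintegral fineK//; exact: integrable_fin_num. Qed.

Lemma integrable_quad : P.-integrable setT (EFin \o (fun w => W w ^+ 2)).
Proof.
apply: (@integrable_dominated _ t0^-1) => [|w]; first exact: measurable_funX.
rewrite ger0_norm ?sqr_ge0// ler_pdivlMl//.
by have := expR_ge1Dx (t0 * W w ^+ 2); lra.
Qed.

Lemma integrable_lin : P.-integrable setT (EFin \o W).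
Proof.
apply: (@integrable_dominated _ (1 + t0^-1)) => // w.
have h0 : `|W w| <= 1 + W w ^+ 2.
  by rewrite ler_norml; apply/andP; split; have := sqr_ge0 (W w); nra.
apply: le_trans h0 _.
have h : W w ^+ 2 <= t0^-1 * expR (t0 * W w ^+ 2).
  by rewrite ler_pdivlMl//; have := expR_ge1Dx (t0 * W w ^+ 2); lra.
have h1 : 1 <= expR (t0 * W w ^+ 2).
  by rewrite -[leLHS]expR0 ler_expR mulr_ge0 ?sqr_ge0// ltW.
lra.
Qed.

Lemma integrable_one (c : R) : P.-integrable setT (EFin \o (fun=> c)).
Proof. exact: finite_measure_integrable_cst. Qed.

Lemma E_one (c : R) : E (fun=> c) = c.
Proof. by rewrite Rintegral_cst//= probability_setT mulr1. Qed.

Lemma E_lin : E W = 0.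
Proof. by rewrite /Rintegral W_mean. Qed.

Lemma E_quad : E (fun w => W w ^+ 2) = s2.
Proof. by rewrite /Rintegral W_var. Qed.

Let t0N : t0 != 0. Proof. by rewrite gt_eqF. Qed.

Let m := E (fun w => expR (t0 * W w ^+ 2)).

Let m_ge1 : 1 <= m.
Proof.
rewrite -(E_one 1); apply: le_Rintegral => //=; first exact: integrable_one.
  exact: integrable_exp_sqr.
by move=> w _; rewrite -[leLHS]expR0 ler_expR mulr_ge0 ?sqr_ge0// ltW.
Qed.

Lemma integrable_exp_lin a : P.-integrable setT (EFin \o (fun w => expR (a * W w))).
Proof.
apply: (@integrable_dominated _ (expR (a ^+ 2 / (4 * t0)))).
  by have := measurable_exp_quad a 0; under eq_fun do rewrite mul0r addr0.
move=> w; rewrite ger0_norm ?expR_ge0// -expRD ler_expR.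
(* [a W <= a^2 / (4 t0) + t0 W^2], by completing the square. *)
rewrite -subr_ge0 (_ : _ - _ = (a / (2 * t0) - W w) ^+ 2 * t0); last by field.
by rewrite mulr_ge0 ?sqr_ge0// ltW.
Qed.

Lemma integrable_exp_sqr_le (b : R) : 0 <= b -> b <= t0 ->
  P.-integrable setT (EFin \o (fun w => expR (b * W w ^+ 2))).
Proof.
move=> b0 bt; apply: (@integrable_dominated _ 1).
  by have := measurable_exp_quad 0 b; under eq_fun do rewrite mul0r add0r.
move=> w; rewrite ger0_norm ?expR_ge0// mul1r ler_expR ler_wpM2r ?sqr_ge0//.
Qed.

Lemma E_exp_sqr_le (b : R) : 0 <= b -> b <= t0 ->
  E (fun w => expR (b * W w ^+ 2)) <= expR ((m - 1) / t0 * b).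
Proof.
move=> b0 bt.
have -> : (m - 1) / t0 * b = - (b / t0) + b / t0 * m by field.
apply: le_trans (expR_ge1Dx _); rewrite addrA.
rewrite -[X in X + _](E_one) -RintegralZl//; last exact: integrable_exp_sqr.
rewrite -RintegralD//; [|exact: integrable_one|]; last first.
  exact: (integrableZl measurableT (b / t0) integrable_exp_sqr).
apply: le_Rintegral => //; first exact: integrable_exp_sqr_le.
  apply: (integrableD measurableT (integrable_one (1 - b / t0))
    (integrableZl measurableT (b / t0) integrable_exp_sqr)).
by move=> w _; exact: expR_convex_itv.
Qed.

Lemma E_exp_lin_ge1 a : 1 <= E (fun w => expR (a * W w)).
Proof.
have <- : 1 + a * E W = 1 by rewrite E_lin mulr0 addr0.
rewrite -[X in X + _](E_one) -RintegralZl//; last exact: integrable_lin.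
have i1 := integrable_one 1; have i2 := integrableZl measurableT a integrable_lin.
rewrite -RintegralD//; apply: le_Rintegral => //=.
- exact: (integrableD measurableT i1 i2).
- exact: integrable_exp_lin.
- by move=> w _; exact: expR_ge1Dx.
Qed.

(** Two regimes. For [2 * a ^+ 2 <= t0], [expR_le_linDexp_sqr] removes the first-order term. For
    larger [a], completing the square leaves a constant factor [m], absorbed because
    [m <= expR (m - 1)] and [2 * a ^+ 2 / t0 >= 1]. *)
Lemma E_exp_lin_le : exists2 C : R, 0 <= C &
  forall a : R, E (fun w => expR (a * W w)) <= expR (C * a ^+ 2).
Proof.
have m1 := m_ge1.
have C0 : 0 <= (m - 1) / t0 by apply: divr_ge0 (ltW t0_gt0); lra.
exists (2 * ((m - 1) / t0) + (4 * t0)^-1) => [|a].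
  by apply: addr_ge0; rewrite ?invr_ge0; apply: mulr_ge0 => //; exact: ltW.
have [at0|at0] := leP (2 * a ^+ 2) t0.
  have a20 : 0 <= 2 * a ^+ 2 by rewrite mulr_ge0 ?sqr_ge0.
  apply: (@le_trans _ _ (a * E W + E (fun w => expR (2 * a ^+ 2 * W w ^+ 2)))).
    rewrite -RintegralZl//; last exact: integrable_lin.
    have i1 := integrable_exp_sqr_le a20 at0.
    have i2 := integrableZl measurableT a integrable_lin.
    rewrite -RintegralD//; apply: le_Rintegral => //=.
    - exact: integrable_exp_lin.
    - exact: (integrableD measurableT i2 i1).
    - move=> w _; apply: le_trans (expR_le_linDexp_sqr _) _.
      by rewrite exprMn mulrA.
  rewrite E_lin mulr0 add0r; apply: le_trans (E_exp_sqr_le a20 at0) _.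
  rewrite ler_expR mulrCA mulrA ler_wpM2r ?sqr_ge0//.
  by rewrite lerDl invr_ge0 mulr_ge0// ltW.
apply: (@le_trans _ _ (expR ((4 * t0)^-1 * a ^+ 2) * m)).
  rewrite -RintegralZl//; last exact: integrable_exp_sqr.
  apply: le_Rintegral => //.
  - exact: integrable_exp_lin.
  - exact: (integrableZl measurableT _ integrable_exp_sqr).
  move=> w _; rewrite -expRD ler_expR.
  rewrite -subr_ge0 (_ : _ - _ = (a / (2 * t0) - W w) ^+ 2 * t0); last by field.
  by rewrite mulr_ge0 ?sqr_ge0// ltW.
have mE : m <= expR (2 * ((m - 1) / t0) * a ^+ 2).
  apply: le_trans (_ : expR (m - 1) <= _).
    by have := expR_ge1Dx (m - 1); lra.
  rewrite ler_expR (_ : 2 * ((m - 1) / t0) * a ^+ 2 = (m - 1) * (2 * a ^+ 2 / t0)).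
    have h : 1 <= 2 * a ^+ 2 / t0 by rewrite ler_pdivlMr// mul1r ltW.
    by apply: ler_peMr => //; lra.
  by field.
rewrite [X in _ <= expR X](_ : _ = (4 * t0)^-1 * a ^+ 2 +
  2 * ((m - 1) / t0) * a ^+ 2); last by ring.
rewrite expRD.
by apply: ler_wpM2l => //; exact: expR_ge0.
Qed.

Lemma mgf_quad_le : exists2 C : R, 1 <= C & forall a b : R, 0 <= b -> b <= C^-1 ->
  (\int[P]_w (expR (a * W w + b * W w ^+ 2))%:E <= (expR (C * a ^+ 2 + C * b))%:E)%E.
Proof.
have [C1 C10 HC1] := E_exp_lin_le.
have m1 := m_ge1.
set C2 := (m - 1) / t0.
have C20 : 0 <= C2 by apply: divr_ge0 (ltW t0_gt0); lra.
have it0 : 0 < 2 / t0 by rewrite divr_gt0.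
set C := 1 + 2 * C1 + C2 + 2 / t0.
have C_ge1 : 1 <= C by rewrite /C; lra.
exists C => // a b b0 bC.
have bt : 2 * b <= t0.
  have : b <= (2 / t0)^-1.
    apply: le_trans bC _; rewrite lef_pV2 ?posrE//; rewrite /C; lra.
  by rewrite invf_div; lra.
have b20 : 0 <= 2 * b by lra.
(* The two doubled moments are at most [expR (2 * p)] and [expR (2 * q)]; [l = q - p] equalises the
   two halves and recovers the Cauchy-Schwarz value [expR (p + q)]. *)
pose p := 2 * C1 * a ^+ 2; pose q := C2 * b; pose l := q - p.
apply: (@le_trans _ _ (expR (p + q))%:E); last first.
  rewrite lee_fin ler_expR /p /q.
  have a20 := sqr_ge0 a.
  by apply: lerD; apply: ler_wpM2r => //; rewrite /C; lra.
have i1 := integrableZl measurableT (2^-1 * expR l) (integrable_exp_lin (2 * a)).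
have i2 := integrableZl measurableT (2^-1 * expR (- l)) (integrable_exp_sqr_le b20 bt).
apply: (@le_trans _ _ (\int[P]_w (2^-1 * expR l * expR (2 * a * W w)
    + 2^-1 * expR (- l) * expR (2 * b * W w ^+ 2))%:E)%E).
  apply: ge0_le_integral => //.
  - by apply/measurable_EFinP; exact: measurable_exp_quad.
  - by have /integrableP[] := integrableD measurableT i1 i2.
  - move=> w _; rewrite lee_fin; apply: le_trans (expRD_le_half _ _ l) _.
    by rewrite !mulrA.
rewrite (EFin_Rintegral (integrableD measurableT i1 i2)) lee_fin RintegralD//.
rewrite !RintegralZl//; [|exact: integrable_exp_sqr_le|exact: integrable_exp_lin].
have h1 : expR l * E (fun w => expR (2 * a * W w)) <= expR (p + q).
  apply: le_trans (ler_wpM2l (expR_ge0 _) (HC1 _)) _.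
  by rewrite -expRD ler_expR /l /p /q; lra.
have h2 : expR (- l) * E (fun w => expR (2 * b * W w ^+ 2)) <= expR (p + q).
  apply: le_trans (ler_wpM2l (expR_ge0 _) (E_exp_sqr_le b20 bt)) _.
  by rewrite -expRD ler_expR /l /p /q /C2; lra.
by rewrite -!mulrA; lra.
Qed.


Let cubic_dominated w :
  `|W w| ^+ 3 * expR `|W w| <= 6 * expR t0^-1 * expR (t0 * W w ^+ 2).
Proof.
have h := expR_gt_cubic (normr_ge0 (W w)).
apply: (@le_trans _ _ (6 * expR `|W w| * expR `|W w|)).
  by apply: ler_wpM2r; [exact: expR_ge0|lra].
rewrite -!mulrA ler_wpM2l// -!expRD ler_expR -real_normK ?num_real//.
set y := `|W w|; rewrite -subr_ge0.
rewrite (_ : _ - _ = (t0^-1 - y) ^+ 2 * t0); last by field.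
by rewrite mulr_ge0 ?sqr_ge0// ltW.
Qed.

(** The expansion is put in exponential form so that taking logarithms expands the cumulant. The
    upper bound is [1 + y <= expR y]; the lower one uses [y - y^2 <= y / (1 + y) <= ln (1 + y)] for
    [y >= 0], whose loss [y^2] is of order [a^4] and accounts for [s2 ^+ 2 / 4] in the constant. *)
Lemma E_exp_lin_taylor : exists2 K : R, 0 <= K & forall a : R, `|a| <= 1 ->
  expR (s2 / 2 * a ^+ 2 - K * `|a| ^+ 3) <= E (fun w => expR (a * W w)) <=
  expR (s2 / 2 * a ^+ 2 + K * `|a| ^+ 3).
Proof.
pose g w := `|W w| ^+ 3 * expR `|W w|.
have mg : measurable_fun setT g.
  by apply: measurable_funM; [apply: measurable_funX|]; apply: measurableT_comp => //;
    exact: measurableT_comp.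
have g0 w : 0 <= g w by rewrite mulr_ge0 ?exprn_ge0 ?expR_ge0.
have ig : P.-integrable setT (EFin \o g).
  apply: (@integrable_dominated _ (6 * expR t0^-1)) => // w.
  by rewrite ger0_norm//; exact: cubic_dominated.
pose K := E g.
have K0 : 0 <= K by exact: Rintegral_ge0.
have s20 : 0 <= s2.
  by rewrite -E_quad; apply: Rintegral_ge0 => w _; exact: sqr_ge0.
have key (a : R) : `|a| <= 1 ->
    `|E (fun w => expR (a * W w)) - (1 + s2 / 2 * a ^+ 2)| <= K * `|a| ^+ 3.
  move=> a1.
  have i0 := integrable_one 1.
  have i1 := integrableZl measurableT a integrable_lin.
  have i2 := integrableZl measurableT (a ^+ 2 / 2) integrable_quad.
  have i3 := integrable_exp_lin a.
  have i12 := integrableD measurableT i1 i2.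
  have i012 := integrableD measurableT i0 i12.
  have -> : 1 + s2 / 2 * a ^+ 2 = E (fun w => 1 + (a * W w + a ^+ 2 / 2 * W w ^+ 2)).
    rewrite RintegralD// RintegralD// RintegralZl//; last exact: integrable_lin.
    rewrite RintegralZl//; last exact: integrable_quad.
    by rewrite E_one E_lin E_quad; field.
  rewrite -RintegralB//.
  apply: le_trans (le_normr_Rintegral _ (integrableB measurableT i3 i012)) _ => //.
  rewrite [leRHS]mulrC -RintegralZl//.
  apply: le_Rintegral => //=.
  - exact: integrable_norm (integrableB measurableT i3 i012).
  - exact: (integrableZl measurableT (`|a| ^+ 3) ig).
  move=> w _; rewrite addrA.
  have := expR_taylor3 (a * W w); rewrite exprMn normrM exprMn => h.
  rewrite (_ : a ^+ 2 / 2 * W w ^+ 2 = a ^+ 2 * W w ^+ 2 / 2); last by field.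
  apply: le_trans h _; rewrite -mulrA ler_wpM2l ?exprn_ge0// /g ler_wpM2l ?exprn_ge0//.
  by rewrite ler_expR ler_piMl.
exists (K + s2 ^+ 2 / 4) => [|a a1]; first by rewrite addr_ge0// divr_ge0 ?sqr_ge0.
have a30 : 0 <= `|a| ^+ 3 by rewrite exprn_ge0.
have := key a a1; rewrite ler_distl => /andP[l1 l2]; apply/andP; split; last first.
  apply: le_trans l2 _; rewrite -addrA.
  apply: le_trans (expR_ge1Dx _) _; rewrite ler_expR lerD2l ler_wpM2r// lerDl.
  by rewrite divr_ge0 ?sqr_ge0.
set y := s2 / 2 * a ^+ 2 - K * `|a| ^+ 3.
have y1 : 1 + y <= E (fun w => expR (a * W w)) by move: l1; rewrite /y; lra.
have a20 := sqr_ge0 a.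
have a43 : a ^+ 4 <= `|a| ^+ 3.
  rewrite -(@ger0_norm _ (a ^+ 4)) ?normrX; last by rewrite exprn_even_ge0.
  by rewrite exprSr ler_piMr.
have c0 : 0 <= s2 ^+ 2 / 4 by rewrite divr_ge0 ?sqr_ge0.
(* For negative [y] the required lower bound is below 1, and the mean of [expR (a * W)] is at least
   1. *)
have [y0|y0] := leP 0 y; last first.
  apply: le_trans (E_exp_lin_ge1 a); rewrite -[leRHS]expR0 ler_expR.
  by move: y0; rewrite /y mulrDl; nra.
apply: le_trans y1; apply: (@le_trans _ _ (expR (y - y ^+ 2))).
  rewrite ler_expR.
  have yle : y <= s2 / 2 * a ^+ 2 by rewrite /y lerBlDr lerDl mulr_ge0.
  have : y ^+ 2 <= s2 ^+ 2 / 4 * `|a| ^+ 3.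
    apply: (@le_trans _ _ ((s2 / 2 * a ^+ 2) ^+ 2)).
      by rewrite lerXn2r// nnegrE// mulr_ge0// divr_ge0.
    rewrite (_ : _ ^+ 2 = s2 ^+ 2 / 4 * a ^+ 4); last by field.
    by rewrite ler_wpM2l.
  by rewrite /y; lra.
have y1p : 0 < 1 + y by lra.
apply: (@le_trans _ _ (expR (y / (1 + y)))).
  rewrite ler_expR ler_pdivlMr//.
  rewrite (_ : _ * _ = y - y ^+ 3); last by ring.
  by rewrite lerBlDr lerDl exprn_ge0.
rewrite -[leLHS]invrK -expRN -[leRHS]invrK lef_pV2 ?posrE ?invr_gt0 ?expR_gt0//.
apply: le_trans (expR_ge1Dx _).
by rewrite le_eqVlt; apply/orP; left; apply/eqP; field; rewrite gt_eqF.
Qed.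

Lemma mgf_sqr_centered : exists2 C : R, 1 <= C & forall b : R, `|b| <= C^-1 ->
  (\int[P]_w (expR (b * (W w ^+ 2 - s2)))%:E <= (expR (C * b ^+ 2))%:E)%E.
Proof.
have s20 : 0 <= s2.
  by rewrite -E_quad; apply: Rintegral_ge0 => w _; exact: sqr_ge0.
(* The available exponent [t0] is shared equally: with [y = W ^+ 2 + s2], one factor [expR (s * y)]
   absorbs [Z ^+ 2], the other dominates [expR |b * Z|]. *)
pose s := t0 / 2; have s0 : 0 < s by rewrite /s divr_gt0.
have m1 := m_ge1.
pose c := expR (t0 * s2) * (4 / s ^+ 2).
have c0 : 0 <= c by rewrite mulr_ge0 ?expR_ge0// divr_ge0// sqr_ge0.
have si0 : 0 < s^-1 by rewrite invr_gt0.
pose C := 1 + s^-1 + c * m.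
have cm0 : 0 <= c * m by apply: mulr_ge0 => //; lra.
have C1 : 1 <= C by rewrite /C; lra.
exists C => // b bC.
have bs : `|b| <= s.
  apply: le_trans bC _; rewrite -[leRHS]invrK lef_pV2 ?posrE//; rewrite /C; lra.
pose Z w := W w ^+ 2 - s2.
have mZ : measurable_fun setT Z by apply: measurable_funB => //; exact: measurable_funX.
have pw w : expR (b * Z w) <= 1 + b * Z w + b ^+ 2 * c * expR (t0 * W w ^+ 2).
  apply: le_trans (expR_le_quadratic_abs _) _; rewrite lerD2l exprMn.
  pose y := W w ^+ 2 + s2.
  have y0 : 0 <= y by rewrite addr_ge0 ?sqr_ge0.
  have Zy : `|Z w| <= y.
    by rewrite ler_norml /Z /y; have := sqr_ge0 (W w) => h; apply/andP; split; lra.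
  have h1 : expR `|b * Z w| <= expR (s * y).
    by rewrite ler_expR normrM ler_pM.
  have h2 : Z w ^+ 2 <= 2 / s ^+ 2 * expR (s * y).
    rewrite -mulrAC ler_pdivlMr ?exprn_gt0//.
    have h3 : Z w ^+ 2 <= y ^+ 2 by rewrite -real_normK ?num_real// lerXn2r// nnegrE.
    have := expR_gt_quadratic (mulr_ge0 (ltW s0) y0); rewrite exprMn => h4.
    apply: le_trans (ler_wpM2r (sqr_ge0 s) h3) _; lra.
  have h5 : expR (t0 * s2) * expR (t0 * W w ^+ 2) = expR (s * y) * expR (s * y).
    by rewrite -!expRD /s /y; congr expR; field.
  have h6 : Z w ^+ 2 * expR `|b * Z w| <= 2 / s ^+ 2 * expR (s * y) * expR (s * y).
    by apply: ler_pM h2 h1; [exact: sqr_ge0|exact: expR_ge0].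
  have -> : b ^+ 2 * c * expR (t0 * W w ^+ 2) =
      b ^+ 2 * (2 * (2 / s ^+ 2 * expR (s * y) * expR (s * y))).
    by rewrite -[_ * expR (s * y) * _]mulrA -h5 /c; ring.
  have -> : 2 * (b ^+ 2 * Z w ^+ 2) * expR `|b * Z w| =
      b ^+ 2 * (2 * (Z w ^+ 2 * expR `|b * Z w|)) by ring.
  by apply: ler_wpM2l; [exact: sqr_ge0|apply: ler_wpM2l].
have i0 := integrable_one 1.
have iZ : P.-integrable setT (EFin \o Z).
  exact: (integrableB measurableT integrable_quad (integrable_one s2)).
have i1 := integrableZl measurableT b iZ.
have i01 := integrableD measurableT i0 i1.
have i2 := integrableZl measurableT (b ^+ 2 * c) integrable_exp_sqr.
have i3 := integrableD measurableT i01 i2.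
apply: (@le_trans _ _ (\int[P]_w (1 + b * Z w + b ^+ 2 * c * expR (t0 * W w ^+ 2))%:E)%E).
  apply: ge0_le_integral => //.
  - apply/measurable_EFinP; apply: measurableT_comp => //; exact: measurable_funM.
  - by have /integrableP[] := i3.
  - by move=> w _; rewrite lee_fin; exact: pw.
rewrite (EFin_Rintegral i3) lee_fin RintegralD// RintegralD// !RintegralZl//; last first.
  exact: integrable_exp_sqr.
have -> : E Z = 0.
  rewrite RintegralB//; [|exact: integrable_quad|exact: integrable_one].
  by rewrite E_quad E_one subrr.
rewrite E_one mulr0 addr0; apply: le_trans (expR_ge1Dx _) _; rewrite ler_expR -/m.
have := sqr_ge0 b => b20; rewrite -mulrA mulrC ler_wpM2r// /C; lra.
Qed.

End gaussian_tail.

(** * Moment generating functions of AR(1) functionals *)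

Section step.
Context {R : realType} {d : measure_display} {T : measurableType d}.
Variables (P : probability T R) (V : nat -> T -> R).
Hypothesis mV : forall k, measurable_fun setT (V k).
Hypothesis indep : mutually_independent P V.
Hypothesis idV : identically_distributed P V.

Lemma integral_step k (h a : past V k -> R) (g : R * R -> R) :
  measurable_fun setT h -> measurable_fun setT a -> measurable_fun setT g ->
  (forall w, 0 <= h w) -> (forall x, 0 <= g x) ->
  (\int[P]_w (h w * g (a w, V k w))%:E =
   \int[P]_w ((h w)%:E * \int[P]_w' (g (a w, V 0%N w'))%:E))%E.
Proof.
move=> mh ma mg h0 g0.
pose f (p : past V k * R) := (h p.1 * g (a p.1, p.2))%:E.
have mf : measurable_fun setT f.
  apply/measurable_EFinP; apply: measurable_funM; first exact: measurableT_comp.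
  apply: measurableT_comp => //; apply: measurable_fun_pair => //.
  exact: measurableT_comp.
have f0 x : (0 <= f x)%E by rewrite lee_fin mulr_ge0.
rewrite (integral_freeze mV indep mf f0); apply: eq_integral => w _.
have mgw : measurable_fun setT (fun v => (g (a w, v))%:E).
  have mc : measurable_fun setT (fun v : R => (a w, v)).
    by apply: measurable_fun_pair => //; exact: measurable_cst.
  by apply/measurable_EFinP; exact: (measurableT_comp mg mc).
rewrite /f /=; under eq_integral do rewrite EFinM.
rewrite ge0_integralZl_EFin//.
- congr (_ * _)%E.
  apply: (integral_identically_distributed mV k idV mgw) => x.
  by rewrite lee_fin.
- by move=> x _; rewrite lee_fin.
- by move: mgw => /measurableT_comp; apply.
Qed.

Lemma measurable_integral_innov (g : R * R -> R) :
  measurable_fun setT g -> (forall x, 0 <= g x) ->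
  measurable_fun setT (fun x => \int[P]_w (g (x, V 0%N w))%:E)%E.
Proof.
move=> mg g0.
have mf : measurable_fun setT (fun p : R * T => (g (p.1, V 0%N p.2))%:E).
  apply/measurable_EFinP; apply: measurableT_comp => //.
  by apply: measurable_fun_pair => //; exact: measurableT_comp.
apply: (@measurable_fun_fubini_tonelli_F _ _ _ _ R P _ mf) => x.
by rewrite lee_fin.
Qed.

Lemma measurable_exp_quad2 (b : R) :
  measurable_fun setT (fun p : R * R => expR (p.1 * p.2 + b * p.2 ^+ 2)).
Proof.
apply: measurableT_comp => //; apply: measurable_funD; apply: measurable_funM => //.
exact: measurable_funX.
Qed.

(** The bound is assumed for every deterministic [x], because the coefficient [a w] of the new
    innovation is random but known from the past. *)
Lemma integral_step_le k (h a : past V k -> R) (b C c : R) :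
  measurable_fun setT h -> measurable_fun setT a -> (forall w, 0 <= h w) ->
  (forall x : R, \int[P]_w (expR (x * V 0%N w + b * V 0%N w ^+ 2))%:E <=
     (expR (C * x ^+ 2 + c))%:E)%E ->
  (\int[P]_w (h w * expR (a w * V k w + b * V k w ^+ 2))%:E <=
   \int[P]_w (h w * expR (C * a w ^+ 2 + c))%:E)%E.
Proof.
move=> mh ma h0 H.
have mg := measurable_exp_quad2 b.
set g := (X in measurable_fun _ X) in mg.
have g0 x : 0 <= g x by exact: expR_ge0.
rewrite (integral_step mh ma mg h0)//.
have m1 : measurable_fun setT (fun w : past V k =>
    ((h w)%:E * \int[P]_w' (g (a w, V 0%N w'))%:E)%E).
  apply: emeasurable_funM; first exact/measurable_EFinP.
  exact: (measurableT_comp (measurable_integral_innov mg g0)).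
have m2 : measurable_fun setT (fun w : past V k => (h w * expR (C * a w ^+ 2 + c))%:E).
  apply/measurable_EFinP; apply: measurable_funM => //; apply: measurableT_comp => //.
  apply: measurable_funD => //; apply: measurable_funM => //; exact: measurable_funX.
apply: ge0_le_integral => //.
- move=> w _; rewrite mule_ge0 ?lee_fin// integral_ge0// => w' _.
  by rewrite lee_fin.
- exact: (past_measurable_fun mV m1).
- exact: (past_measurable_fun mV m2).
- by move=> w _; rewrite EFinM lee_wpmul2l ?lee_fin//; exact: H.
Qed.

Lemma past_measurable_ar (r : R) k n : (k <= n)%N ->
  measurable_fun setT (eps_ar r V k : past V n -> R).
Proof.
elim: k => [|k IH] kn /=; first exact: measurable_cst.
apply: measurable_funD.
  by apply: measurable_funM => //; apply: IH; exact: ltnW.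
exact: measurable_past_innov.
Qed.

Lemma past_measurable_sum n (f : nat -> past V n -> R) :
  (forall k, (k < n)%N -> measurable_fun setT (f k)) ->
  measurable_fun setT (fun w => \sum_(0 <= k < n) f k w).
Proof.
move=> mf; rewrite (_ : (fun w => _) = (fun w => \sum_(k < n) f k w)).
  by apply: measurable_sum => i; exact: mf.
by apply/funext => w; rewrite big_mkord.
Qed.

Variable C : R.
Hypothesis C_ge1 : 1 <= C.
Hypothesis mgfV : forall a b : R, 0 <= b -> b <= C^-1 ->
  (\int[P]_w (expR (a * V 0%N w + b * V 0%N w ^+ 2))%:E <=
   (expR (C * a ^+ 2 + C * b))%:E)%E.

Definition ar_mart (r : R) n (w : T) := \sum_(0 <= k < n) eps_ar r V k w * V k w.

Lemma past_measurable_ar_mart (r : R) m n : (m <= n)%N ->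
  measurable_fun setT (ar_mart r m : past V n -> R).
Proof.
move=> mn; rewrite (_ : ar_mart r m = fun w => \sum_(k < m) eps_ar r V k w * V k w).
  apply: measurable_sum => i; have im := leq_trans (ltn_ord i) mn.
  by apply: measurable_funM; [exact: (past_measurable_ar r (ltnW im))|exact: measurable_past_innov].
by apply/funext => w; rewrite /ar_mart big_mkord.
Qed.

(** Integrating out the last innovation leaves a quadratic term in the state, so the martingale
    alone does not give an induction. Hence [key] carries [A * eps_ar ^+ 2] in the exponent. The
    choice of [A] makes this term reproduce itself: [A <= |u| / 2] gives
    [|u + 2 * A * r| <= 2 * |u|], so [A * r ^+ 2 + C * (u + 2 * A * r) ^+ 2 <= A], and each step
    costs only a factor [expR (C * A)]. *)
Lemma mgf_ar_mart (r u : R) n : `|r| < 1 -> 8 * C * `|u| <= 1 - r ^+ 2 ->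
  (\int[P]_w (expR (u * ar_mart r n w))%:E <=
   (expR (n%:R * (4 * C ^+ 2 * u ^+ 2 / (1 - r ^+ 2))))%:E)%E.
Proof.
move=> r1 uh.
set h := 1 - r ^+ 2 in uh *.
have r2 : r ^+ 2 < 1.
  by rewrite -real_normK ?num_real// expr_lt1.
have h0 : 0 < h by rewrite /h; lra.
have h1 : h <= 1 by rewrite /h; have := sqr_ge0 r; lra.
have C0 : 0 < C by have := C_ge1; lra.
have u0 := normr_ge0 u.
pose A := 4 * C * u ^+ 2 / h.
have uu : u ^+ 2 = `|u| ^+ 2 by rewrite real_normK ?num_real.
have A0 : 0 <= A by rewrite /A divr_ge0 ?(ltW h0)// mulr_ge0 ?sqr_ge0//; lra.
have A2 : A <= `|u| / 2.
  rewrite /A ler_pdivrMr// uu.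
  have : `|u| * (8 * C * `|u|) <= `|u| * h by rewrite ler_wpM2l.
  by lra.
have AC : A <= C^-1.
  have : 8 * C * `|u| <= 1 by lra.
  rewrite -[C^-1]mul1r ler_pdivlMr//; have := ler_wpM2r (ltW C0) A2; lra.
have key m : (\int[P]_w (expR (u * ar_mart r m w + A * eps_ar r V m w ^+ 2))%:E <=
   (expR (m%:R * (C * A)))%:E)%E.
  elim: m => [|m IH].
    under eq_integral do rewrite /ar_mart big_geq//= expr0n /= !mulr0 addr0 expR0.
    by rewrite mul0r expR0 integral_cst//= probability_setT mul1e.
  pose hh w := expR (u * ar_mart r m w + A * r ^+ 2 * eps_ar r V m w ^+ 2).
  pose aa w := (u + 2 * A * r) * eps_ar r V m w.
  have mY := past_measurable_ar r (leqnn m).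
  have mN := past_measurable_ar_mart r (leqnn m).
  have mhh : measurable_fun setT (hh : past V m -> R).
    apply: measurableT_comp => //; apply: measurable_funD; apply: measurable_funM => //.
    exact: measurable_funX.
  have maa : measurable_fun setT (aa : past V m -> R) by exact: measurable_funM.
  have mhh0 w : 0 <= hh w by exact: expR_ge0.
  have := integral_step_le mhh maa mhh0 (fun x => mgfV x A0 AC).
  rewrite (eq_integral (fun w => (expR (u * ar_mart r m.+1 w +
     A * eps_ar r V m.+1 w ^+ 2))%:E)); last first.
    move=> w _; rewrite /hh /aa -expRD; congr (expR _)%:E.
    by rewrite /ar_mart big_nat_recr//=; ring.
  move=> /le_trans; apply.
  apply: (@le_trans _ _ (\int[P]_w ((expR (C * A))%:E *
    (expR (u * ar_mart r m w + A * eps_ar r V m w ^+ 2))%:E))%E).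
    apply: ge0_le_integral => //.
    - by move=> w _; rewrite lee_fin mulr_ge0 ?expR_ge0.
    - apply/measurable_EFinP; apply: measurable_funM.
        exact: (past_measurable_fun mV mhh).
      apply: measurableT_comp => //; apply: measurable_funD => //.
      apply: measurable_funM => //; apply: measurable_funX.
      exact: (past_measurable_fun mV maa).
    - apply/measurable_EFinP; apply: measurable_funM => //.
      apply: measurableT_comp => //; apply: measurable_funD => //.
        apply: measurable_funM => //; exact: (past_measurable_fun mV mN).
      apply: measurable_funM => //; apply: measurable_funX.
      exact: (past_measurable_fun mV mY).
    move=> w _; rewrite lee_fin /hh /aa -!expRD ler_expR.
    have y0 := sqr_ge0 (eps_ar r V m w).
    have : A * r ^+ 2 + C * (u + 2 * A * r) ^+ 2 <= A.
      have b1 : `|u + 2 * A * r| <= 2 * `|u|.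
        apply: le_trans (ler_normD _ _) _.
        have A20 : 0 <= 2 * A by apply: mulr_ge0.
        rewrite [`|2 * A * r|]normrM (ger0_norm A20).
        have : A * `|r| <= A by rewrite ler_piMr// ltW.
        lra.
      have b2 : (u + 2 * A * r) ^+ 2 <= 4 * u ^+ 2.
        rewrite -real_normK ?num_real// uu.
        apply: le_trans (_ : (2 * `|u|) ^+ 2 <= _); last by rewrite exprMn; lra.
        by rewrite lerXn2r// nnegrE mulr_ge0.
      have b3 : A * h = 4 * C * u ^+ 2 by rewrite /A mulfVK// gt_eqF.
      have b4 : C * (u + 2 * A * r) ^+ 2 <= A * h.
        by rewrite b3; move: (ler_wpM2l (ltW C0) b2); lra.
      by move: b4; rewrite /h; lra.
    move=> b5; have := ler_wpM2r y0 b5; rewrite exprMn; lra.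
  rewrite ge0_integralZl_EFin ?expR_ge0//; first last.
  - apply/measurable_EFinP; apply: measurableT_comp => //; apply: measurable_funD => //.
      apply: measurable_funM => //; exact: (past_measurable_fun mV mN).
    apply: measurable_funM => //; apply: measurable_funX.
    exact: (past_measurable_fun mV mY).
  apply: le_trans (lee_wpmul2l _ IH) _; first by rewrite lee_fin expR_ge0.
  by rewrite -EFinM lee_fin -expRD ler_expR -natr1; lra.
apply: le_trans (_ : _ <= (expR (n%:R * (C * A)))%:E)%E _; last first.
  by rewrite lee_fin ler_expR ler_wpM2l// /A le_eqVlt; apply/orP; left; apply/eqP; ring.
apply: le_trans (key n); apply: ge0_le_integral => //.
- apply/measurable_EFinP; apply: measurableT_comp => //; apply: measurable_funM => //.
  exact: (past_measurable_fun mV (past_measurable_ar_mart r (leqnn n))).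
- apply/measurable_EFinP; apply: measurableT_comp => //; apply: measurable_funD => //.
    apply: measurable_funM => //.
    exact: (past_measurable_fun mV (past_measurable_ar_mart r (leqnn n))).
  apply: measurable_funM => //; apply: measurable_funX.
  exact: (past_measurable_fun mV (past_measurable_ar r (leqnn n))).
- by move=> w _; rewrite lee_fin ler_expR lerDl mulr_ge0 ?sqr_ge0.
Qed.

(** The induction is for all [A]: one step back in time replaces [A] by [A' <= A * (1 - h / 2)] with
    [h = 1 - r ^+ 2], at cost [C * A]. The costs form a geometric series, so the bound is uniform in
    [n]. *)
Lemma mgf_ar_sqr (r A : R) n : `|r| < 1 -> 0 <= A -> 8 * C * A <= 1 - r ^+ 2 ->
  (\int[P]_w (expR (A * eps_ar r V n w ^+ 2))%:E <=
   (expR (2 * C * A / (1 - r ^+ 2)))%:E)%E.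
Proof.
move=> r1; set h := 1 - r ^+ 2.
have r2 : r ^+ 2 < 1.
  by rewrite -real_normK ?num_real// expr_lt1.
have h0 : 0 < h by rewrite /h; lra.
have h1 : h <= 1 by rewrite /h; have := sqr_ge0 r; lra.
have C0 : 0 < C by have := C_ge1; lra.
elim: n A => [|n IH] A A0 Ah.
  under eq_integral do rewrite /= expr0n /= mulr0 expR0.
  rewrite integral_cst//= probability_setT mul1e lee_fin -[leLHS]expR0 ler_expR.
  by rewrite divr_ge0 ?(ltW h0)// !mulr_ge0// ltW.
have AC : A <= C^-1 by rewrite -[C^-1]mul1r ler_pdivlMr//; nra.
pose hh w := expR (A * r ^+ 2 * eps_ar r V n w ^+ 2).
pose aa w := (2 * A * r) * eps_ar r V n w.
have mY := past_measurable_ar r (leqnn n).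
have mhh : measurable_fun setT (hh : past V n -> R).
  apply: measurableT_comp => //; apply: measurable_funM => //.
  exact: measurable_funX.
have maa : measurable_fun setT (aa : past V n -> R) by exact: measurable_funM.
have mhh0 w : 0 <= hh w by exact: expR_ge0.
have := integral_step_le mhh maa mhh0 (fun x => mgfV x A0 AC).
rewrite (eq_integral (fun w => (expR (A * eps_ar r V n.+1 w ^+ 2))%:E)); last first.
  by move=> w _; rewrite /hh /aa -expRD; congr (expR _)%:E => /=; ring.
move=> /le_trans; apply.
pose A' := A * r ^+ 2 * (1 + 4 * C * A).
have A'0 : 0 <= A'.
  have CA0 : 0 <= 4 * C * A by apply: mulr_ge0 => //; lra.
  by apply: mulr_ge0; [apply: mulr_ge0 => //; exact: sqr_ge0|lra].
have A'A : A' <= A * (1 - h / 2).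
  rewrite /A' -mulrA; apply: ler_wpM2l => //.
  have -> : r ^+ 2 = 1 - h by rewrite /h; ring.
  by nra.
have A'h : 8 * C * A' <= h.
  apply: le_trans Ah; rewrite ler_wpM2l//; first by rewrite mulr_ge0// ltW.
  by apply: le_trans A'A _; rewrite ler_piMr//; lra.
rewrite (eq_integral (fun w => ((expR (C * A))%:E * (expR (A' * eps_ar r V n w ^+ 2))%:E)%E)); last first.
  by move=> w _; rewrite /hh /aa -EFinM -!expRD /A'; congr (expR _)%:E; ring.
rewrite ge0_integralZl_EFin ?expR_ge0//; first last.
- apply/measurable_EFinP; apply: measurableT_comp => //.
  apply: measurable_funM => //; apply: measurable_funX.
  exact: (past_measurable_fun mV mY).
apply: le_trans (lee_wpmul2l _ (IH _ A'0 A'h)) _; first by rewrite lee_fin expR_ge0.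
rewrite -EFinM lee_fin -expRD ler_expR.
have -> : C * A = C * A * h / h by rewrite mulfK// gt_eqF.
rewrite -mulrDl ler_wpM2r ?invr_ge0 ?(ltW h0)//.
have := ler_wpM2l (ltW C0) A'A; lra.
Qed.

Lemma mgf_sum_sqr (s2 C' b : R) n :
  (\int[P]_w (expR (b * (V 0%N w ^+ 2 - s2)))%:E <= (expR (C' * b ^+ 2))%:E)%E ->
  (\int[P]_w (expR (b * \sum_(0 <= k < n) (V k w ^+ 2 - s2)))%:E <=
   (expR (n%:R * (C' * b ^+ 2)))%:E)%E.
Proof.
move=> H.
have mS k : measurable_fun setT
    ((fun w => expR (b * \sum_(0 <= i < k) (V i w ^+ 2 - s2))) : past V k -> R).
  apply: measurableT_comp => //; apply: measurable_funM => //.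
  apply: past_measurable_sum => i ik; apply: measurable_funB => //.
  by apply: measurable_funX; exact: measurable_past_innov.
elim: n => [|n IH].
  under eq_integral do rewrite big_geq// mulr0 expR0.
  by rewrite integral_cst//= probability_setT mul1e mul0r expR0.
pose g (p : R * R) := expR (b * (p.2 ^+ 2 - s2)).
have mg : measurable_fun setT g.
  apply: measurableT_comp => //; apply: measurable_funM => //.
  by apply: measurable_funB => //; exact: measurable_funX.
have g0 x : 0 <= g x by exact: expR_ge0.
have h0 w : 0 <= expR (b * \sum_(0 <= i < n) (V i w ^+ 2 - s2)) by exact: expR_ge0.
have ma0 : measurable_fun setT ((fun=> 0) : past V n -> R) by exact: measurable_cst.
have := integral_step (mS n) ma0 mg h0 g0.
rewrite (eq_integral (fun w => (expR (b * \sum_(0 <= k < n.+1) (V k w ^+ 2 - s2)))%:E)); last first.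
  by move=> w _; congr (_%:E); rewrite /g /= big_nat_recr//= -expRD; congr expR; ring.
move=> ->; rewrite /g /=.
apply: (@le_trans _ _ (\int[P]_w ((expR (C' * b ^+ 2))%:E *
   (expR (b * \sum_(0 <= k < n) (V k w ^+ 2 - s2)))%:E))%E).
  apply: ge0_le_integral => //.
  - move=> w _; apply: mule_ge0; first by rewrite lee_fin expR_ge0.
    by apply: integral_ge0 => w' _; rewrite lee_fin expR_ge0.
  - apply: emeasurable_funM => //; apply/measurable_EFinP.
    exact: (past_measurable_fun mV (mS n)).
  - apply: emeasurable_funM => //; apply/measurable_EFinP.
    exact: (past_measurable_fun mV (mS n)).
  - by move=> w _; rewrite muleC; apply: lee_wpmul2r => //; rewrite lee_fin expR_ge0.
rewrite ge0_integralZl_EFin ?expR_ge0//; first last.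
  by apply/measurable_EFinP; exact: (past_measurable_fun mV (mS n)).
apply: le_trans (lee_wpmul2l _ IH) _; first by rewrite lee_fin expR_ge0.
by rewrite -EFinM lee_fin -expRD ler_expR -natr1; lra.
Qed.

Lemma mgf_exp_mart (L : R -> R) (X : nat -> T -> R) (u : R) n :
  measurable_fun setT L ->
  (forall x : R, \int[P]_w (expR (x * V 0%N w))%:E = (expR (L x))%:E)%E ->
  (forall i j, (i <= j)%N -> measurable_fun setT (X i : past V j -> R)) ->
  (\int[P]_w (expR (u * \sum_(0 <= k < n) X k w * V k w -
    \sum_(0 <= k < n) L (u * X k w)))%:E = 1)%E.
Proof.
move=> mL HL mX.
pose D k w := expR (u * \sum_(0 <= i < k) X i w * V i w - \sum_(0 <= i < k) L (u * X i w)).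
have mD k : measurable_fun setT (D k : past V k -> R).
  apply: measurableT_comp => //; apply: measurable_funB.
    apply: measurable_funM => //; apply: past_measurable_sum => i ik.
    by apply: measurable_funM; [apply: mX; exact: ltnW|exact: measurable_past_innov].
  apply: past_measurable_sum => i ik; apply: measurableT_comp => //.
  by apply: measurable_funM => //; apply: mX; exact: ltnW.
elim: n => [|n IH].
  under eq_integral do rewrite !big_geq// mulr0 subr0 expR0.
  by rewrite integral_cst//= probability_setT mul1e.
pose g (p : R * R) := expR (p.1 * p.2 - L p.1).
have mg : measurable_fun setT g.
  apply: measurableT_comp => //; apply: measurable_funB; first exact: measurable_funM.
  exact: measurableT_comp.
have g0 x : 0 <= g x by exact: expR_ge0.
have h0 w : 0 <= D n w by exact: expR_ge0.
have ma : measurable_fun setT ((fun w => u * X n w) : past V n -> R).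
  by apply: measurable_funM => //; exact: mX.
have := integral_step (mD n) ma mg h0 g0.
rewrite (eq_integral (fun w => (D n.+1 w)%:E)); last first.
  move=> w _; congr (_%:E); rewrite /g /D /= !big_nat_recr//= -expRD; congr expR; ring.
rewrite /D => ->; rewrite -[RHS]IH; apply: eq_integral => w _.
rewrite (_ : \int[P]_w' _ = 1)%E ?mule1// /g /=.
under eq_integral do rewrite expRD mulrC EFinM.
rewrite ge0_integralZl_EFin ?expR_ge0//.
  by rewrite HL -EFinM -expRD addNr expR0.
apply/measurable_EFinP; apply: measurableT_comp => //; exact: measurable_funM.
Qed.

End step.

(** * Superexponential convergence and quadratic LDPs *)

Section elog_lims.
Context {R : realType}.

Lemma limn_esup_le_near (u : nat -> \bar R) (l : \bar R) :
  (\forall n \near \oo, (u n <= l)%E) -> (limn_esup u <= l)%E.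
Proof.
move=> ul; rewrite /limn_esup /limf_esup; apply: ge_ereal_inf.
exists (ereal_sup (u @` [set n | (u n <= l)%E])).
  by exists [set n | (u n <= l)%E].
by apply: ge_ereal_sup => _ [n /= nl <-].
Qed.

Lemma limn_einf_ge_near (u : nat -> \bar R) (l : \bar R) :
  (\forall n \near \oo, (l <= u n)%E) -> (l <= limn_einf u)%E.
Proof.
move=> ul; rewrite /limn_einf leeNr; apply: limn_esup_le_near.
by apply: filterS ul => n; rewrite /= leeN2.
Qed.

Lemma elog_le (p : \bar R) (c : R) : (p <= (expR c)%:E)%E -> (elog p <= c%:E)%E.
Proof.
case: p => [r| |] //=; rewrite ?leNye ?leey//.
rewrite lee_fin => rc; case: ifPn => [r0|_]; last by rewrite leNye.
by rewrite lee_fin -ler_expR lnK.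
Qed.

Lemma elog_ge (p : \bar R) (c : R) : ((expR c)%:E <= p)%E -> (c%:E <= elog p)%E.
Proof.
case: p => [r| |] //=; rewrite ?leNye ?leey//.
rewrite lee_fin => rc; have r0 : 0 < r by apply: lt_le_trans rc; exact: expR_gt0.
by rewrite r0 lee_fin -ler_expR lnK.
Qed.

End elog_lims.

Section superexp.
Context {R : realType} {d : measure_display} {T : measurableType d}.
Variables (P : probability T R) (s : nat -> R).
Hypothesis s_gt0 : forall n, 0 < s n.
Hypothesis s_cvg : s @ \oo --> +oo.

Lemma speed_ge (K : R) : \forall n \near \oo, K <= s n.
Proof. by move/cvgryPge : s_cvg; exact. Qed.

(** Asking for the rate [K + 1] on each set leaves a spare factor [expR (- s n) <= 1 / 2], which
    absorbs the 2 of the union bound. The closure lemmas below therefore call their hypotheses at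
    [K + 1]. *)
Lemma measure_setU_superexp (K : R) n (N M : set T) : measurable N -> measurable M ->
  ln 2 <= s n -> (P N <= (expR (- (K + 1) * s n))%:E)%E ->
  (P M <= (expR (- (K + 1) * s n))%:E)%E -> (P (N `|` M) <= (expR (- K * s n))%:E)%E.
Proof.
move=> mN mM sn PN PM; apply: (le_trans (measureU2 P mN mM)).
apply: le_trans (leeD PN PM) _.
rewrite -EFinD lee_fin.
have -> : expR (- (K + 1) * s n) = expR (- K * s n) * expR (- s n).
  by rewrite -expRD; congr expR; ring.
rewrite -mulrDr ler_piMr ?expR_ge0//.
have : expR (- s n) <= 2^-1.
  by rewrite expRN lef_pV2 ?posrE ?expR_gt0// -[leLHS]lnK ?posrE// ler_expR.
by lra.
Qed.

Lemma measurable_set_ge (Z : T -> R) (a : R) : measurable_fun setT Z ->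
  measurable [set w | a <= Z w].
Proof.
move=> mZ.
have := measurable_fun_ler (@measurable_cst _ _ _ _ _ a) mZ.
by move=> /(_ measurableT [set true] I); rewrite setTI.
Qed.

Lemma measurable_set_lt (Z : T -> R) (a : R) : measurable_fun setT Z ->
  measurable [set w | Z w < a].
Proof.
move=> mZ.
have := measurable_fun_ltr mZ (@measurable_cst _ _ _ _ _ a).
by move=> /(_ measurableT [set true] I); rewrite setTI.
Qed.

(* The enclosing measurable set spares measurability proofs for the events. *)
Definition superexp_small (E : nat -> set T) := forall K : R,
  \forall n \near \oo, exists2 N : set T, measurable N &
    E n `<=` N /\ (P N <= (expR (- K * s n))%:E)%E.

Lemma superexp_small_sub (E F : nat -> set T) :
  (\forall n \near \oo, E n `<=` F n) -> superexp_small F -> superexp_small E.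
Proof.
move=> EF sF K; apply: filterS2 EF (sF K) => n EFn [N mN [FN PN]].
by exists N => //; split => //; exact: subset_trans FN.
Qed.

Lemma superexp_smallU (E F : nat -> set T) :
  superexp_small E -> superexp_small F -> superexp_small (fun n => E n `|` F n).
Proof.
move=> sE sF K.
have := speed_ge (ln 2).
apply: filterS3 (sE (K + 1)) (sF (K + 1)) => n [N mN [EN PN]] [M mM [FM PM]] sn.
exists (N `|` M); first exact: measurableU.
split; first exact: setUSS.
exact: measure_setU_superexp.
Qed.

Definition superexp_cvg (Z : nat -> T -> R) (z : R) := forall e : R, 0 < e ->
  superexp_small (fun n => [set w | e < `|Z n w - z|]).

(** Exponential tightness at speed [s]: the level [B] may depend on the rate [K], as it must for a
    sequence with a nontrivial LDP at this speed. *)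
Definition superexp_tight (Z : nat -> T -> R) := forall K : R, exists B : R,
  \forall n \near \oo, exists2 N : set T, measurable N &
    [set w | B < `|Z n w|] `<=` N /\ (P N <= (expR (- K * s n))%:E)%E.

Lemma superexp_cvg_ext (Z Y : nat -> T -> R) z :
  (\forall n \near \oo, forall w, Z n w = Y n w) -> superexp_cvg Z z -> superexp_cvg Y z.
Proof.
move=> ZY cZ e e0; apply: superexp_small_sub (cZ e e0).
by apply: filterS ZY => n h w /=; rewrite h.
Qed.

Lemma superexp_cvg_seq (z : nat -> R) (l : R) :
  z @ \oo --> l -> superexp_cvg (fun n _ => z n) l.
Proof.
move=> zl e e0 K; move/cvgrPdist_le : zl => /(_ e e0); apply: filterS => n ne.
exists set0 => //; split; last by rewrite measure0 lee_fin expR_ge0.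
by move=> w /=; rewrite distrC ltNge ne.
Qed.

Lemma superexp_cvg_cst (l : R) : superexp_cvg (fun=> fun=> l) l.
Proof. by apply: superexp_cvg_seq; exact: cvg_cst. Qed.

(** The continuous mapping principle: only continuity of [f] at the limit point is required, so
    division is covered although [Z n] may vanish on a negligible event. *)
Lemma superexp_cvg2 (f : R -> R -> R) (Z Y : nat -> T -> R) (z y : R) :
  (forall e : R, 0 < e -> exists2 h : R, 0 < h & forall a b, `|a - z| <= h -> `|b - y| <= h ->
    `|f a b - f z y| <= e) ->
  superexp_cvg Z z -> superexp_cvg Y y ->
  superexp_cvg (fun n w => f (Z n w) (Y n w)) (f z y).
Proof.
move=> cf cZ cY e e0; have [h h0 H] := cf e e0.
apply: superexp_small_sub (superexp_smallU (cZ h h0) (cY h h0)).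
apply: nearW => n w /=.
have [Zh|Zh] := leP `|Z n w - z| h; last by left.
have [Yh|Yh] := leP `|Y n w - y| h; last by right.
by rewrite ltNge H.
Qed.

Lemma superexp_cvgD (Z Y : nat -> T -> R) (z y : R) :
  superexp_cvg Z z -> superexp_cvg Y y ->
  superexp_cvg (fun n w => Z n w + Y n w) (z + y).
Proof.
apply: superexp_cvg2 => e e0; exists (e / 2); first by rewrite divr_gt0.
move=> a b az bY; rewrite opprD addrACA.
by apply: le_trans (ler_normD _ _) _; lra.
Qed.

Lemma superexp_cvgM (Z Y : nat -> T -> R) (z y : R) :
  superexp_cvg Z z -> superexp_cvg Y y ->
  superexp_cvg (fun n w => Z n w * Y n w) (z * y).
Proof.
apply: superexp_cvg2 => e e0.
pose D := 1 + `|z| + `|y|; have z0 := normr_ge0 z; have y0 := normr_ge0 y.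
have D0 : 0 < D by rewrite /D; lra.
pose h := Num.min 1 (e / D).
have h0 : 0 < h by rewrite lt_min ltr01 divr_gt0.
exists h => // a b az bY.
have h1 : h <= 1 by rewrite ge_min lexx.
have hD : h * D <= e by rewrite -ler_pdivlMr// ge_min lexx orbT.
have -> : a * b - z * y = (a - z) * (b - y) + (a - z) * y + z * (b - y) by ring.
apply: le_trans (ler_normD _ _) _.
apply: le_trans (lerD (ler_normD _ _) (lexx _)) _; rewrite !normrM.
have i1 : `|a - z| * `|b - y| <= h * 1 by apply: ler_pM => //; exact: le_trans h1.
have i2 : `|a - z| * `|y| <= h * `|y| by apply: ler_wpM2r.
have i3 : `|z| * `|b - y| <= `|z| * h by apply: ler_wpM2l.
by move: hD; rewrite /D; lra.
Qed.

Lemma superexp_cvgN (Z : nat -> T -> R) (z : R) :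
  superexp_cvg Z z -> superexp_cvg (fun n w => - Z n w) (- z).
Proof. by move=> cZ e e0; under eq_fun do under eq_set do rewrite -opprD normrN; exact: cZ. Qed.

Lemma superexp_cvgV (Z : nat -> T -> R) (z : R) : z != 0 ->
  superexp_cvg Z z -> superexp_cvg (fun n w => (Z n w)^-1) z^-1.
Proof.
move=> z0 cZ; have nz : 0 < `|z| by rewrite normr_gt0.
apply: (@superexp_cvg2 (fun a _ => a^-1) Z Z z z _ cZ cZ) => e e0.
pose h := Num.min (`|z| / 2) (e * `|z| ^+ 2 / 2).
have h0 : 0 < h by rewrite lt_min !divr_gt0// mulr_gt0// exprn_gt0.
exists h => // a _ az _.
have hz : h <= `|z| / 2 by rewrite ge_min lexx.
have he : h <= e * `|z| ^+ 2 / 2 by rewrite ge_min lexx orbT.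
have a2 : `|z| / 2 <= `|a|.
  have : `|z| <= `|z - a| + `|a| by have := ler_normD (z - a) a; rewrite subrK.
  by rewrite distrC; lra.
have a0 : a != 0 by rewrite -normr_gt0; lra.
have -> : a^-1 - z^-1 = (z - a) / (a * z) by field; rewrite a0 z0.
rewrite normrM normfV normrM distrC ler_pdivrMr ?mulr_gt0//; last by lra.
apply: le_trans az _; apply: le_trans he _.
rewrite (_ : e * `|z| ^+ 2 / 2 = e * (`|z| / 2 * `|z|)); last by ring.
by rewrite ler_wpM2l ?(ltW e0)// ler_wpM2r// ltW.
Qed.

Lemma superexp_cvg_tight (Z : nat -> T -> R) (z : R) :
  superexp_cvg Z z -> superexp_tight Z.
Proof.
move=> cZ K; exists (`|z| + 1); apply: filterS (cZ 1 ltr01 K) => n [N mN [ZN PN]].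
exists N => //; split => //; apply: subset_trans ZN => w /= h.
have : `|Z n w| <= `|Z n w - z| + `|z| by have := ler_normD (Z n w - z) z; rewrite subrK.
lra.
Qed.

(** A Slutsky argument: the rate fixes the level [B] for [Z] first, and then [Y] is asked to be
    below [e / (|B| + 1)]. *)
Lemma superexp_tightM_cvg0 (Z Y : nat -> T -> R) :
  superexp_tight Z -> superexp_cvg Y 0 -> superexp_cvg (fun n w => Z n w * Y n w) 0.
Proof.
move=> tZ cY e e0 K.
have [B HB] := tZ (K + 1).
have B1 : 0 < `|B| + 1 by have := normr_ge0 B; lra.
have eB : 0 < e / (`|B| + 1) by rewrite divr_gt0.
have := speed_ge (ln 2).
apply: filterS3 HB (cY _ eB (K + 1)) => n [N mN [ZN PN]] [M mM [YM PM]] sn.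
exists (N `|` M); first exact: measurableU.
split.
  move=> w /=; rewrite subr0 normrM => ew.
  have [ZB|ZB] := leP `|Z n w| B; last by left; exact: ZN.
  right; apply: YM => /=; rewrite subr0 ltr_pdivrMr//.
  apply: lt_le_trans ew _; rewrite mulrC ler_wpM2l//.
  by apply: le_trans ZB _; have := ler_norm B; lra.
exact: measure_setU_superexp.
Qed.

Lemma chernoff_ge (Z : T -> R) (t x c : R) : measurable_fun setT Z -> 0 <= t ->
  (\int[P]_w (expR (t * Z w))%:E <= (expR c)%:E)%E ->
  (P [set w | (x <= Z w)%R] <= (expR (c - t * x))%:E)%E.
Proof.
move=> mZ t0 H.
have mA := measurable_set_ge x mZ.
rewrite expRB EFinM lee_pdivlMr ?expR_gt0// muleC.
rewrite -(setIT [set w | x <= Z w]) -integral_indic// -ge0_integralZl_EFin ?expR_ge0//.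
  apply: le_trans H; apply: ge0_le_integral => //.
  - by apply/measurable_EFinP; apply: measurable_funM => //; exact: measurable_indic.
  - by apply/measurable_EFinP; apply: measurableT_comp => //; exact: measurable_funM.
  move=> w _; rewrite -EFinM lee_fin indicE; case: (boolP (w \in _)) => [|_].
    by rewrite inE /= => xZ; rewrite mulr1 ler_expR ler_wpM2l.
  by rewrite mulr0 expR_ge0.
by apply/measurable_EFinP; exact: measurable_indic.
Qed.

(** * Large deviation bounds from a quadratic limit of the scaled log-Laplace transform *)

Section gaertner_ellis.
Variables (Y : nat -> T -> R) (v : R).
Hypothesis v_gt0 : 0 < v.
Hypothesis mY : forall n, measurable_fun setT (Y n).
Hypothesis mgfY : forall t e : R, 0 < e -> \forall n \near \oo,
  ((expR (s n * (v * t ^+ 2 / 2 - e)))%:E <= \int[P]_w (expR (t * s n * Y n w))%:E)%E /\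
  (\int[P]_w (expR (t * s n * Y n w))%:E <= (expR (s n * (v * t ^+ 2 / 2 + e)))%:E)%E.

Lemma gaertner_ellis_upper (a e : R) : 0 <= a -> 0 < e -> \forall n \near \oo,
  (P [set w | (a <= Y n w)%R] <= (expR (- s n * (a ^+ 2 / (2 * v) - e)))%:E)%E.
Proof.
(* [a / v] maximises [t * a - v * t ^+ 2 / 2], with value [a ^+ 2 / (2 * v)]. *)
move=> a0 e0; apply: filterS (mgfY (a / v) e0) => n [_ H].
have t0 : 0 <= a / v * s n by rewrite mulr_ge0 ?(ltW (s_gt0 n))// divr_ge0// ltW.
apply: le_trans (chernoff_ge a (mY n) t0 H) _.
rewrite lee_fin ler_expR le_eqVlt; apply/orP; left; apply/eqP; field.
by rewrite gt_eqF.
Qed.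

(** No tilted measure is formed. The pointwise bound [pw] splits [expR (t * s n * Y n)] according to
    whether [Y n] is near [x], above or below. The outer pieces are dominated by exponentials at
    [t + h] and [t - h], whose known asymptotics make them too small to carry the total mass; the
    rest must come from the event near [x]. *)
Lemma gaertner_ellis_lower (x r e : R) : 0 < r -> 0 < e -> \forall n \near \oo,
  ((expR (- s n * (x ^+ 2 / (2 * v) + e)))%:E <= P [set w | (`|Y n w - x| < r)%R])%E.
Proof.
move=> r0 e0; pose t := x / v.
have vt : v * t = x by rewrite /t mulrC divfK// gt_eqF.
have t0 := normr_ge0 t.
(* the exponential tilting by [t] concentrates [Y n] around [v * t = x] *)
pose q := Num.min r (Num.min (e / (4 * (`|t| + 1))) (Num.min v (2 * e))).
have q0 : 0 < q by rewrite !lt_min r0 v_gt0 !divr_gt0 ?mulr_gt0//; lra.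
have qr : q <= r by rewrite ge_min lexx.
have qe : q * (4 * (`|t| + 1)) <= e.
  by rewrite -ler_pdivlMr ?mulr_gt0// ?ltr_pwDr// !ge_min lexx orbT.
have qv : q <= v by rewrite !ge_min lexx !orbT.
have q2e : q <= 2 * e by rewrite !ge_min lexx !orbT.
(* With [h = q / v], leaving the window gains [h * q - v * h ^+ 2 / 2 = q ^+ 2 / (2 * v) = 4 * e1].
   After errors of size [e1] in the transforms, the tails lie at [- 3 * e1] against a total of at
   least [- e1], both relative to [v * t ^+ 2 / 2]. *)
pose e1 := q ^+ 2 / (8 * v).
have v8 : 0 < 8 * v by rewrite mulr_gt0.
have e10 : 0 < e1 by rewrite divr_gt0// exprn_gt0.
have e1e : e1 <= e / 4.
  rewrite /e1 ler_pdivrMr//.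
  have : q * q <= q * v by rewrite ler_wpM2l// ltW.
  have : v * q <= v * (2 * e) by rewrite ler_wpM2l// ltW.
  by rewrite expr2; lra.
pose h := q / v.
have hv : v * h = q by rewrite /h mulrC divfK// gt_eqF.
have hq : h * q = 8 * e1 by rewrite /h /e1; field; rewrite gt_eqF.
have h0 : 0 < h by rewrite divr_gt0.
have [S1 S2] : (\forall n \near \oo, ln 4 / (2 * e1) <= s n) /\
    (\forall n \near \oo, ln 2 / (e / 4) <= s n) by split; exact: speed_ge.
apply: filterS3 (mgfY t e10) (mgfY (t + h) e10)
  (filterI (mgfY (t - h) e10) (filterI S1 S2)) => n [L _] [_ U1] [[_ U2] [s1 s2]].
have sn := s_gt0 n.
have mA : measurable [set w | `|Y n w - x| < r].
  by apply: measurable_set_lt; apply: measurableT_comp => //; exact: measurable_funB.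
set A := [set w | _] in mA *.
pose B := expR (s n * (t * x + `|t| * q)).
pose c1 := expR (- s n * (h * (x + q))); pose c2 := expR (s n * (h * (x - q))).
have pw w : expR (t * s n * Y n w) <= B * \1_A w +
    (c1 * expR ((t + h) * s n * Y n w) + c2 * expR ((t - h) * s n * Y n w)).
  have B0 : 0 <= B * \1_A w by rewrite mulr_ge0 ?expR_ge0.
  have c10 : 0 <= c1 * expR ((t + h) * s n * Y n w) by rewrite mulr_ge0 ?expR_ge0.
  have c20 : 0 <= c2 * expR ((t - h) * s n * Y n w) by rewrite mulr_ge0 ?expR_ge0.
  have [Yx|Yx] := leP (x + q) (Y n w).
    suff : expR (t * s n * Y n w) <= c1 * expR ((t + h) * s n * Y n w) by lra.
    rewrite -expRD ler_expR.
    have := ler_wpM2l (ltW (mulr_gt0 sn h0)) Yx; lra.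
  have [Yx'|Yx'] := leP (Y n w) (x - q).
    suff : expR (t * s n * Y n w) <= c2 * expR ((t - h) * s n * Y n w) by lra.
    rewrite -expRD ler_expR.
    have := ler_wpM2l (ltW (mulr_gt0 sn h0)) Yx'; lra.
  have Yq : `|Y n w - x| < q by rewrite ltr_distl; apply/andP; split; lra.
  have A1 : \1_A w = 1 :> R by rewrite indicE mem_set//; exact: lt_le_trans qr.
  suff : expR (t * s n * Y n w) <= B by rewrite A1; lra.
  rewrite ler_expR.
  have : t * (Y n w - x) <= `|t| * q.
    by apply: le_trans (ler_norm _) _; rewrite normrM ler_wpM2l// ltW.
  move/(ler_wpM2l (ltW sn)); lra.
have mE (y : R) : measurable_fun setT (fun w => (expR (y * s n * Y n w))%:E).
  by apply/measurable_EFinP; apply: measurableT_comp => //; exact: measurable_funM.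
have m1A : measurable_fun setT (fun w => (\1_A w : R)%:E).
  by apply/measurable_EFinP; exact: measurable_indic.
have I0 : (\int[P]_w (expR (t * s n * Y n w))%:E <= B%:E * P A +
   (c1%:E * \int[P]_w (expR ((t + h) * s n * Y n w))%:E +
    c2%:E * \int[P]_w (expR ((t - h) * s n * Y n w))%:E))%E.
  rewrite -[in leRHS](setIT A) -integral_indic//.
  rewrite -!ge0_integralZl_EFin ?expR_ge0//.
  have m0 : measurable_fun setT (fun w => (B%:E * (\1_A w)%:E)%E).
    exact: measurable_funeM.
  have m1 : measurable_fun setT (fun w => (c1%:E * (expR ((t + h) * s n * Y n w))%:E)%E).
    exact: measurable_funeM.
  have m2 : measurable_fun setT (fun w => (c2%:E * (expR ((t - h) * s n * Y n w))%:E)%E).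
    exact: measurable_funeM.
  have m12 := emeasurable_funD m1 m2.
  have p0 w : setT w -> (0 <= B%:E * (\1_A w)%:E)%E.
    by rewrite -EFinM lee_fin mulr_ge0 ?expR_ge0.
  have p1 w : setT w -> (0 <= c1%:E * (expR ((t + h) * s n * Y n w))%:E)%E.
    by rewrite -EFinM lee_fin mulr_ge0 ?expR_ge0.
  have p2 w : setT w -> (0 <= c2%:E * (expR ((t - h) * s n * Y n w))%:E)%E.
    by rewrite -EFinM lee_fin mulr_ge0 ?expR_ge0.
  have p12 w : setT w -> (0 <= c1%:E * (expR ((t + h) * s n * Y n w))%:E +
      c2%:E * (expR ((t - h) * s n * Y n w))%:E)%E.
    by move=> Tw; rewrite adde_ge0 ?p1 ?p2.
  rewrite -(ge0_integralD P measurableT p1 m1 p2 m2).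
  rewrite -(ge0_integralD P measurableT p0 m0 p12 m12).
  apply: ge0_le_integral => //; first exact: emeasurable_funD.
  by move=> w _; rewrite -!EFinM -!EFinD lee_fin; exact: pw.
have vhh : v * h * h = 8 * e1 by rewrite hv mulrC.
have e1E : e1 = v * h * h / 8 by rewrite vhh; field.
have J1 : (c1%:E * \int[P]_w (expR ((t + h) * s n * Y n w))%:E <=
    (expR (s n * (v * t ^+ 2 / 2 - 3 * e1)))%:E)%E.
  apply: le_trans (lee_wpmul2l _ U1) _; first by rewrite lee_fin expR_ge0.
  rewrite -EFinM -expRD lee_fin ler_expR -subr_ge0.
  by rewrite (_ : _ - _ = 0)// -vt -hv e1E; field.
have J2 : (c2%:E * \int[P]_w (expR ((t - h) * s n * Y n w))%:E <=
    (expR (s n * (v * t ^+ 2 / 2 - 3 * e1)))%:E)%E.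
  apply: le_trans (lee_wpmul2l _ U2) _; first by rewrite lee_fin expR_ge0.
  rewrite -EFinM -expRD lee_fin ler_expR -subr_ge0.
  by rewrite (_ : _ - _ = 0)// -vt -hv e1E; field.
have PA : P A \is a fin_num by exact: fin_num_measure.
have := le_trans (le_trans L I0) (leeD (lexx _) (leeD J1 J2)).
rewrite -(fineK PA) -EFinM -!EFinD !lee_fin.
set p := fine _; set E1 := expR (s n * _); set E2 := expR (s n * _) => main.
have E12 : 4 * E2 <= E1.
  have l4 (z : R) : 4 * z = expR (ln 4) * z by rewrite lnK ?posrE.
  rewrite [leLHS]l4 -expRD ler_expR.
  move: s1; rewrite ler_pdivrMr ?(mulr_gt0 _ e10)//; lra.
have E10 : 0 < E1 by exact: expR_gt0.
have BE : B * expR (- s n * (x ^+ 2 / (2 * v) + e)) <= E1 / 2.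
  have l2 (z : R) : z * 2 = z * expR (ln 2) by rewrite lnK ?posrE.
  rewrite ler_pdivlMr// [leLHS]l2 -!expRD ler_expR.
  have xv : x ^+ 2 / (2 * v) = v * t ^+ 2 / 2 by rewrite -vt; field; rewrite gt_eqF.
  rewrite xv -vt {xv}; move: s2; rewrite ler_pdivrMr ?divr_gt0// => s2.
  have tq : `|t| * q <= e / 4 by have := ltW q0; nra.
  have := ler_wpM2l (ltW sn) tq; have := ler_wpM2l (ltW sn) e1e.
  move=> X1 X2; rewrite -subr_ge0.
  rewrite (_ : _ - _ = (s n * (e / 4) - s n * e1) + (s n * (e / 4) - s n * (`|t| * q)) +
    (s n * (e / 4) - ln 2) + s n * (e / 4)); last by field.
  have sE : 0 <= s n * (e / 4) by rewrite mulr_ge0 ?(ltW sn)//; lra.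
  apply: addr_ge0 => //; apply: addr_ge0; last by rewrite subr_ge0.
  by apply: addr_ge0; rewrite subr_ge0.
have Bp : E1 / 2 <= B * p by lra.
by have := le_trans BE Bp; rewrite ler_pM2l ?expR_gt0.
Qed.

End gaertner_ellis.

Section quadratic_LDP.
Variables (Y Z : nat -> T -> R) (v : R).
Hypothesis v_gt0 : 0 < v.
Hypothesis mY : forall n, measurable_fun setT (Y n).
Hypothesis mZ : forall n, measurable_fun setT (Z n).
Hypothesis mgfY : forall t e : R, 0 < e -> \forall n \near \oo,
  ((expR (s n * (v * t ^+ 2 / 2 - e)))%:E <= \int[P]_w (expR (t * s n * Y n w))%:E)%E /\
  (\int[P]_w (expR (t * s n * Y n w))%:E <= (expR (s n * (v * t ^+ 2 / 2 + e)))%:E)%E.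
Hypothesis ZY : superexp_cvg (fun n w => Z n w - Y n w) 0.

Lemma gaertner_ellis_lower_tail (a e : R) : 0 <= a -> 0 < e -> \forall n \near \oo,
  (P [set w | (a <= - Y n w)%R] <= (expR (- s n * (a ^+ 2 / (2 * v) - e)))%:E)%E.
Proof.
apply: (gaertner_ellis_upper (Y := fun n w => - Y n w) v_gt0) => [n|t e' e'0].
  exact: measurableT_comp.
apply: filterS (mgfY (- t) e'0) => n; rewrite sqrrN.
by under eq_integral do rewrite mulNr mulNr -mulrN.
Qed.

Lemma quadratic_upper_bound (a e : R) : 0 <= a -> 0 < e -> \forall n \near \oo,
  (P [set w | (a <= `|Z n w|)%R] <= (expR (- s n * (a ^+ 2 / (2 * v) - e)))%:E)%E.
Proof.
move=> a0 e0.
(* At [a = 0] no margin [r] with [0 < r <= a] exists, but the bound is at least 1 there. *)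
have [->|/eqP aN0] := eqVneq a 0.
  apply: nearW => n; apply: (@le_trans _ _ 1%E).
    by apply: probability_le1; apply: measurable_set_ge; exact: measurableT_comp.
  rewrite lee_fin -[leLHS]expR0 ler_expR expr0n /= mul0r sub0r mulrN mulNr opprK.
  by rewrite mulr_ge0 ?ltW.
have {aN0 a0} a0 : 0 < a by rewrite lt_neqAle a0 andbT eq_sym; apply/eqP.
(* Lowering the level from [a] to [a - r] costs at most [e / 2] in the rate; the other half of [e]
   pays for the three events in the union bound. *)
pose r := Num.min a (e * v / (2 * a)).
have r0 : 0 < r by rewrite lt_min a0 divr_gt0// mulr_gt0.
have ra : r <= a by rewrite ge_min lexx.
have re : r * (2 * a) <= e * v by rewrite -ler_pdivlMr ?mulr_gt0// ge_min lexx orbT.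
have ar0 : 0 <= a - r by lra.
have e40 : 0 < e / 4 by lra.
have sq : a ^+ 2 / (2 * v) - e / 2 <= (a - r) ^+ 2 / (2 * v).
  rewrite -subr_ge0.
  rewrite (_ : _ - _ = (r ^+ 2 + (e * v - r * (2 * a))) / (2 * v)).
    apply: divr_ge0; last by rewrite mulr_ge0// ltW.
    by have := sqr_ge0 r; lra.
  by field; rewrite gt_eqF.
apply: filterS3 (gaertner_ellis_upper v_gt0 mY mgfY ar0 e40)
  (gaertner_ellis_lower_tail ar0 e40)
  (filterI (ZY r0 (a ^+ 2 / (2 * v))) (speed_ge (ln 3 / (e / 4)))) =>
  n U1 U2 [[N mN [ZN PN]] sn].
have mA1 := measurable_set_ge (a - r) (mY n).
have mA2 : measurable [set w | a - r <= - Y n w].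
  by apply: measurable_set_ge; exact: measurableT_comp.
apply: (@le_trans _ _ (P ([set w | (a - r <= Y n w)%R] `|` [set w | (a - r <= - Y n w)%R] `|` N))).
  apply: le_measure; rewrite ?inE.
  - by apply: measurable_set_ge; exact: measurableT_comp.
  - by do 2! apply: measurableU => //.
  move=> w /= aZ; have [h|h] := leP `|Z n w - Y n w| r; last first.
    by right; apply: ZN => /=; rewrite subr0.
  left; move: h; rewrite ler_norml => /andP[h1 h2].
  by have [Z0|Z0] := leP 0 (Z n w); [left|right]; move: aZ;
    rewrite ?(ger0_norm Z0) ?(ltr0_norm Z0)/=; lra.
apply: le_trans (measureU2 P (measurableU _ _ mA1 mA2) mN) _.
apply: le_trans (leeD (measureU2 P mA1 mA2) (lexx _)) _.
apply: le_trans (leeD (leeD U1 U2) PN) _.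
have s0 := s_gt0 n; rewrite -!EFinD lee_fin.
have b1 : expR (- s n * ((a - r) ^+ 2 / (2 * v) - e / 4)) <=
    expR (- s n * (a ^+ 2 / (2 * v) - e)) / 3.
  rewrite ler_pdivlMr// -[3]lnK ?posrE// -expRD ler_expR.
  move: sn; rewrite ler_pdivrMr// => sn; have := ler_wpM2l (ltW s0) sq; lra.
have b2 : expR (- (a ^+ 2 / (2 * v)) * s n) <= expR (- s n * (a ^+ 2 / (2 * v) - e)) / 3.
  rewrite ler_pdivlMr// -[3]lnK ?posrE// -expRD ler_expR.
  move: sn; rewrite ler_pdivrMr// => sn; have := mulr_gt0 s0 e0; lra.
by lra.
Qed.

Lemma quadratic_lower_bound (x r e : R) : 0 < r -> 0 < e -> \forall n \near \oo,
  ((expR (- s n * (x ^+ 2 / (2 * v) + e)))%:E <= P [set w | (`|Z n w - x| < r)%R])%E.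
Proof.
move=> r0 e0.
have r20 : 0 < r / 2 by lra.
have e20 : 0 < e / 2 by lra.
have y0 : 0 <= x ^+ 2 / (2 * v) by rewrite divr_ge0 ?sqr_ge0// mulr_ge0// ltW.
apply: filterS3 (gaertner_ellis_lower v_gt0 mY mgfY x r20 e20)
  (ZY r20 (x ^+ 2 / (2 * v) + e)) (speed_ge (ln 2 / (e / 2))) =>
  n L [N mN [ZN PN]] sn.
have s0 := s_gt0 n.
have mA : measurable [set w | `|Z n w - x| < r].
  by apply: measurable_set_lt; apply: measurableT_comp => //; exact: measurable_funB.
have mB : measurable [set w | `|Y n w - x| < r / 2].
  by apply: measurable_set_lt; apply: measurableT_comp => //; exact: measurable_funB.
have H : (P [set w | (`|Y n w - x| < r / 2)%R] <= P [set w | (`|Z n w - x| < r)%R] + P N)%E.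
  apply: le_trans (measureU2 P mA mN); apply: le_measure; rewrite ?inE//.
    exact: measurableU.
  move=> w /= Yx; have [h|h] := leP `|Z n w - Y n w| (r / 2); last first.
    by right; apply: ZN => /=; rewrite subr0.
  left; rewrite (_ : _ - x = (Z n w - Y n w) + (Y n w - x)); last by ring.
  by apply: le_lt_trans (ler_normD _ _) _; lra.
have PA : P [set w | (`|Z n w - x| < r)%R] \is a fin_num by exact: fin_num_measure.
have := le_trans L (le_trans H (leeD (lexx _) PN)).
rewrite -(fineK PA) -EFinD !lee_fin.
set E := expR _; set E' := expR _.
have b1 : 2 * expR (- s n * (x ^+ 2 / (2 * v) + e)) <= E.
  have l2 (z : R) : 2 * z = expR (ln 2) * z by rewrite lnK ?posrE.
  rewrite [leLHS]l2 -expRD ler_expR.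
  move: sn; rewrite ler_pdivrMr//; lra.
have -> : E' = expR (- s n * (x ^+ 2 / (2 * v) + e)) by congr expR; ring.
lra.
Qed.

(** The rate increases with [|x|], so a closed [F] lies in the set where [|x| >= a], with [a] the
    level at which the rate equals its infimum over [F]; a two-sided tail estimate is then enough.
    For open sets, balls around each point suffice. *)
Lemma quadratic_LDP : LDP P Z s (fun x => x ^+ 2 / (2 * v)).
Proof.
have J0 x : 0 <= x ^+ 2 / (2 * v) by rewrite divr_ge0 ?sqr_ge0// mulr_ge0// ltW.
split=> [F cF|G oG].
  have mF n : measurable (Z n @^-1` F).
    by rewrite -[_ @^-1` _]setTI; apply: mZ => //; exact: closed_measurable.
  (* For empty [F] the bound to reach is [-oo], attained since [elog] sends 0 to [-oo]. *)
  have [F0|/set0P[x0 Fx0]] := eqVneq F set0.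
    apply: limn_esup_le_near; apply: nearW => n.
    rewrite F0 preimage_set0 measure0 /= ltxx mulrNy gtr0_sg ?invr_gt0 ?s_gt0//.
    by rewrite mul1e leNye.
  set i := ereal_inf _.
  have i0 : (0 <= i)%E by apply: le_ereal_inf_tmp => _ [x Fx <-]; rewrite lee_fin.
  have ix x : F x -> (i <= (x ^+ 2 / (2 * v))%:E)%E.
    by move=> Fx; apply: ereal_inf_lbound; exists x.
  have ifin : i \is a fin_num.
    by rewrite ge0_fin_numE//; apply: le_lt_trans (ix _ Fx0) _; rewrite ltry.
  apply/lee_addgt0Pr => e e0; rewrite -(fineK ifin) -EFinN -EFinD.
  apply: limn_esup_le_near.
  have j0 : 0 <= fine i by exact: fine_ge0.
  pose a := Num.sqrt (2 * v * fine i).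
  have a2 : a ^+ 2 / (2 * v) = fine i.
    rewrite sqr_sqrtr ?mulr_ge0// ?(ltW v_gt0)//.
    by rewrite mulrC mulKf// gt_eqF// mulr_gt0.
  apply: filterS (quadratic_upper_bound (sqrtr_ge0 (2 * v * fine i)) e0) => n.
  rewrite -/a a2 => U.
  have : (P (Z n @^-1` F) <= (expR (- s n * (fine i - e)))%:E)%E.
    apply: le_trans U; apply: le_measure; rewrite ?inE//.
      by apply: measurable_set_ge; exact: measurableT_comp.
    move=> w /= FZ; rewrite -(ger0_norm (sqrtr_ge0 _ : 0 <= a)) -ler_sqr ?nnegrE ?normr_ge0//.
    rewrite !real_normK ?num_real// -(@ler_pM2r _ (2 * v)^-1) ?invr_gt0 ?mulr_gt0// a2.
    by rewrite -lee_fin fineK//; exact: ix.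
  move/elog_le => /(lee_wpmul2l _) -/(_ (s n)^-1%:E) => H.
  apply: le_trans (H _) _; first by rewrite lee_fin invr_ge0 ltW.
  rewrite -EFinM lee_fin mulrA mulrN mulVf ?gt_eqF ?s_gt0//.
  by rewrite mulN1r opprB addrC.
have mG n : measurable (Z n @^-1` G).
  by rewrite -[_ @^-1` _]setTI; apply: mZ => //; exact: open_measurable.
rewrite leeNl; apply: le_ereal_inf_tmp => _ [x Gx <-]; rewrite leeNl.
apply/lee_subgt0Pr => e e0.
have /nbhs_ballP[r /= r0 rG] : nbhs x G by exact: open_nbhs_nbhs.
rewrite -EFinD; apply: limn_einf_ge_near.
apply: filterS (quadratic_lower_bound x r0 e0) => n L.
have : ((expR (- s n * (x ^+ 2 / (2 * v) + e)))%:E <= P (Z n @^-1` G))%E.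
  apply: le_trans L _; apply: le_measure; rewrite ?inE//.
    by apply: measurable_set_lt; apply: measurableT_comp => //; exact: measurable_funB.
  by move=> w /= h; apply: rG; rewrite /ball /= distrC.
move/elog_ge => /(lee_wpmul2l _) -/(_ (s n)^-1%:E) => H.
apply: le_trans (H _); last by rewrite lee_fin invr_ge0 ltW.
rewrite -EFinM lee_fin mulrA mulrN mulVf ?gt_eqF ?s_gt0//.
by rewrite mulN1r opprD.
Qed.

End quadratic_LDP.

End superexp.

(** * Replacing a random compensator by its limit *)

Section tilting.
Context {R : realType} {d : measure_display} {T : measurableType d}.
Variables (P : probability T R).

Lemma le_integral_dominated (f f1 f2 : T -> R) (a b c : R) (N : set T) :
  measurable_fun setT f -> measurable_fun setT f1 -> measurable_fun setT f2 ->
  measurable N -> (forall w, 0 <= f w) -> (forall w, 0 <= f1 w) -> (forall w, 0 <= f2 w) ->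
  0 <= a -> 0 <= b -> 0 <= c ->
  (forall w, f w <= a * f1 w + b * f2 w + c * \1_N w) ->
  (\int[P]_w (f w)%:E <=
   a%:E * \int[P]_w (f1 w)%:E + b%:E * \int[P]_w (f2 w)%:E + c%:E * P N)%E.
Proof.
move=> mf m1 m2 mN f0 f10 f20 a0 b0 c0 H.
have mE (g : T -> R) : measurable_fun setT g -> measurable_fun setT (fun w => (g w)%:E).
  by move=> mg; exact/measurable_EFinP.
have mZ (k : R) (g : T -> R) : measurable_fun setT g ->
    measurable_fun setT (fun w => k%:E * (g w)%:E)%E.
  by move=> mg; apply: measurable_funeM; exact: mE.
have i0 w : 0 <= \1_N w :> R by rewrite indicE.
apply: (@le_trans _ _ (\int[P]_w (a%:E * (f1 w)%:E + b%:E * (f2 w)%:E + c%:E * (\1_N w)%:E))%E).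
  apply: ge0_le_integral => //.
  - by move=> w _; rewrite lee_fin.
  - exact: mE.
  - by apply: emeasurable_funD; [apply: emeasurable_funD|]; apply: mZ => //; exact: measurable_indic.
  - by move=> w _; rewrite lee_fin.
rewrite ge0_integralD//; last 4 first.
- by move=> w _; rewrite adde_ge0// mule_ge0// lee_fin.
- by apply: emeasurable_funD; apply: mZ.
- by move=> w _; rewrite mule_ge0// lee_fin.
- by apply: mZ; exact: measurable_indic.
rewrite ge0_integralD//; last 4 first.
- by move=> w _; rewrite mule_ge0// lee_fin.
- exact: mZ.
- by move=> w _; rewrite mule_ge0// lee_fin.
- exact: mZ.
have iZ (k : R) (g : T -> R) : measurable_fun setT g -> (forall w, 0 <= g w) -> 0 <= k ->
    (\int[P]_w (k%:E * (g w)%:E) = k%:E * \int[P]_w (g w)%:E)%E.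
  move=> mg g0 k0; rewrite ge0_integralZl//; first exact: mE.
  by move=> w _; rewrite lee_fin.
by rewrite !iZ ?integral_indic ?setIT//; exact: measurable_indic.
Qed.

Variables (s : nat -> R).
Hypothesis s_gt0 : forall n, 0 < s n.
Hypothesis s_cvg : s @ \oo --> +oo.
Variables (M Q : nat -> T -> R) (a C : R).
Hypothesis mM : forall n, measurable_fun setT (M n).
Hypothesis mQ : forall n, measurable_fun setT (Q n).
Hypothesis Q_ge0 : forall n w, 0 <= Q n w.
Hypothesis exp_mart : \forall n \near \oo, (\int[P]_w (expR (M n w - Q n w))%:E = 1)%E.
Hypothesis exp_sqr : \forall n \near \oo,
  (\int[P]_w (expR (2 * M n w))%:E <= (expR (C * s n))%:E)%E.
Hypothesis Q_cvg : superexp_cvg P s (fun n w => Q n w / s n) a.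

(* Off an event negligible at speed [s], [Q] may be replaced by the constant [s * a];
   on that event Cauchy-Schwarz, in the form [expRD_le_half], uses [exp_sqr]. *)
Lemma mgf_tilt (e : R) : 0 < e -> \forall n \near \oo,
  ((expR (s n * (a - e)))%:E <= \int[P]_w (expR (M n w))%:E)%E /\
  (\int[P]_w (expR (M n w))%:E <= (expR (s n * (a + e)))%:E)%E.
Proof.
move=> e0; have e20 : 0 < e / 2 by lra.
(* The weight [expR (k * s n)] in Young's inequality is tuned so that both [C - k] and [k - 2 * k]
   are at most [- (|a| + 1)]: the contribution of [N], taken negligible at rate [2 * k], is then
   below [expR (s n * a)]. *)
pose k := `|C| + `|a| + 1.
have sl : \forall n \near \oo, ln 2 <= s n /\ 2 * ln 2 / e <= s n.
  by apply: filterI; exact: speed_ge.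
apply: filterS3 (filterI exp_mart exp_sqr) (Q_cvg e20 (2 * k)) sl
  => n [D1 D2] [N mN [QN PN]] [sl2 sle].
have sn := s_gt0 n.
have mexp (f : T -> R) : measurable_fun setT f -> measurable_fun setT (fun w => expR (f w)).
  by move=> mf; exact: measurableT_comp.
have mD : measurable_fun setT (fun w => expR (M n w - Q n w)).
  by apply: mexp; exact: measurable_funB.
have m2 : measurable_fun setT (fun w => expR (2 * M n w)).
  by apply: mexp; exact: measurable_funM.
have QnN w : ~ N w -> s n * (a - e / 2) <= Q n w <= s n * (a + e / 2).
  move=> nw; have : ~ (e / 2 < `|Q n w / s n - a|) by move=> h; apply/nw/QN.
  move/negP; rewrite -leNgt ler_distl => /andP[h1 h2].
  by apply/andP; split; rewrite mulrC -?ler_pdivlMr// -?ler_pdivrMr.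
have half_N w : expR (M n w) <=
    2^-1 * expR (- (k * s n)) * expR (2 * M n w) + 2^-1 * expR (k * s n).
  have := expRD_le_half (M n w) 0 (- (k * s n)).
  by rewrite addr0 opprK mulr0 expR0 mulr1 !mulrA.
have c10 : 0 <= 2^-1 * expR (- (k * s n)) by rewrite mulr_ge0// expR_ge0.
have c20 : 0 <= 2^-1 * expR (k * s n) by rewrite mulr_ge0// expR_ge0.
have small : (( 2^-1 * expR (- (k * s n)))%:E * \int[P]_w (expR (2 * M n w))%:E +
    (2^-1 * expR (k * s n))%:E * P N <= (expR (- (`|a| + 1) * s n))%:E)%E.
  apply: (@le_trans _ _ (( 2^-1 * expR (- (k * s n)))%:E * (expR (C * s n))%:E +
    (2^-1 * expR (k * s n))%:E * (expR (- (2 * k) * s n))%:E)%E).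
    by apply: leeD; apply: lee_pmul2l || apply: lee_wpmul2l; rewrite ?lee_fin.
  rewrite -!EFinM -EFinD lee_fin -!mulrA -!expRD.
  set E := expR (- (_ + _) * _).
  have h1 : expR (- (k * s n) + C * s n) <= E.
    rewrite ler_expR -mulNr -mulrDl ler_wpM2r ?(ltW sn)// /k.
    have := ler_norm C; lra.
  have h2 : expR (k * s n + - (2 * k) * s n) <= E.
    rewrite ler_expR -mulrDl ler_wpM2r ?(ltW sn)// /k.
    have := normr_ge0 C; lra.
  lra.
have e2 (x y : R) : 2 * expR (s n * x) <= expR (s n * y) \/ y < x + e / 2.
  case: (leP (x + e / 2) y) => xy; [left|by right].
  rewrite -[X in X * _](@lnK _ 2) ?posrE// -expRD ler_expR.
  have : s n * (x + e / 2) <= s n * y by rewrite ler_wpM2l// ltW.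
  have : 2 * ln 2 <= s n * e by rewrite -ler_pdivrMr.
  lra.
split.
(* Lower bound: start from the mean 1 of [expR (M - Q)]. On [N] the compensator is dropped, as
   [Q >= 0], and that part takes at most half of the mass. *)
- have := @le_integral_dominated (fun w => expR (M n w - Q n w)) (fun w => expR (M n w))
    (fun w => expR (2 * M n w)) (expR (- (s n * (a - e / 2))))
    (2^-1 * expR (- (k * s n))) (2^-1 * expR (k * s n)) N mD (mexp _ (mM n)) m2 mN.
  rewrite D1 => H.
  have {H} H : (1 <= (expR (- (s n * (a - e / 2))))%:E * \int[P]_w (expR (M n w))%:E +
      ((2^-1 * expR (- (k * s n)))%:E * \int[P]_w (expR (2 * M n w))%:E +
      (2^-1 * expR (k * s n))%:E * P N))%E.
    rewrite addeA; apply: H => // w; rewrite ?expR_ge0//.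
    have h0 : 0 <= expR (- (s n * (a - e / 2))) * expR (M n w) by rewrite mulr_ge0 ?expR_ge0.
    have h1 : 0 <= 2^-1 * expR (- (k * s n)) * expR (2 * M n w) by rewrite mulr_ge0 ?expR_ge0.
    rewrite indicE; have [/set_mem Nw|/negP nN] := boolP (w \in N).
      rewrite mulr1; have : expR (M n w - Q n w) <= expR (M n w).
        by rewrite ler_expR lerBlDr lerDl.
      have := half_N w; lra.
    rewrite mulr0 addr0.
    have /andP[h _] : s n * (a - e / 2) <= Q n w <= s n * (a + e / 2).
      by apply: QnN => Nw; apply: nN; exact: mem_set.
    have : expR (M n w - Q n w) <= expR (- (s n * (a - e / 2))) * expR (M n w).
      by rewrite -expRD ler_expR; lra.
    lra.
  have {}small : ((2^-1 * expR (- (k * s n)))%:E * \int[P]_w (expR (2 * M n w))%:E +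
      (2^-1 * expR (k * s n))%:E * P N <= (2^-1)%:E)%E.
    apply: le_trans small _; rewrite lee_fin -[X in _ <= X^-1](@lnK _ 2) ?posrE//.
    rewrite -expRN ler_expR mulNr lerN2.
    have := normr_ge0 a; nra.
  move: H; set I1 := (_%:E * _)%E; have := leeD (lexx I1) small; rewrite /I1 {I1}.
  move=> h1 /le_trans => /(_ _ h1) {h1}.
  have : (0 <= \int[P]_w (expR (M n w))%:E)%E.
    by apply: integral_ge0 => w _; rewrite lee_fin expR_ge0.
  case: (\int[P]_w (expR (M n w))%:E)%E => [I| |] // I0; last by rewrite leey.
  rewrite -EFinM -EFinD !lee_fin => H.
  case: (e2 (a - e) (a - e / 2)) => [h|]; last by lra.
  have h1 : expR (s n * (a - e / 2)) * 2^-1 <= I.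
    by rewrite -ler_pdivlMl ?expR_gt0// -expRN; lra.
  lra.
- have := @le_integral_dominated (fun w => expR (M n w)) (fun w => expR (M n w - Q n w))
    (fun w => expR (2 * M n w)) (expR (s n * (a + e / 2)))
    (2^-1 * expR (- (k * s n))) (2^-1 * expR (k * s n)) N (mexp _ (mM n)) mD m2 mN.
  rewrite D1 mule1 -addeA => H.
  apply: (@le_trans _ _ ((expR (s n * (a + e / 2)))%:E + (expR (- (`|a| + 1) * s n))%:E)%E).
    apply: le_trans (leeD (lexx _) small); apply: H => // w; rewrite ?expR_ge0//.
    have h0 : 0 <= expR (s n * (a + e / 2)) * expR (M n w - Q n w) by rewrite mulr_ge0 ?expR_ge0.
    have h1 : 0 <= 2^-1 * expR (- (k * s n)) * expR (2 * M n w) by rewrite mulr_ge0 ?expR_ge0.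
    rewrite indicE; have [/set_mem Nw|/negP nN] := boolP (w \in N).
      rewrite mulr1; have := half_N w; lra.
    rewrite mulr0 addr0.
    have /andP[_ h] : s n * (a - e / 2) <= Q n w <= s n * (a + e / 2).
      by apply: QnN => Nw; apply: nN; exact: mem_set.
    have : expR (M n w) <= expR (s n * (a + e / 2)) * expR (M n w - Q n w).
      by rewrite -expRD ler_expR; lra.
    lra.
  rewrite -EFinD lee_fin.
  case: (e2 (a + e / 2) (a + e)) => [h|]; last by lra.
  have : expR (- (`|a| + 1) * s n) <= expR (s n * (a + e / 2)).
    rewrite ler_expR [leLHS]mulrC ler_wpM2l ?(ltW sn)//.
    have := lerNnormlW (lexx `|a|); lra.
  lra.
Qed.

End tilting.

(** * Chernoff criteria and calculus of exponentially tight sequences *)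

Section superexp_chernoff.
Context {R : realType} {d : measure_display} {T : measurableType d}.
Variables (P : probability T R) (s : nat -> R).
Hypothesis s_gt0 : forall n, 0 < s n.
Hypothesis s_cvg : s @ \oo --> +oo.

Lemma superexp_cvg0_chernoff (Z : nat -> T -> R) :
  (forall n, measurable_fun setT (Z n)) ->
  (forall e K : R, 0 < e -> \forall n \near \oo, exists t c : R, [/\ 0 <= t,
     (\int[P]_w (expR (t * Z n w))%:E <= (expR c)%:E)%E,
     (\int[P]_w (expR (t * - Z n w))%:E <= (expR c)%:E)%E & c - t * e <= - K * s n]) ->
  superexp_cvg P s Z 0.
Proof.
move=> mZ H e e0 K; have := speed_ge s_cvg (ln 2).
apply: filterS2 (H e (K + 1) e0) => n [t [c [t0 H1 H2 ct]]] sn.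
have mA := measurable_set_ge e (mZ n).
have mZN : measurable_fun setT (fun w => - Z n w) by exact: measurableT_comp.
have mB := measurable_set_ge e mZN.
exists ([set w | e <= Z n w] `|` [set w | e <= - Z n w]); first exact: measurableU.
split.
  move=> w /=; rewrite subr0 ltNge ler_norml => /negP h.
  have [Z1|Z1] := leP e (Z n w); first by left.
  right; rewrite leNgt; apply/negP => Z2; apply: h; apply/andP; split; lra.
apply: (measure_setU_superexp _ _ sn) => //.
- by apply: le_trans (chernoff_ge e (mZ n) t0 H1) _; rewrite lee_fin ler_expR.
- by apply: le_trans (chernoff_ge e mZN t0 H2) _; rewrite lee_fin ler_expR.
Qed.

Lemma superexp_tight_chernoff (Z : nat -> T -> R) (C : R) :
  (forall n, measurable_fun setT (Z n)) ->
  (\forall n \near \oo,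
     (\int[P]_w (expR (s n * Z n w))%:E <= (expR (C * s n))%:E)%E /\
     (\int[P]_w (expR (s n * - Z n w))%:E <= (expR (C * s n))%:E)%E) ->
  superexp_tight P s Z.
Proof.
move=> mZ H K; exists (C + K + 1); have := speed_ge s_cvg (ln 2).
apply: filterS2 H => n [H1 H2] sn.
have s0 := s_gt0 n.
set e := C + K + 1.
have mA := measurable_set_ge e (mZ n).
have mZN : measurable_fun setT (fun w => - Z n w) by exact: measurableT_comp.
have mB := measurable_set_ge e mZN.
exists ([set w | e <= Z n w] `|` [set w | e <= - Z n w]); first exact: measurableU.
split.
  move=> w /=; rewrite ltNge ler_norml => /negP h.
  have [Z1|Z1] := leP e (Z n w); first by left.
  right; rewrite leNgt; apply/negP => Z2; apply: h; apply/andP; split; lra.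
apply: (measure_setU_superexp _ _ sn) => //.
- apply: le_trans (chernoff_ge e (mZ n) (ltW s0) H1) _.
  by rewrite lee_fin ler_expR /e; lra.
- apply: le_trans (chernoff_ge e mZN (ltW s0) H2) _.
  by rewrite lee_fin ler_expR /e; lra.
Qed.

(** The closed formulas for the estimators hold only where their denominators do not vanish, so they
    may be used off a negligible event only. *)
Lemma superexp_cvg_ext_small (Z Y : nat -> T -> R) z :
  superexp_small P s (fun n => [set w | Z n w != Y n w]) ->
  superexp_cvg P s Z z -> superexp_cvg P s Y z.
Proof.
move=> ZY cZ e e0.
apply: superexp_small_sub (superexp_smallU s_cvg ZY (cZ e e0)).
apply: nearW => n w /=; case: (eqVneq (Z n w) (Y n w)) => [->|]; by [right|left].
Qed.

Lemma superexp_tight_ext_small (Z Y : nat -> T -> R) :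
  superexp_small P s (fun n => [set w | Z n w != Y n w]) ->
  superexp_tight P s Z -> superexp_tight P s Y.
Proof.
move=> ZY tZ K; have [B HB] := tZ (K + 1); exists B.
have := speed_ge s_cvg (ln 2).
apply: filterS3 HB (ZY (K + 1)) => n [N mN [ZN PN]] [M mM [ZYM PM]] sn.
exists (N `|` M); first exact: measurableU.
split; last exact: measure_setU_superexp.
move=> w /=; case: (eqVneq (Z n w) (Y n w)) => [<-|h] BZ; first by left; exact: ZN.
by right; exact: ZYM.
Qed.

Lemma superexp_tightM (Z Y : nat -> T -> R) :
  superexp_tight P s Z -> superexp_tight P s Y ->
  superexp_tight P s (fun n w => Z n w * Y n w).
Proof.
move=> tZ tY K; have [B HB] := tZ (K + 1); have [D HD] := tY (K + 1).
exists (`|B| * `|D|).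
have := speed_ge s_cvg (ln 2).
apply: filterS3 HB HD => n [N mN [ZN PN]] [M mM [YM PM]] sn.
exists (N `|` M); first exact: measurableU.
split; last exact: measure_setU_superexp.
move=> w /= h.
have [ZB|ZB] := leP `|Z n w| B; last by left; exact: ZN.
have [YD|YD] := leP `|Y n w| D; last by right; exact: YM.
move: h; rewrite ltNge normrM => /negP; case.
by apply: ler_pM => //; [exact: le_trans ZB (ler_norm _)|exact: le_trans YD (ler_norm _)].
Qed.

Lemma superexp_tightD (Z Y : nat -> T -> R) :
  superexp_tight P s Z -> superexp_tight P s Y ->
  superexp_tight P s (fun n w => Z n w + Y n w).
Proof.
move=> tZ tY K; have [B HB] := tZ (K + 1); have [D HD] := tY (K + 1).
exists (B + D).
have := speed_ge s_cvg (ln 2).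
apply: filterS3 HB HD => n [N mN [ZN PN]] [M mM [YM PM]] sn.
exists (N `|` M); first exact: measurableU.
split; last exact: measure_setU_superexp.
move=> w /= h.
have [ZB|ZB] := leP `|Z n w| B; last by left; exact: ZN.
have [YD|YD] := leP `|Y n w| D; last by right; exact: YM.
by move: h; rewrite ltNge (le_trans (ler_normD _ _))// lerD.
Qed.

End superexp_chernoff.

(** * The scales *)

Section rates.
Context {R : realType}.
Variables (kappa lambda : nat -> R).
Hypothesis kappa_gt0 : forall n, 0 < kappa n.
Hypothesis kappa_cvg : kappa @ \oo --> +oo.
Hypothesis lambda_gt0 : forall n, 0 < lambda n.
Hypothesis lambda_cvg : lambda @ \oo --> +oo.
Hypothesis rate : (fun n => n%:R / (lambda n ^+ 6 * kappa n ^+ 6)) @ \oo --> +oo.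

Lemma near_kappa (K : R) : \forall n \near \oo, K <= kappa n.
Proof. by move/cvgryPge : kappa_cvg; exact. Qed.

Lemma near_lambda (K : R) : \forall n \near \oo, K <= lambda n.
Proof. by move/cvgryPge : lambda_cvg; exact. Qed.

Lemma rate6 (K : R) : \forall n \near \oo, K * (lambda n ^+ 6 * kappa n ^+ 6) <= n%:R.
Proof.
move/cvgryPge : rate => /(_ K); apply: filterS => n.
by rewrite ler_pdivlMr// mulr_gt0// exprn_gt0.
Qed.

(** Eventually [lambda] and [kappa] exceed 1, so every monomial of smaller degrees is dominated as
    well; all later growth requirements on [n] take this form. *)
Lemma rate_poly (K : R) (i j : nat) : (i <= 6)%N -> (j <= 6)%N ->
  \forall n \near \oo, K * (lambda n ^+ i * kappa n ^+ j) <= n%:R.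
Proof.
move=> i6 j6; have := near_kappa 1.
apply: filterS3 (rate6 `|K|) (near_lambda 1) => n h l1 k1.
apply: le_trans h; apply: (@le_trans _ _ (`|K| * (lambda n ^+ i * kappa n ^+ j))).
  by rewrite ler_wpM2r ?ler_norm// mulr_ge0// exprn_ge0// ltW.
rewrite ler_wpM2l// ler_pM ?exprn_ge0 ?(ltW (lambda_gt0 _)) ?(ltW (kappa_gt0 _))//.
  by rewrite ler_weXn2l.
by rewrite ler_weXn2l.
Qed.

(** The martingale [M_n] has standard deviation of order [sqrt (n * kappa n)]; [lambda n] is the
    moderate deviation factor. *)
Definition norming n := lambda n * Num.sqrt (n%:R * kappa n).

Lemma sqr_norming n : norming n ^+ 2 = lambda n ^+ 2 * (n%:R * kappa n).
Proof. by rewrite exprMn sqr_sqrtr// mulr_ge0// ltW. Qed.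

Lemma norming_gt0 n : (0 < n)%N -> 0 < norming n.
Proof. by move=> n0; rewrite mulr_gt0// sqrtr_gt0 mulr_gt0// ltr0n. Qed.

Lemma norming_le (e : R) : 0 < e -> \forall n \near \oo, norming n <= e * n%:R.
Proof.
move=> e0; have := rate_poly (e ^- 2) (isT : (2 <= 6)%N) (isT : (1 <= 6)%N).
apply: filterS => n; rewrite ler_pdivrMl ?exprn_gt0// => h.
rewrite -ler_sqr ?nnegrE.
- rewrite sqr_norming exprMn expr1 in h *.
  by have := ler_wpM2r (ler0n R n) h; rewrite [n%:R ^+ 2]expr2; lra.
- by rewrite mulr_ge0// ltW.
- by rewrite mulr_ge0// ltW.
Qed.

Lemma norming_cvg0 : (fun n => norming n / n%:R) @ \oo --> 0.
Proof.
apply/cvgrPdist_le => e e0.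
apply: filterS2 (norming_le e0) (nbhs_infty_gt 0) => n h n0.
rewrite sub0r normrN ger0_norm; last by rewrite divr_ge0// mulr_ge0// ltW.
by rewrite ler_pdivrMr ?ltr0n.
Qed.

Lemma speed_cvg : (fun n => lambda n ^+ 2) @ \oo --> +oo.
Proof.
apply/cvgryPge => K; apply: filterS2 (near_lambda 1) (near_lambda K) => n l1 lK.
by apply: le_trans lK _; rewrite expr2 ler_peMl// ltW.
Qed.

(** The normalisation of the estimators is [n / norming n]: multiplied by [kappa n * M_n / S_n],
    with [S_n] of order [n * kappa n], it returns [M_n / norming n]. *)
Lemma scale_norming n : Num.sqrt (n%:R / kappa n) / lambda n * norming n = n%:R.
Proof.
rewrite /norming mulrA mulfVK ?gt_eqF// -sqrtrM ?divr_ge0// ?(ltW (kappa_gt0 _))//.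
rewrite mulrACA mulVf ?gt_eqF// mulr1 -expr2 sqrtr_sqr ger0_norm//.
Qed.

End rates.

(** * AR(1) functionals at speed [lambda n ^+ 2] *)

Section ar_family.
Context {R : realType} {d : measure_display} {T : measurableType d}.
Variables (P : probability T R) (V : nat -> T -> R).
Hypothesis mV : forall k, measurable_fun setT (V k).
Hypothesis indep : mutually_independent P V.
Hypothesis idV : identically_distributed P V.
Variables (C C' s2 : R).
Hypothesis C_ge1 : 1 <= C.
Hypothesis mgfV : forall a b : R, 0 <= b -> b <= C^-1 ->
  (\int[P]_w (expR (a * V 0%N w + b * V 0%N w ^+ 2))%:E <=
   (expR (C * a ^+ 2 + C * b))%:E)%E.
Hypothesis C'_ge1 : 1 <= C'.
Hypothesis mgfV2 : forall b : R, `|b| <= C'^-1 ->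
  (\int[P]_w (expR (b * (V 0%N w ^+ 2 - s2)))%:E <= (expR (C' * b ^+ 2))%:E)%E.
Variables (kappa lambda : nat -> R).
Hypothesis kappa_gt0 : forall n, 0 < kappa n.
Hypothesis kappa_cvg : kappa @ \oo --> +oo.
Hypothesis lambda_gt0 : forall n, 0 < lambda n.
Hypothesis lambda_cvg : lambda @ \oo --> +oo.
Hypothesis rate : (fun n => n%:R / (lambda n ^+ 6 * kappa n ^+ 6)) @ \oo --> +oo.

Local Notation s := (fun n => lambda n ^+ 2).
Local Notation q := (norming kappa lambda).
Let s_gt0 n : 0 < s n. Proof. by rewrite exprn_gt0. Qed.
Let s_cvg : s @ \oo --> +oo. Proof. exact: speed_cvg. Qed.

Lemma measurable_ar (x : R) k : measurable_fun setT (eps_ar x V k).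
Proof. exact: (past_measurable_fun mV (@past_measurable_ar _ _ _ V x k k (leqnn k))). Qed.

Lemma measurable_ar_mart (x : R) k : measurable_fun setT (ar_mart V x k).
Proof. exact: (past_measurable_fun mV (@past_measurable_ar_mart _ _ _ V x k k (leqnn k))). Qed.

Lemma innov_sqr_cvg0 :
  superexp_cvg P s (fun n w => (\sum_(0 <= k < n) (V k w ^+ 2 - s2)) / n%:R) 0.
Proof.
have mS n : measurable_fun setT (fun w => \sum_(0 <= k < n) (V k w ^+ 2 - s2)).
  rewrite (_ : (fun w => _) = (fun w => \sum_(k < n) (V k w ^+ 2 - s2))).
    by apply: measurable_sum => i; apply: measurable_funB => //; exact: measurable_funX.
  by apply/funext => w; rewrite big_mkord.
apply: superexp_cvg0_chernoff => // [n|e K e0].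
  exact: measurable_funM.
have C'0 : 0 < C' by have := C'_ge1; lra.
(* A parameter free of [n] works here: the first bound keeps [b] in the domain of [mgfV2], the
   second makes the quadratic cost at most half of the gain [b * e]. *)
pose b := Num.min C'^-1 (e / (2 * C')).
have b0 : 0 < b by rewrite lt_min invr_gt0 C'0 divr_gt0// mulr_gt0.
have bC : b <= C'^-1 by rewrite ge_min lexx.
have be : b * (2 * C') <= e.
  by rewrite -ler_pdivlMr ?mulr_gt0// ge_min lexx orbT.
have be0 : 0 < b * e / 2 by rewrite divr_gt0// mulr_gt0.
have := rate_poly kappa_gt0 kappa_cvg lambda_gt0 lambda_cvg rate (K / (b * e / 2))
  (isT : 2 <= 6)%N (isT : 0 <= 6)%N.
apply: filterS2 (nbhs_infty_gt 0) => n n0; rewrite expr0 mulr1 => rn.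
have nN : n%:R != 0 :> R by rewrite pnatr_eq0 -lt0n.
have nb : `|b| <= C'^-1 by rewrite ger0_norm// ltW.
have nb' : `|- b| <= C'^-1 by rewrite normrN.
exists (n%:R * b), (n%:R * (C' * b ^+ 2)); split.
- by rewrite mulr_ge0// ltW.
- rewrite (eq_integral (fun w => (expR (b * \sum_(0 <= k < n) (V k w ^+ 2 - s2)))%:E)).
    by apply: (mgf_sum_sqr mV indep idV); exact: mgfV2.
  by move=> w _; congr (expR _)%:E; field.
- rewrite (eq_integral (fun w => (expR (- b * \sum_(0 <= k < n) (V k w ^+ 2 - s2)))%:E)).
    by rewrite -(sqrrN b); apply: (mgf_sum_sqr mV indep idV); exact: mgfV2.
  by move=> w _; congr (expR _)%:E; field.
- have h1 : C' * b ^+ 2 <= b * e / 2.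
    by have := ler_wpM2l (ltW b0) be; lra.
  have : K * s n <= n%:R * (b * e / 2).
    by rewrite -ler_pdivrMr// mulrAC.
  have := ler_wpM2l (ler0n R n) h1; lra.
Qed.

Variables (r : nat -> R) (g : R).
Hypothesis g_gt0 : 0 < g.
Hypothesis r_cvg : (fun n => kappa n * (1 - r n ^+ 2)) @ \oo --> 2 * g.

(** The limit is written [2 * g] so that [g] itself is an eventual lower bound; [g] will be
    [- gamma1] or [- gamma2]. *)
Lemma ar_gap : \forall n \near \oo, `|r n| < 1 /\ g <= kappa n * (1 - r n ^+ 2).
Proof.
have g2 : g < 2 * g by have := g_gt0; lra.
move/cvgr_ge : r_cvg => /(_ _ g2); apply: filterS => n h; split => //.
have : 0 < 1 - r n ^+ 2.
  by rewrite -(pmulr_rgt0 _ (kappa_gt0 n)); exact: lt_le_trans h.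
by rewrite subr_gt0 -real_normK ?num_real// expr_lt1.
Qed.

Let C0 : 0 < C. Proof. by have := C_ge1; lra. Qed.

Lemma ar_mart_cvg0 : superexp_cvg P s (fun n w => ar_mart V (r n) n w / n%:R) 0.
Proof.
apply: superexp_cvg0_chernoff => // [n|e K e0].
  by apply: measurable_funM => //; exact: measurable_ar_mart.
(* The Chernoff parameter is [y] times the gap [h], as large as [mgf_ar_mart] permits in order. The
   exponent is then at most [- n * h * y * e / 2], and [n * h >= n * g / kappa n] outgrows the
   speed. *)
pose y := Num.min (8 * C)^-1 (e / (8 * C ^+ 2)).
have y0 : 0 < y by rewrite lt_min invr_gt0 divr_gt0 ?mulr_gt0// exprn_gt0.
have yC : y * (8 * C) <= 1 by rewrite -ler_pdivlMr ?mulr_gt0// div1r ge_min lexx.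
have ye : y * (8 * C ^+ 2) <= e.
  by rewrite -ler_pdivlMr ?mulr_gt0 ?exprn_gt0// ge_min lexx orbT.
pose D := g * y * e / 2.
have D0 : 0 < D by rewrite divr_gt0// !mulr_gt0.
have := rate_poly kappa_gt0 kappa_cvg lambda_gt0 lambda_cvg rate (`|K| / D)
  (isT : 2 <= 6)%N (isT : 1 <= 6)%N.
apply: filterS3 ar_gap (nbhs_infty_gt 0) => n [r1 gh] n0; rewrite expr1 => rn.
have nN : n%:R != 0 :> R by rewrite pnatr_eq0 -lt0n.
set h := 1 - r n ^+ 2 in gh.
have h0 : 0 < h by rewrite -(pmulr_rgt0 _ (kappa_gt0 n)); exact: lt_le_trans gh.
have yh : 0 < y * h by exact: mulr_gt0.
have uC : 8 * C * `|y * h| <= h.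
  by rewrite (ger0_norm (ltW yh)); have := ler_wpM2r (ltW h0) yC; lra.
have uC' : 8 * C * `|- (y * h)| <= h by rewrite normrN.
exists (n%:R * (y * h)), (n%:R * (4 * C ^+ 2 * (y * h) ^+ 2 / h)); split.
- by rewrite mulr_ge0// ltW.
- rewrite (eq_integral (fun w => (expR (y * h * ar_mart V (r n) n w))%:E)).
    exact: (mgf_ar_mart mV indep idV C_ge1 mgfV).
  by move=> w _; congr (expR _)%:E; field.
- rewrite (eq_integral (fun w => (expR (- (y * h) * ar_mart V (r n) n w))%:E)).
    rewrite -(sqrrN (y * h)).
    exact: (mgf_ar_mart mV indep idV C_ge1 mgfV).
  by move=> w _; congr (expR _)%:E; field.
- have -> : n%:R * (4 * C ^+ 2 * (y * h) ^+ 2 / h) = n%:R * h * (4 * C ^+ 2 * y ^+ 2).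
    by field; rewrite gt_eqF.
  have h1 : 4 * C ^+ 2 * y ^+ 2 <= y * e / 2.
    by have := ler_wpM2l (ltW y0) ye; lra.
  have nh : 0 <= n%:R * h by rewrite mulr_ge0// ltW.
  have : `|K| * s n <= n%:R * h * (y * e / 2).
    rewrite -(@ler_pM2r _ (kappa n))//.
    have := rn; rewrite mulrAC ler_pdivrMr// mulrA => /le_trans; apply.
    rewrite /D (_ : n%:R * h * (y * e / 2) * kappa n = n%:R * (kappa n * h * y * e / 2)); last by ring.
    have w0 : 0 <= y * e / 2 by rewrite divr_ge0// mulr_ge0// ltW.
    by have := ler_wpM2l (ler0n R n) (ler_wpM2r w0 gh); lra.
  have := ler_wpM2l nh h1.
  have : K * s n <= `|K| * s n by rewrite ler_wpM2r ?ler_norm// ltW.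
  lra.
Qed.

Lemma ar_sqr_cvg0 (k : nat -> nat) :
  superexp_cvg P s (fun n w => eps_ar (r n) V (k n) w ^+ 2 / q n) 0.
Proof.
apply: superexp_cvg0_chernoff => // [n|e K e0].
  by apply: measurable_funM => //; apply: measurable_funX; exact: measurable_ar.
pose D := (`|K| + 1) * (8 * C) / (g * e).
have D0 : 0 <= D by rewrite divr_ge0 ?mulr_ge0 ?addr_ge0// ltW.
have := rate_poly kappa_gt0 kappa_cvg lambda_gt0 lambda_cvg rate (D ^+ 2)
  (isT : 2 <= 6)%N (isT : 1 <= 6)%N.
have F1 : \forall n \near \oo, (0 < n)%N /\ 1 <= lambda n.
  exact: filterI (nbhs_infty_gt 0) (near_lambda lambda_cvg 1).
apply: filterS3 ar_gap F1 => n [r1 gh] [n0 l1]; rewrite expr1 => rn.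
have q0 := norming_gt0 kappa_gt0 lambda_gt0 n0.
have qN : q n != 0 by rewrite gt_eqF.
set h := 1 - r n ^+ 2 in gh.
have h0 : 0 < h by rewrite -(pmulr_rgt0 _ (kappa_gt0 n)); exact: lt_le_trans gh.
have C8 : 0 < 8 * C by rewrite mulr_gt0.
(* The largest value allowed by [mgf_ar_sqr], for which the moment is at most [expR 4^-1] whatever
   the time index. What remains is that [norming n / kappa n] dominates the speed. *)
pose A := h / (8 * C).
have A0 : 0 < A by rewrite divr_gt0.
exists (q n * A), 4^-1; split.
- by rewrite mulr_ge0// ltW.
- rewrite (eq_integral (fun w => (expR (A * eps_ar (r n) V (k n) w ^+ 2))%:E)).
    apply: le_trans (mgf_ar_sqr mV indep idV C_ge1 mgfV _ r1 (ltW A0) _) _.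
      by rewrite /A mulrC divfK ?gt_eqF.
    rewrite lee_fin ler_expR -/h /A le_eqVlt; apply/orP; left; apply/eqP; field.
    by rewrite !gt_eqF.
  by move=> w _; congr (expR _)%:E; field.
(* The opposite variable is nonpositive, so its moment generating function is at most 1. *)
- apply: (@le_trans _ _ (\int[P]_w 1%:E)%E).
    apply: ge0_le_integral => //.
      apply/measurable_EFinP; apply: measurableT_comp => //; apply: measurable_funM => //.
      apply: measurableT_comp => //; apply: measurable_funM => //.
      by apply: measurable_funX; exact: measurable_ar.
    move=> w _; rewrite lee_fin -[leRHS]expR0 ler_expR mulrN oppr_le0.
    by rewrite mulr_ge0 ?(mulr_ge0 (ltW q0) (ltW A0))// divr_ge0 ?sqr_ge0// ltW.
  by rewrite integral_cst//= probability_setT mul1e lee_fin -[leLHS]expR0 ler_expR.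
- have qD : D * (kappa n * s n) <= q n.
    rewrite -ler_sqr ?nnegrE ?(ltW q0)//; last first.
      by rewrite mulr_ge0// mulr_ge0// ltW.
    rewrite sqr_norming//.
    rewrite (_ : (D * _) ^+ 2 = D ^+ 2 * (lambda n ^+ 2 * kappa n) * (lambda n ^+ 2 * kappa n)); last by ring.
    rewrite (_ : lambda n ^+ 2 * (n%:R * _) = n%:R * (lambda n ^+ 2 * kappa n)); last by ring.
    by rewrite ler_wpM2r// mulr_ge0// ltW.
  have : (`|K| + 1) * s n <= q n * A * e.
    rewrite -(@ler_pM2r _ (8 * C * kappa n)) ?mulr_gt0//.
    apply: (@le_trans _ _ (q n * (g * e))).
      apply: le_trans (ler_wpM2r _ qD); last by rewrite mulr_ge0// ltW.
      rewrite /D le_eqVlt; apply/orP; left; apply/eqP; field.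
      by rewrite !gt_eqF.
    rewrite (_ : q n * A * e * _ = q n * (kappa n * h * e)); last first.
      by rewrite /A; field; rewrite gt_eqF.
    by rewrite ler_wpM2l ?(ltW q0)// ler_wpM2r// ltW.
  have : K * s n <= `|K| * s n by rewrite ler_wpM2r ?ler_norm// ltW.
  have : 1 <= s n by rewrite expr_ge1// ltW.
  lra.
Qed.

Lemma sqr_tilt (t : R) n : (0 < n)%N ->
  (t * s n / q n) ^+ 2 = t ^+ 2 * s n / (n%:R * kappa n).
Proof.
move=> n0; have q0 := norming_gt0 kappa_gt0 lambda_gt0 n0.
rewrite !exprMn exprVn sqr_norming//; field.
by rewrite !gt_eqF ?ltr0n.
Qed.

Lemma ar_mart_mgf (tb : R) : \forall n \near \oo, forall t : R, `|t| <= tb ->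
  (\int[P]_w (expR (t * s n * (ar_mart V (r n) n w / q n)))%:E <=
   (expR (4 * C ^+ 2 * tb ^+ 2 / g * s n))%:E)%E.
Proof.
have := rate_poly kappa_gt0 kappa_cvg lambda_gt0 lambda_cvg rate (64 * C ^+ 2 * tb ^+ 2 / g ^+ 2)
  (isT : 2 <= 6)%N (isT : 1 <= 6)%N.
apply: filterS3 ar_gap (nbhs_infty_gt 0) => n [r1 gh] n0; rewrite expr1 => rn t ttb.
have t2 : t ^+ 2 <= tb ^+ 2.
  by rewrite -real_normK ?num_real// lerXn2r// nnegrE//; exact: le_trans ttb.
have q0 := norming_gt0 kappa_gt0 lambda_gt0 n0.
have qN : q n != 0 by rewrite gt_eqF.
have nN : 0 < n%:R :> R by rewrite ltr0n.
have k0 := kappa_gt0 n; have l0 := lambda_gt0 n.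
set h := 1 - r n ^+ 2 in gh.
have h0 : 0 < h by rewrite -(pmulr_rgt0 _ k0); exact: lt_le_trans gh.
pose u := t * s n / q n.
have u2 : u ^+ 2 = t ^+ 2 * s n / (n%:R * kappa n) by exact: sqr_tilt.
have uh : 8 * C * `|u| <= h.
  rewrite -(@ler_pM2l _ (kappa n))//; apply: le_trans gh.
  rewrite -ler_sqr ?nnegrE ?(ltW g_gt0)//; last first.
    by rewrite mulr_ge0 ?(ltW k0)// mulr_ge0// mulr_ge0// ltW.
  rewrite !exprMn real_normK ?num_real// u2.
  move: rn; rewrite [_ / g ^+ 2 * _]mulrAC ler_pdivrMr ?exprn_gt0// => rn.
  rewrite (_ : kappa n ^+ 2 * _ = 64 * C ^+ 2 * t ^+ 2 * (s n * kappa n) / n%:R); last first.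
    by field; rewrite !gt_eqF.
  rewrite ler_pdivrMr// [leRHS]mulrC; apply: le_trans rn.
  apply: ler_wpM2r; first by rewrite mulr_ge0 ?(ltW k0)// ltW ?s_gt0.
  by rewrite ler_wpM2l// mulr_ge0 ?sqr_ge0.
rewrite (eq_integral (fun w => (expR (u * ar_mart V (r n) n w))%:E)); last first.
  by move=> w _; congr (expR _)%:E; rewrite /u; field.
apply: le_trans (mgf_ar_mart mV indep idV C_ge1 mgfV _ r1 uh) _.
rewrite lee_fin ler_expR u2 -/h.
rewrite (_ : _ * _ = 4 * C ^+ 2 * t ^+ 2 * s n * (kappa n * h)^-1); last first.
  by field; rewrite !gt_eqF.
rewrite [leRHS]mulrAC ler_pM//.
- by rewrite mulr_ge0 ?(ltW (s_gt0 n))// mulr_ge0 ?sqr_ge0// mulr_ge0 ?sqr_ge0.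
- by rewrite invr_ge0 mulr_ge0// ltW.
- by rewrite ler_wpM2r ?(ltW (s_gt0 n))// ler_wpM2l// mulr_ge0 ?sqr_ge0.
- by rewrite lef_pV2 ?posrE ?mulr_gt0.
Qed.

Lemma ar_mart_tight : superexp_tight P s (fun n w => ar_mart V (r n) n w / q n).
Proof.
apply: (superexp_tight_chernoff s_gt0 s_cvg (C := 4 * C ^+ 2 * 1 ^+ 2 / g)).
  by move=> n; apply: measurable_funM => //; exact: measurable_ar_mart.
apply: filterS (ar_mart_mgf 1) => n H; split.
  by have := H 1; rewrite normr1 mul1r; exact.
have := H (-1); rewrite normrN normr1 => /(_ (lexx _)).
rewrite (eq_integral
  (fun w => (expR (lambda n ^+ 2 * - (ar_mart V (r n) n w / q n)))%:E))// => w _.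
by rewrite mulN1r mulrN mulNr.
Qed.

(* union bound over the [n] times, affordable because [n >= lambda n ^+ 4] *)
Lemma ar_max_small (t e : R) : 0 < e -> superexp_small P s (fun n =>
  [set w | exists2 k, (k < n)%N & e < `|t * s n / q n * eps_ar (r n) V k w|]).
Proof.
move=> e0 K.
(* [t ^+ 2 + 1] in place of [t ^+ 2] covers [t = 0]. Each single time then has probability at most
   [expR (4^-1 - c * z)] with [z = n / lambda n ^+ 2]. *)
pose c := g * e ^+ 2 / (8 * C * (t ^+ 2 + 1)).
have t1 : 0 < t ^+ 2 + 1 by have := sqr_ge0 t; lra.
have c0 : 0 < c by rewrite divr_gt0 ?mulr_gt0// exprn_gt0.
have rt (D : R) := rate_poly kappa_gt0 kappa_cvg lambda_gt0 lambda_cvg rate D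
  (isT : 4 <= 6)%N (isT : 0 <= 6)%N.
have rt2 := rate_poly kappa_gt0 kappa_cvg lambda_gt0 lambda_cvg rate (96 / c ^+ 3)
  (isT : 2 <= 6)%N (isT : 0 <= 6)%N.
apply: filterS3 ar_gap (filterI (nbhs_infty_gt 0) rt2) (filterI (rt 1) (rt (2 * K / c))) =>
  n [r1 gh] [n0 rn2] [rn1 rnK].
rewrite !expr0 !mulr1 in rn1 rn2 rnK.
have q0 := norming_gt0 kappa_gt0 lambda_gt0 n0.
have nN : 0 < n%:R :> R by rewrite ltr0n.
have k0 := kappa_gt0 n; have l0 := lambda_gt0 n; have sn := s_gt0 n.
set h := 1 - r n ^+ 2 in gh.
have h0 : 0 < h by rewrite -(pmulr_rgt0 _ k0); exact: lt_le_trans gh.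
pose A := h / (8 * C).
have A0 : 0 <= A by rewrite divr_ge0 ?(ltW h0)// mulr_ge0// ltW.
pose y := e ^+ 2 * (n%:R * kappa n) / ((t ^+ 2 + 1) * s n).
pose E k := [set w | y <= eps_ar (r n) V k w ^+ 2].
have mE k : measurable (E k).
  by apply: measurable_set_ge; apply: measurable_funX; exact: measurable_ar.
pose z := n%:R / s n.
have z0 : 0 < z by rewrite divr_gt0.
have PE k : (P (E k) <= (expR (4^-1 - c * z))%:E)%E.
  have H := mgf_ar_sqr mV indep idV C_ge1 mgfV k r1 A0.
  have mY2 : measurable_fun setT (fun w => eps_ar (r n) V k w ^+ 2).
    by apply: measurable_funX; exact: measurable_ar.
  have h8 : 8 * C * A <= 1 - r n ^+ 2 by rewrite /A mulrC divfK ?gt_eqF ?mulr_gt0.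
  apply: le_trans (chernoff_ge y mY2 A0 (H h8)) _.
  rewrite lee_fin ler_expR -/h lerD//.
    rewrite /A le_eqVlt; apply/orP; left; apply/eqP; field.
    by rewrite !gt_eqF.
  rewrite lerN2 /A /y /c /z.
  rewrite (_ : h / (8 * C) * _ = kappa n * h * (e ^+ 2 / (8 * C * (t ^+ 2 + 1)) * (n%:R / s n))); last first.
    by field; rewrite !gt_eqF.
  rewrite (_ : g * e ^+ 2 / _ * _ = g * (e ^+ 2 / (8 * C * (t ^+ 2 + 1)) * (n%:R / s n))); last first.
    by field; rewrite !gt_eqF.
  apply: ler_wpM2r gh; rewrite mulr_ge0 ?(ltW z0)// divr_ge0 ?sqr_ge0//.
  by rewrite mulr_ge0 ?(ltW t1)// mulr_ge0// ltW.
exists (\big[setU/set0]_(k < n) E k); first by apply: bigsetU_measurable.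
split.
  move=> w [k kn /= ek].
  rewrite -(bigcup_mkord n E); exists k => //=.
  have u2 := sqr_tilt t n0.
  have e2 : e ^+ 2 <= (t * s n / q n) ^+ 2 * eps_ar (r n) V k w ^+ 2.
    rewrite -exprMn -[leRHS]real_normK ?num_real//.
    by rewrite lerXn2r ?nnegrE ?(ltW e0)// ltW.
  rewrite /E /= /y ler_pdivrMr ?mulr_gt0//.
  move: e2; rewrite u2 mulrAC ler_pdivlMr ?mulr_gt0// => e2; apply: le_trans e2 _.
  rewrite [leRHS]mulrC ler_wpM2r ?sqr_ge0// ler_wpM2r ?(ltW sn)//; lra.
apply: le_trans (Boole_inequality P (fun k _ => mE k)) _.
apply: (@le_trans _ _ (\sum_(k < n) (expR (4^-1 - c * z))%:E)%E).
  by apply: lee_sum => k _; exact: PE.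
rewrite sumEFin lee_fin sumr_const card_ord -[leLHS]mulr_natl.
have cz : 0 <= c * z / 2 by rewrite divr_ge0// ltW// mulr_gt0.
(* The number of events becomes polynomial in [z]. Half of the exponent [c * z] absorbs it by the
   cubic lower bound on the exponential (whence 96); the other half gives the rate [K]. *)
have nz : n%:R <= z ^+ 2.
  rewrite /z exprMn exprVn -exprM [n%:R ^+ 2]expr2 -mulrA ler_peMr ?ler0n//.
  by rewrite ler_pdivlMr ?exprn_gt0.
have z96 : 96 / c ^+ 3 <= z by rewrite /z ler_pdivlMr.
have e14 : expR 4^-1 <= 2 :> R.
  have h4 : 4^-1 <= 1 :> R by lra.
  have := expR_le_quadratic h4; lra.
have ez : 2 * z ^+ 2 <= expR (c * z / 2).
  apply: le_trans (expR_gt_cubic cz).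
  move: z96; rewrite ler_pdivrMr ?exprn_gt0// => z96.
  have := ler_wpM2l (sqr_ge0 z) z96; lra.
have -> : expR (4^-1 - c * z) = expR 4^-1 * (expR (- (c * z / 2)) * expR (- (c * z / 2))).
  by rewrite -!expRD; congr expR; field.
apply: (@le_trans _ _ (expR (- (c * z / 2)))); last first.
  rewrite ler_expR mulNr lerN2 /z.
  move: rnK; rewrite mulrAC ler_pdivrMr// => rnK.
  rewrite -(@ler_pM2r _ (2 * s n)) ?mulr_gt0//.
  rewrite (_ : c * _ / 2 * _ = n%:R * c); last by field; rewrite gt_eqF.
  by apply: le_trans rnK; rewrite le_eqVlt; apply/orP; left; apply/eqP; ring.
set a := c * z / 2 in cz ez *.
rewrite [leLHS]mulrA [leLHS]mulrA ler_piMl ?expR_ge0// expRN ler_pdivrMr ?expR_gt0// mul1r.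
apply: le_trans ez; rewrite [leRHS]mulrC.
by apply: ler_pM => //; exact: expR_ge0.
Qed.

(** Obtained by squaring the recursion and summing; it reduces the energy to the innovations, a
    martingale and a boundary term. *)
Lemma ar_sqr_sum (x : R) n w : (1 - x ^+ 2) * \sum_(0 <= k < n) eps_ar x V k w ^+ 2 =
  2 * x * ar_mart V x n w + \sum_(0 <= k < n) V k w ^+ 2 - eps_ar x V n w ^+ 2.
Proof.
elim: n => [|n IH]; first by rewrite /ar_mart !big_geq//= expr0n /=; ring.
by rewrite /ar_mart !big_nat_recr//= mulrDr IH /ar_mart; ring.
Qed.

Lemma innov_sqr_mean_cvg : superexp_cvg P s
  (fun n w => (\sum_(0 <= k < n) V k w ^+ 2) / n%:R) s2.
Proof.
have := superexp_cvgD s_cvg innov_sqr_cvg0 (superexp_cvg_cst P s s2).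
rewrite add0r; apply: superexp_cvg_ext.
apply: filterS (nbhs_infty_gt 0) => n n0 w.
rewrite sumrB sumr_const_nat subn0 -[s2 *+ n]mulr_natr; field.
by rewrite pnatr_eq0 -lt0n.
Qed.

Lemma ar_sqr_mean_cvg0 (k : nat -> nat) :
  superexp_cvg P s (fun n w => eps_ar (r n) V (k n) w ^+ 2 / n%:R) 0.
Proof.
have qc := norming_cvg0 kappa_gt0 kappa_cvg lambda_gt0 lambda_cvg rate.
have := superexp_cvgM s_cvg (ar_sqr_cvg0 k) (superexp_cvg_seq P s qc).
rewrite mulr0; apply: superexp_cvg_ext.
apply: filterS (nbhs_infty_gt 0) => n n0 w; field.
by rewrite pnatr_eq0 -lt0n n0 gt_eqF// norming_gt0.
Qed.

Lemma ar_energy_cvg (rl : R) : r @ \oo --> rl -> superexp_cvg P s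
  (fun n w => (1 - r n ^+ 2) * (\sum_(0 <= k < n) eps_ar (r n) V k w ^+ 2) / n%:R) s2.
Proof.
move=> rc.
have r2c : (fun n => 2 * r n) @ \oo --> 2 * rl by apply: cvgMr.
have h1 := superexp_cvgM s_cvg (superexp_cvg_seq P s r2c) ar_mart_cvg0.
have h2 := superexp_cvgN (ar_sqr_mean_cvg0 id).
have := superexp_cvgD s_cvg (superexp_cvgD s_cvg h1 innov_sqr_mean_cvg) h2.
rewrite mulr0 add0r oppr0 addr0; apply: superexp_cvg_ext.
by apply: nearW => n w; rewrite ar_sqr_sum !mulrDl mulNr mulrA.
Qed.

End ar_family.

(** Writing the inverse as [f] times a power of [f ^+ 2] moves the inversion to a nonnegative base;
    both sides are 0 where [f] vanishes. *)
Lemma measurable_funV {R : realType} {d : measure_display} {T : measurableType d} (f : T -> R) :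
  measurable_fun setT f -> measurable_fun setT (fun w => (f w)^-1).
Proof.
move=> mf; rewrite (_ : (fun w => _) = (fun w => f w * (f w ^+ 2) `^ (-1))).
  apply: measurable_funM => //; apply: (measurableT_comp (f := fun x : R => x `^ (-1))).
    exact: measurable_powR.
  exact: measurable_funX.
apply/funext => w; rewrite powR_inv1 ?sqr_ge0//.
have [->|f0] := eqVneq (f w) 0; first by rewrite invr0 mul0r.
by field.
Qed.

(** * Algebra of the estimators *)

Section estimator_algebra.
Context {R : realType} {d : measure_display} {T : measurableType d}.
Variables (V : nat -> T -> R) (theta rho : R).
Hypothesis theta_rho : theta - rho != 0.

(* [X_lag k] is [X_{k-1}], with value 0 at [k = 0] *)
Definition X_lag k (w : T) := (eps_ar theta V k w - eps_ar rho V k w) / (theta - rho).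

Local Notation x := (X_ar theta rho V).
Local Notation xm := X_lag.

Lemma X_arE k w : x k w = (theta * eps_ar theta V k w - rho * eps_ar rho V k w) / (theta - rho).
Proof.
elim: k => [|k IH] /=; first by rewrite !mulr0 subrr mul0r.
by rewrite IH; field.
Qed.

Lemma X_lag0 w : xm 0 w = 0.
Proof. by rewrite /X_lag /= subrr mul0r. Qed.

Lemma X_lagS k w : xm k.+1 w = x k w.
Proof. by rewrite X_arE /X_lag /=; field. Qed.

Lemma X_arS k w : x k.+1 w = (theta + rho) * x k w - theta * rho * xm k w + V k w.
Proof. by rewrite !X_arE /X_lag /=; field. Qed.

Local Arguments X_ar : simpl never.

Definition X_energy n w := \sum_(0 <= k < n) x k w ^+ 2.
Definition X_mart n w := \sum_(0 <= k < n) x k w * V k w.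
Definition X_lag_mart n w := \sum_(0 <= k < n) xm k w * V k w.
Definition X_cov n w := \sum_(0 <= k < n) x k.+1 w * x k w.

Local Notation S := X_energy.
Local Notation M := X_mart.
Local Notation M' := X_lag_mart.

Lemma sum_X_lag n w : \sum_(0 <= k < n) x k w * xm k w = X_cov n w - x n w * xm n w.
Proof.
elim: n => [|n IH]; first by rewrite /X_cov !big_geq// X_lag0 mulr0 subr0.
by rewrite /X_cov !big_nat_recr//= -/(X_cov n w) IH X_lagS; ring.
Qed.

Lemma sum_X_lag_sqr n w : \sum_(0 <= k < n) xm k w ^+ 2 = S n w - xm n w ^+ 2.
Proof.
elim: n => [|n IH]; first by rewrite /X_energy !big_geq// X_lag0 expr0n/= subr0.
by rewrite /X_energy !big_nat_recr//= -/(X_energy n w) IH X_lagS; ring.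
Qed.

(** Multiply the second-order recursion [X_arS] by [x k] and sum: the lagged products give back
    [X_cov] up to a boundary term, and collecting it on the left produces [1 + theta * rho]. *)
Lemma X_covE n w : (1 + theta * rho) * X_cov n w =
  (theta + rho) * S n w + M n w + theta * rho * (x n w * xm n w).
Proof.
have : X_cov n w = (theta + rho) * S n w -
    theta * rho * (\sum_(0 <= k < n) x k w * xm k w) + M n w.
  rewrite /X_cov /X_energy /X_mart !mulr_sumr -sumrB -big_split /=.
  by apply: eq_bigr => k _; rewrite X_arS; ring.
by rewrite sum_X_lag => h; rewrite mulrDl mul1r {1}h; ring.
Qed.

Lemma sum_X_lag2 n w : \sum_(0 <= k < n) x k.+1 w * xm k w =
  (theta + rho) * (X_cov n w - x n w * xm n w) - theta * rho * (S n w - xm n w ^+ 2) + M' n w.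
Proof.
rewrite -sum_X_lag -sum_X_lag_sqr !mulr_sumr -sumrB -big_split /=.
by apply: eq_bigr => k _; rewrite X_arS; ring.
Qed.

Lemma theta_hatE n w : theta_hat theta rho V n w = X_cov n w / S n w.
Proof. by rewrite /theta_hat !big_add1. Qed.

(** One formula including [k = 0], where [x] and its lag are 0, in agreement with the convention for
    the initial residual. *)
Lemma eps_hatE n k w :
  eps_hat theta rho V n k w = x k w - theta_hat theta rho V n w * xm k w.
Proof.
by case: k => [|k]; rewrite /eps_hat /= ?X_lag0 ?mulr0 ?subr0// X_lagS.
Qed.

Lemma theta_hat_sub n w : S n w != 0 -> 1 + theta * rho != 0 ->
  theta_hat theta rho V n w - (theta + rho) / (1 + theta * rho) =
  (M n w + theta * rho * (x n w * xm n w)) / ((1 + theta * rho) * S n w).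
Proof.
move=> S0 tr0; rewrite theta_hatE.
rewrite (_ : X_cov n w = ((theta + rho) * S n w + M n w + theta * rho * (x n w * xm n w)) /
  (1 + theta * rho)); last by rewrite -X_covE mulrC mulKf.
by field; rewrite S0 tr0.
Qed.

Lemma rho_hatE n w : let th := theta_hat theta rho V n w in
  rho_hat theta rho V n w =
  (X_cov n w - th * S n w - th * (\sum_(0 <= k < n) x k.+1 w * xm k w) +
     th ^+ 2 * (X_cov n w - x n w * xm n w)) /
  (S n w - 2 * th * (X_cov n w - x n w * xm n w) + th ^+ 2 * (S n w - xm n w ^+ 2)).
Proof.
move=> th; rewrite /rho_hat !big_add1 /=; congr (_ / _).
  rewrite -sum_X_lag /X_cov /X_energy !mulr_sumr -!sumrB -big_split/=.
  by apply: eq_bigr => k _; rewrite !eps_hatE X_lagS -/th; ring.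
rewrite -sum_X_lag -sum_X_lag_sqr /X_energy !mulr_sumr -!sumrB -big_split/=.
by apply: eq_bigr => k _; rewrite !eps_hatE -/th; ring.
Qed.

(** [D] is the denominator of [rho_hat] divided by [S]. Every term over [D] has a reason to vanish
    after scaling: a factor [1 + theta * rho], the lagged martingale over [S] without the gain of
    order [kappa], or a boundary ratio. *)
Lemma rho_hat_sub n w : S n w != 0 -> 1 + theta * rho != 0 ->
  let th := theta_hat theta rho V n w in
  let ths := (theta + rho) / (1 + theta * rho) in
  let b1 := x n w * xm n w / S n w in let b2 := xm n w ^+ 2 / S n w in
  let D := 1 - th ^+ 2 + 2 * th * b1 - th ^+ 2 * b2 in
  D != 0 ->
  rho_hat theta rho V n w - theta * rho * ths = theta * rho * (th - ths) +
  (th ^+ 2 * (1 + theta * rho) * (th - ths) - th * (M' n w / S n w)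
   + ((theta + rho) * th - th ^+ 2) * b1 - th * (theta * rho) * b2
   - theta * rho * th * (2 * th * b1 - th ^+ 2 * b2)) / D.
Proof.
move=> S0 tr0 th ths b1 b2 D D0.
have PE : X_cov n w = th * S n w by rewrite /th theta_hatE mulfVK.
have B1 : x n w * xm n w = b1 * S n w by rewrite /b1 mulfVK.
have B2 : xm n w ^+ 2 = b2 * S n w by rewrite /b2 mulfVK.
have M1 : M' n w = M' n w / S n w * S n w by rewrite mulfVK.
rewrite rho_hatE -/th sum_X_lag2 PE B1 B2 {1}M1.
set m := M' n w / S n w.
have -> : S n w - 2 * th * (th * S n w - b1 * S n w) + th ^+ 2 * (S n w - b2 * S n w) =
  D * S n w by rewrite /D; ring.
have ab : theta + rho = ths * (1 + theta * rho) by rewrite /ths mulfVK.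
rewrite ab; move: D0 S0; rewrite /D.
move: (S n w) (th) (ths) (b1) (b2) m (theta * rho) tr0 => s t u c1 c2 m p p0 D0 s0.
by field; rewrite D0 s0.
Qed.

End estimator_algebra.

Section cross_algebra.
Context {R : realType} {d : measure_display} {T : measurableType d}.
Variables (V : nat -> T -> R) (theta rho : R).
Hypothesis theta_rho : theta - rho != 0.

Lemma past_measurable_X (theta' rho' : R) k n : (k <= n)%N ->
  measurable_fun setT (X_ar theta' rho' V k : past V n -> R).
Proof.
elim: k => [|k IH] kn; first exact: measurable_cst.
apply: measurable_funD; last exact: past_measurable_ar.
by apply: measurable_funM => //; apply: IH; exact: ltnW.
Qed.

Lemma ar_cross_sum n w :
  (1 - theta * rho) * \sum_(0 <= k < n) eps_ar theta V k w * eps_ar rho V k w =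
  theta * ar_mart V theta n w + rho * ar_mart V rho n w +
  \sum_(0 <= k < n) V k w ^+ 2 - eps_ar theta V n w * eps_ar rho V n w.
Proof.
elim: n => [|n IH]; first by rewrite /ar_mart !big_geq//= !mulr0 !addr0 subr0.
by rewrite /ar_mart !big_nat_recr//= mulrDr IH /ar_mart; ring.
Qed.

Lemma X_energyE n w : X_energy V theta rho n w =
  (theta ^+ 2 * \sum_(0 <= k < n) eps_ar theta V k w ^+ 2 +
   rho ^+ 2 * \sum_(0 <= k < n) eps_ar rho V k w ^+ 2 -
   2 * (theta * rho) * \sum_(0 <= k < n) eps_ar theta V k w * eps_ar rho V k w)
  / (theta - rho) ^+ 2.
Proof.
rewrite /X_energy !mulr_sumr -big_split/= -sumrB mulr_suml.
by apply: eq_bigr => k _; rewrite X_arE//; field.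
Qed.

Lemma X_martE n w : X_mart V theta rho n w =
  (theta * ar_mart V theta n w - rho * ar_mart V rho n w) / (theta - rho).
Proof.
rewrite /X_mart /ar_mart !mulr_sumr -sumrB mulr_suml.
by apply: eq_bigr => k _; rewrite X_arE//; field.
Qed.

Lemma X_lag_martE n w : X_lag_mart V theta rho n w =
  (ar_mart V theta n w - ar_mart V rho n w) / (theta - rho).
Proof.
rewrite /X_lag_mart /ar_mart -sumrB mulr_suml.
by apply: eq_bigr => k _; rewrite /X_lag; field.
Qed.

End cross_algebra.

(** * Asymptotics of the estimators *)

Section model.
Context {R : realType} {d : measure_display} {T : measurableType d}.
Variables (P : probability T R) (V : nat -> T -> R).
Hypothesis mV : forall k, measurable_fun setT (V k).
Hypothesis indep : mutually_independent P V.
Hypothesis idV : identically_distributed P V.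
Variables (C C' s2 : R).
Hypothesis C_ge1 : 1 <= C.
Hypothesis mgfV : forall a b : R, 0 <= b -> b <= C^-1 ->
  (\int[P]_w (expR (a * V 0%N w + b * V 0%N w ^+ 2))%:E <=
   (expR (C * a ^+ 2 + C * b))%:E)%E.
Hypothesis C'_ge1 : 1 <= C'.
Hypothesis mgfV2 : forall b : R, `|b| <= C'^-1 ->
  (\int[P]_w (expR (b * (V 0%N w ^+ 2 - s2)))%:E <= (expR (C' * b ^+ 2))%:E)%E.
Hypothesis s2_gt0 : 0 < s2.
Variables (kappa lambda : nat -> R).
Hypothesis kappa_gt0 : forall n, 0 < kappa n.
Hypothesis kappa_cvg : kappa @ \oo --> +oo.
Hypothesis lambda_gt0 : forall n, 0 < lambda n.
Hypothesis lambda_cvg : lambda @ \oo --> +oo.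
Hypothesis rate : (fun n => n%:R / (lambda n ^+ 6 * kappa n ^+ 6)) @ \oo --> +oo.
Variables (gamma1 gamma2 : R).
Hypothesis gamma1_lt0 : gamma1 < 0.
Hypothesis gamma2_lt0 : gamma2 < 0.

Local Notation s := (fun n => lambda n ^+ 2).
Local Notation q := (norming kappa lambda).
Let s_gt0 n : 0 < s n. Proof. by rewrite exprn_gt0. Qed.
Let s_cvg : s @ \oo --> +oo. Proof. exact: speed_cvg. Qed.
Let theta n := 1 + gamma1 / kappa n.
Let rho n := -1 - gamma2 / kappa n.
Let G := - (gamma1 + gamma2).

Let G_gt0 : 0 < G.
Proof. by rewrite /G; have := gamma1_lt0; have := gamma2_lt0; lra. Qed.

Let kN n : kappa n != 0. Proof. by rewrite gt_eqF. Qed.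

Let kV_cvg : (fun n => (kappa n)^-1) @ \oo --> (0 : R).
Proof. by apply/gtr0_cvgV0 => //; exact: nearW. Qed.

Let theta_cvg : theta @ \oo --> (1 : R).
Proof.
rewrite -[X in _ --> X]addr0 -(mulr0 gamma1); apply: cvgD; first exact: cvg_cst.
by apply: cvgMr.
Qed.

Let rho_cvg : rho @ \oo --> (-1 : R).
Proof.
rewrite -[X in _ --> X]subr0 -(mulr0 gamma2); apply: cvgB; first exact: cvg_cst.
by apply: cvgMr.
Qed.

Let theta_gap : (fun n => kappa n * (1 - theta n ^+ 2)) @ \oo --> 2 * - gamma1.
Proof.
rewrite (_ : (fun n => _) = (fun n => 2 * - gamma1 - gamma1 ^+ 2 * (kappa n)^-1)).
  rewrite -[X in _ --> X]subr0 -(mulr0 (gamma1 ^+ 2)).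
  by apply: cvgB; [exact: cvg_cst|exact: cvgMr].
by apply/funext => n; rewrite /theta; field.
Qed.

Let rho_gap : (fun n => kappa n * (1 - rho n ^+ 2)) @ \oo --> 2 * - gamma2.
Proof.
rewrite (_ : (fun n => _) = (fun n => 2 * - gamma2 - gamma2 ^+ 2 * (kappa n)^-1)).
  rewrite -[X in _ --> X]subr0 -(mulr0 (gamma2 ^+ 2)).
  by apply: cvgB; [exact: cvg_cst|exact: cvgMr].
by apply/funext => n; rewrite /rho; field.
Qed.

Let prod_cvg : (fun n => theta n * rho n) @ \oo --> (-1 : R).
Proof. by rewrite -[X in _ --> X]mul1r; exact: cvgM. Qed.

Let prod_gap : (fun n => kappa n * (1 + theta n * rho n)) @ \oo --> G.
Proof.
rewrite (_ : (fun n => _) = (fun n => G - gamma1 * gamma2 * (kappa n)^-1)).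
  rewrite -[X in _ --> X]subr0 -(mulr0 (gamma1 * gamma2)).
  by apply: cvgB; [exact: cvg_cst|exact: cvgMr].
by apply/funext => n; rewrite /theta /rho /G; field.
Qed.

Let diff_cvg : (fun n => theta n - rho n) @ \oo --> (2 : R).
Proof. by rewrite (_ : 2 = 1 - (-1)); [exact: cvgB|ring]. Qed.

Let diff_neq0 : \forall n \near \oo, theta n - rho n != 0.
Proof.
have h : (1 : R) < 2 by lra.
move/cvgr_gt : diff_cvg => /(_ _ h); apply: filterS => n h1.
by rewrite gt_eqF//; lra.
Qed.

Let theta_star_cvg :
  (fun n => (theta n + rho n) / (1 + theta n * rho n)) @ \oo --> (gamma1 - gamma2) / G.
Proof.
rewrite (_ : (fun n => _) = (fun n => (gamma1 - gamma2) / (kappa n * (1 + theta n * rho n)))).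
  apply: cvgMr; apply: cvgV => //; exact: lt0r_neq0.
apply/funext => n; rewrite (_ : theta n + rho n = (gamma1 - gamma2) / kappa n).
  by rewrite invfM mulrA.
by rewrite /theta /rho; field.
Qed.

Let g1_gt0 : 0 < - gamma1. Proof. by rewrite oppr_gt0. Qed.
Let g2_gt0 : 0 < - gamma2. Proof. by rewrite oppr_gt0. Qed.

Lemma superexp_cvg0_le (Z Y : nat -> T -> R) :
  (\forall n \near \oo, forall w, `|Z n w| <= Y n w) ->
  superexp_cvg P s Y 0 -> superexp_cvg P s Z 0.
Proof.
move=> ZY cY e e0; apply: superexp_small_sub (cY e e0).
apply: filterS ZY => n h w /=; rewrite !subr0 => eZ.
by apply: lt_le_trans eZ _; apply: le_trans (h w) (ler_norm _).
Qed.

Let y2_cvg0 : superexp_cvg P s (fun n w => eps_ar (theta n) V n w ^+ 2 / q n) 0.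
Proof.
exact: (ar_sqr_cvg0 mV indep idV C_ge1 mgfV kappa_gt0 kappa_cvg lambda_gt0 lambda_cvg
  rate g1_gt0 theta_gap id).
Qed.

Let z2_cvg0 : superexp_cvg P s (fun n w => eps_ar (rho n) V n w ^+ 2 / q n) 0.
Proof.
exact: (ar_sqr_cvg0 mV indep idV C_ge1 mgfV kappa_gt0 kappa_cvg lambda_gt0 lambda_cvg
  rate g2_gt0 rho_gap id).
Qed.

Let q_ge0 n : 0 <= q n.
Proof. by rewrite mulr_ge0// ltW. Qed.

Let yz_cvg0 : superexp_cvg P s
  (fun n w => eps_ar (theta n) V n w * eps_ar (rho n) V n w / q n) 0.
Proof.
have := superexp_cvgD s_cvg y2_cvg0 z2_cvg0; rewrite addr0.
apply: superexp_cvg0_le; apply: nearW => n w.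
rewrite normrM normfV (ger0_norm (q_ge0 n)) -mulrDl ler_wpM2r ?invr_ge0//.
rewrite ler_norml; set y := eps_ar _ _ _ _; set z := eps_ar _ _ _ _.
by apply/andP; split; have := sqr_ge0 (y + z); have := sqr_ge0 (y - z);
  have := sqr_ge0 y; have := sqr_ge0 z; lra.
Qed.

Let q_n_cvg0 : (fun n => q n / n%:R) @ \oo --> 0.
Proof. exact: norming_cvg0. Qed.

Let near_n0 : \forall n \near \oo, [/\ n%:R != 0 :> R, q n != 0 & theta n - rho n != 0].
Proof.
apply: filterS2 diff_neq0 (nbhs_infty_gt 0) => n tr n0.
by split => //; [rewrite pnatr_eq0 -lt0n|rewrite gt_eqF// norming_gt0].
Qed.

Let sV_cvg := innov_sqr_mean_cvg mV indep idV C'_ge1 mgfV2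
  kappa_gt0 kappa_cvg lambda_gt0 lambda_cvg rate.

Let Ny_cvg0 := ar_mart_cvg0 mV indep idV C_ge1 mgfV kappa_gt0 kappa_cvg
  lambda_gt0 lambda_cvg rate g1_gt0 theta_gap.
Let Nz_cvg0 := ar_mart_cvg0 mV indep idV C_ge1 mgfV kappa_gt0 kappa_cvg
  lambda_gt0 lambda_cvg rate g2_gt0 rho_gap.
Let Ny_tight := ar_mart_tight mV indep idV C_ge1 mgfV kappa_gt0 kappa_cvg
  lambda_gt0 lambda_cvg rate g1_gt0 theta_gap.
Let Nz_tight := ar_mart_tight mV indep idV C_ge1 mgfV kappa_gt0 kappa_cvg
  lambda_gt0 lambda_cvg rate g2_gt0 rho_gap.
Let Sy_cvg := ar_energy_cvg mV indep idV C_ge1 mgfV C'_ge1 mgfV2 kappa_gt0 kappa_cvg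
  lambda_gt0 lambda_cvg rate g1_gt0 theta_gap theta_cvg.
Let Sz_cvg := ar_energy_cvg mV indep idV C_ge1 mgfV C'_ge1 mgfV2 kappa_gt0 kappa_cvg
  lambda_gt0 lambda_cvg rate g2_gt0 rho_gap rho_cvg.

(** Here [1 - theta n * rho n] tends to 2 instead of 0, so the mixed sum is of order [n], a factor
    [kappa n] below the two energies. *)
Let cross_cvg0 : superexp_cvg P s (fun n w =>
  (\sum_(0 <= k < n) eps_ar (theta n) V k w * eps_ar (rho n) V k w) / (n%:R * kappa n)) 0.
Proof.
have pN : 1 - -1 != 0 :> R by rewrite gt_eqF//; lra.
have pc : (fun n => (1 - theta n * rho n)^-1 * (kappa n)^-1) @ \oo --> (1 - -1)^-1 * (0 : R).
  by apply: cvgM => //; apply: cvgV => //; apply: cvgB => //; exact: cvg_cst.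
have h1 := superexp_cvgM s_cvg (superexp_cvg_seq P s theta_cvg) Ny_cvg0.
have h2 := superexp_cvgM s_cvg (superexp_cvg_seq P s rho_cvg) Nz_cvg0.
have h3 := superexp_cvgN (superexp_cvgM s_cvg yz_cvg0 (superexp_cvg_seq P s q_n_cvg0)).
have h4 := superexp_cvgD s_cvg (superexp_cvgD s_cvg (superexp_cvgD s_cvg h1 h2) sV_cvg) h3.
have := superexp_cvgM s_cvg h4 (superexp_cvg_seq P s pc).
rewrite !mulr0; apply: superexp_cvg_ext.
have pgt : \forall n \near \oo, 1 - theta n * rho n != 0.
  have h : (-1 : R) < 1 by lra.
  move/cvgr_lt : prod_cvg => /(_ _ h); apply: filterS => n h'.
  by rewrite gt_eqF// subr_gt0.
apply: filterS2 near_n0 pgt => n [n0 qn0 tr] p0 w.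
have -> : \sum_(0 <= k < n) eps_ar (theta n) V k w * eps_ar (rho n) V k w =
   (theta n * ar_mart V (theta n) n w + rho n * ar_mart V (rho n) n w +
  \sum_(0 <= k < n) V k w ^+ 2 - eps_ar (theta n) V n w * eps_ar (rho n) V n w) /
   (1 - theta n * rho n) by rewrite -ar_cross_sum mulrC mulKf.
by field; rewrite n0 qn0 p0 kN.
Qed.

(** The sum of the two energies [s2 / (2 * - gamma1)] and [s2 / (2 * - gamma2)], divided by the
    limit 4 of [(theta n - rho n) ^+ 2]. *)
Definition energy_lim := s2 * G / (8 * gamma1 * gamma2).

Let energy_lim_gt0 : 0 < energy_lim.
Proof.
have g12 : 0 < gamma1 * gamma2 by rewrite nmulr_rgt0.
by rewrite /energy_lim -[8 * _ * _]mulrA; apply: divr_gt0; apply: mulr_gt0.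
Qed.

Lemma energy_cvg : superexp_cvg P s
  (fun n w => X_energy V (theta n) (rho n) n w / (n%:R * kappa n)) energy_lim.
Proof.
have g1N : 2 * - gamma1 != 0 by rewrite mulf_neq0// gt_eqF.
have g2N : 2 * - gamma2 != 0 by rewrite mulf_neq0// gt_eqF.
have d0 : (2 : R) ^+ 2 != 0 by rewrite gt_eqF.
have c0 : (fun n => ((theta n - rho n) ^+ 2)^-1) @ \oo --> ((2 : R) ^+ 2)^-1.
  by apply: cvgV => //; rewrite expr2; under eq_fun do rewrite expr2; exact: cvgM.
have c1 : (fun n => theta n ^+ 2 * (kappa n * (1 - theta n ^+ 2))^-1) @ \oo -->
    1 ^+ 2 * (2 * - gamma1)^-1.
  apply: cvgM; last exact: cvgV.
  by rewrite expr2; under eq_fun do rewrite expr2; exact: cvgM.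
have c2 : (fun n => rho n ^+ 2 * (kappa n * (1 - rho n ^+ 2))^-1) @ \oo -->
    (-1) ^+ 2 * (2 * - gamma2)^-1.
  apply: cvgM; last exact: cvgV.
  by rewrite expr2; under eq_fun do rewrite expr2; exact: cvgM.
have c3 : (fun n => - (2 * (theta n * rho n))) @ \oo --> - (2 * -1 : R).
  by apply: cvgN; exact: cvgMr.
have h1 := superexp_cvgM s_cvg Sy_cvg (superexp_cvg_seq P s c1).
have h2 := superexp_cvgM s_cvg Sz_cvg (superexp_cvg_seq P s c2).
have h3 := superexp_cvgM s_cvg cross_cvg0 (superexp_cvg_seq P s c3).
have := superexp_cvgM s_cvg (superexp_cvgD s_cvg (superexp_cvgD s_cvg h1 h2) h3)
  (superexp_cvg_seq P s c0).
rewrite (_ : (_ + _) * _ = energy_lim); last first.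
  rewrite /energy_lim /G; field.
  by rewrite !lt_eqF.
apply: superexp_cvg_ext.
have gy := ar_gap kappa_gt0 g1_gt0 theta_gap.
have gz := ar_gap kappa_gt0 g2_gt0 rho_gap.
apply: filterS3 near_n0 gy gz => n [n0 qn0 tr] [_ y0] [_ z0] w.
have y1 : 1 - theta n ^+ 2 != 0.
  by rewrite gt_eqF// -(pmulr_rgt0 _ (kappa_gt0 n)); exact: lt_le_trans y0.
have z1 : 1 - rho n ^+ 2 != 0.
  by rewrite gt_eqF// -(pmulr_rgt0 _ (kappa_gt0 n)); exact: lt_le_trans z0.
rewrite X_energyE//.
by field; rewrite n0 kN tr y1 z1.
Qed.

Let seq_tight (z : nat -> R) (l : R) : z @ \oo --> l -> superexp_tight P s (fun n _ => z n).
Proof. by move=> zl; apply: superexp_cvg_tight; exact: superexp_cvg_seq zl. Qed.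

Lemma X_mart_tight : superexp_tight P s
  (fun n w => X_mart V (theta n) (rho n) n w / q n).
Proof.
have d0 : (2 : R) != 0 by [].
have c1 : (fun n => theta n / (theta n - rho n)) @ \oo --> 1 / (2 : R).
  by apply: cvgM => //; exact: cvgV.
have c2 : (fun n => - rho n / (theta n - rho n)) @ \oo --> - -1 / (2 : R).
  by apply: cvgM; [exact: cvgN|exact: cvgV].
have := superexp_tightD s_cvg (superexp_tightM s_cvg (seq_tight c1) Ny_tight)
  (superexp_tightM s_cvg (seq_tight c2) Nz_tight).
apply: superexp_tight_ext_small => // K; apply: filterS near_n0 => n [n0 qn0 tr].
exists set0 => //; split; last by rewrite measure0 lee_fin expR_ge0.
by move=> w /= /eqP; apply; rewrite X_martE//; field; rewrite qn0 tr.
Qed.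

Lemma X_lag_mart_tight : superexp_tight P s
  (fun n w => X_lag_mart V (theta n) (rho n) n w / q n).
Proof.
have d0 : (2 : R) != 0 by [].
have c1 : (fun n => (theta n - rho n)^-1) @ \oo --> (2 : R)^-1 by exact: cvgV.
have c2 : (fun n => - (theta n - rho n)^-1) @ \oo --> - (2 : R)^-1 by exact: cvgN.
have := superexp_tightD s_cvg (superexp_tightM s_cvg (seq_tight c1) Ny_tight)
  (superexp_tightM s_cvg (seq_tight c2) Nz_tight).
apply: superexp_tight_ext_small => // K; apply: filterS near_n0 => n [n0 qn0 tr].
exists set0 => //; split; last by rewrite measure0 lee_fin expR_ge0.
by move=> w /= /eqP; apply; rewrite X_lag_martE//; field; rewrite qn0 tr.
Qed.

Local Notation xn n w := (X_ar (theta n) (rho n) V n w).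
Local Notation xnk n k w := (X_ar (theta n) (rho n) V k w).
Local Notation xl n w := (X_lag V (theta n) (rho n) n w).

Let diffV2_cvg : (fun n => ((theta n - rho n) ^+ 2)^-1) @ \oo --> ((2 : R) ^+ 2)^-1.
Proof.
apply: cvgV; first by rewrite gt_eqF.
by rewrite expr2; under eq_fun do rewrite expr2; exact: cvgM.
Qed.

Lemma boundary1_cvg0 : superexp_cvg P s (fun n w => xn n w * xl n w / q n) 0.
Proof.
have c1 : (fun n => - (theta n + rho n)) @ \oo --> - (1 + -1 : R).
  by apply: cvgN; exact: cvgD.
have h1 := superexp_cvgM s_cvg (superexp_cvg_seq P s theta_cvg) y2_cvg0.
have h2 := superexp_cvgM s_cvg (superexp_cvg_seq P s rho_cvg) z2_cvg0.
have h3 := superexp_cvgM s_cvg (superexp_cvg_seq P s c1) yz_cvg0.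
have := superexp_cvgM s_cvg (superexp_cvgD s_cvg (superexp_cvgD s_cvg h1 h2) h3)
  (superexp_cvg_seq P s diffV2_cvg).
rewrite !mulr0 !addr0 mul0r; apply: superexp_cvg_ext.
apply: filterS near_n0 => n [n0 qn0 tr] w.
by rewrite X_arE// /X_lag; field; rewrite qn0 tr.
Qed.

Lemma boundary2_cvg0 : superexp_cvg P s (fun n w => xl n w ^+ 2 / q n) 0.
Proof.
have h3 := superexp_cvgM s_cvg (superexp_cvg_cst P s (-2)) yz_cvg0.
have := superexp_cvgM s_cvg (superexp_cvgD s_cvg (superexp_cvgD s_cvg y2_cvg0 z2_cvg0) h3)
  (superexp_cvg_seq P s diffV2_cvg).
rewrite !mulr0 !addr0 mul0r; apply: superexp_cvg_ext.
apply: filterS near_n0 => n [n0 qn0 tr] w.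
by rewrite /X_lag; field; rewrite qn0 tr.
Qed.

Lemma superexp_small_eq0 (Z : nat -> T -> R) (z : R) : z != 0 ->
  superexp_cvg P s Z z -> superexp_small P s (fun n => [set w | Z n w = 0]).
Proof.
move=> z0 cZ; have nz : 0 < `|z| by rewrite normr_gt0.
have nz2 : 0 < `|z| / 2 by rewrite divr_gt0.
apply: superexp_small_sub (cZ _ nz2); apply: nearW => n w /= ->.
by rewrite sub0r normrN; lra.
Qed.

Local Notation S n w := (X_energy V (theta n) (rho n) n w).
Local Notation M n w := (X_mart V (theta n) (rho n) n w).
Local Notation M' n w := (X_lag_mart V (theta n) (rho n) n w).
Local Notation theta_star n := ((theta n + rho n) / (1 + theta n * rho n)).
Local Notation c n := (Num.sqrt (n%:R / kappa n) / lambda n).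
Local Notation th n w := (theta_hat (theta n) (rho n) V n w).
Local Notation Zt n w := (c n * (th n w - theta_star n)).
Local Notation Zr n w :=
  (c n * (rho_hat (theta n) (rho n) V n w - theta n * rho n * theta_star n)).
Local Notation IS n w := (S n w / (n%:R * kappa n))^-1.

Let E_neq0 : energy_lim != 0. Proof. by rewrite gt_eqF. Qed.

Let G_neq0 : G != 0. Proof. by rewrite gt_eqF. Qed.

Let S_neq0 : superexp_small P s (fun n => [set w | S n w = 0]).
Proof.
apply: superexp_small_sub (superexp_small_eq0 E_neq0 energy_cvg).
by apply: nearW => n w /= ->; rewrite mul0r.
Qed.

Let IS_cvg : superexp_cvg P s (fun n w => IS n w) energy_lim^-1.
Proof. exact: (superexp_cvgV s_cvg E_neq0 energy_cvg). Qed.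

Let ISk_cvg0 : superexp_cvg P s (fun n w => IS n w / kappa n) 0.
Proof. by have := superexp_cvgM s_cvg IS_cvg (superexp_cvg_seq P s kV_cvg); rewrite mulr0. Qed.

Let prod1_cvg : (fun n => 1 + theta n * rho n) @ \oo --> (0 : R).
Proof. by rewrite -(subrr 1); apply: cvgD => //; exact: cvg_cst. Qed.

Let near_scale : \forall n \near \oo,
  [/\ n%:R != 0 :> R, q n != 0, theta n - rho n != 0, c n = n%:R / q n &
    kappa n * (1 + theta n * rho n) != 0].
Proof.
have pg : \forall n \near \oo, kappa n * (1 + theta n * rho n) != 0.
  by move/cvgr_gt : prod_gap => /(_ _ G_gt0); apply: filterS => n h; rewrite gt_eqF.
apply: filterS2 near_n0 pg => n [n0 qn0 tr] p0.
by split => //; apply: (mulIf qn0); rewrite scale_norming// mulfVK.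
Qed.

(** Limit of [n * kappa n / S n] divided by [kappa n * (1 + theta n * rho n)]. *)
Definition mart_coef := (G * energy_lim)^-1.

Lemma theta_hat_equiv : superexp_cvg P s
  (fun n w => Zt n w - mart_coef * (M n w / q n)) 0.
Proof.
have pV : (fun n => (kappa n * (1 + theta n * rho n))^-1) @ \oo --> G^-1 by exact: cvgV.
have h1 := superexp_cvgM s_cvg IS_cvg (superexp_cvg_seq P s pV).
have h2 := superexp_cvgD s_cvg h1 (superexp_cvg_cst P s (- mart_coef)).
rewrite (_ : _ + - mart_coef = 0) in h2; last first.
  by rewrite /mart_coef -invfM [energy_lim * G]mulrC subrr.
have h3 := superexp_tightM_cvg0 s_cvg X_mart_tight h2.
have h4 := superexp_cvgM s_cvg
  (superexp_cvgM s_cvg boundary1_cvg0 (superexp_cvg_seq P s prod_cvg)) h1.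
have := superexp_cvgD s_cvg h3 h4; rewrite !mul0r addr0.
apply: (superexp_cvg_ext_small s_cvg).
apply: superexp_small_sub S_neq0; apply: filterS near_scale => n [n0 qn0 tr cE p0] w /=.
apply: contra_neqP => /eqP S0.
have p1 : 1 + theta n * rho n != 0 by move: p0; rewrite mulf_eq0 negb_or => /andP[].
rewrite theta_hat_sub// cE.
by field; rewrite p1 S0 qn0 kN n0.
Qed.

Let Zt_tight : superexp_tight P s (fun n w => Zt n w).
Proof.
have h1 := superexp_tightM s_cvg (superexp_cvg_tight (superexp_cvg_cst P s mart_coef)) X_mart_tight.
have := superexp_tightD s_cvg h1 (superexp_cvg_tight theta_hat_equiv).
apply: (superexp_tight_ext_small s_cvg) => K; apply: nearW => n.
exists set0 => //; split; last by rewrite measure0 lee_fin expR_ge0.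
by move=> w /= /eqP; apply; rewrite addrC subrK.
Qed.

Let tau := (gamma1 - gamma2) / G.

Let th_cvg : superexp_cvg P s (fun n w => th n w) tau.
Proof.
have h1 := superexp_tightM_cvg0 s_cvg Zt_tight (superexp_cvg_seq P s q_n_cvg0).
have := superexp_cvgD s_cvg (superexp_cvg_seq P s theta_star_cvg) h1.
rewrite addr0; apply: superexp_cvg_ext; apply: filterS near_scale => n [n0 qn0 tr cE p0] w.
by rewrite cE; move: (theta_star n) (th n w) => a b; field; rewrite qn0 n0.
Qed.

(** [b1] and [b2] are the boundary ratios already multiplied by the scale [n / q n], which is why
    [D] multiplies them back by [q n / n]. *)
Let b1 n w := xn n w * xl n w / q n * (IS n w / kappa n).
Let b2 n w := xl n w ^+ 2 / q n * (IS n w / kappa n).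
Let D n w := 1 - th n w * th n w + 2 * (th n w * (b1 n w * (q n / n%:R)))
  - th n w * th n w * (b2 n w * (q n / n%:R)).

Let b1_cvg0 : superexp_cvg P s b1 0.
Proof. by have := superexp_cvgM s_cvg boundary1_cvg0 ISk_cvg0; rewrite mulr0. Qed.

Let b2_cvg0 : superexp_cvg P s b2 0.
Proof. by have := superexp_cvgM s_cvg boundary2_cvg0 ISk_cvg0; rewrite mulr0. Qed.

Let th2_cvg := superexp_cvgM s_cvg th_cvg th_cvg.

Let D_cvg : superexp_cvg P s D (1 - tau * tau).
Proof.
have h1 := superexp_cvgM s_cvg b1_cvg0 (superexp_cvg_seq P s q_n_cvg0).
have h2 := superexp_cvgM s_cvg b2_cvg0 (superexp_cvg_seq P s q_n_cvg0).
have h3 := superexp_cvgM s_cvg (superexp_cvg_cst P s 2) (superexp_cvgM s_cvg th_cvg h1).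
have h4 := superexp_cvgN (superexp_cvgM s_cvg th2_cvg h2).
have := superexp_cvgD s_cvg (superexp_cvgD s_cvg (superexp_cvgD s_cvg
  (superexp_cvg_cst P s 1) (superexp_cvgN th2_cvg)) h3) h4.
by rewrite !mulr0 oppr0 !addr0.
Qed.

Let D_lim_neq0 : 1 - tau * tau != 0.
Proof.
have g12 : 0 < gamma1 * gamma2 by rewrite nmulr_rgt0.
rewrite (_ : 1 - tau * tau = 4 * (gamma1 * gamma2) / G ^+ 2).
  by rewrite gt_eqF// divr_gt0 ?exprn_gt0// mulr_gt0.
rewrite /tau; move: G_neq0; rewrite /G => h; by field; move: h; rewrite oppr_eq0.
Qed.

(** The sign is that of the limit -1 of [theta n * rho n]: the leading term [theta n * rho n * Zt]
    equals [- Zt + (1 + theta n * rho n) * Zt], where the second part vanishes because [Zt] is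
    tight. *)
Lemma rho_hat_equiv : superexp_cvg P s
  (fun n w => Zr n w - - mart_coef * (M n w / q n)) 0.
Proof.
have A0 := superexp_tightM_cvg0 s_cvg Zt_tight (superexp_cvg_seq P s prod1_cvg).
have m0 := superexp_tightM_cvg0 s_cvg X_lag_mart_tight ISk_cvg0.
have c1 : (fun n => theta n + rho n) @ \oo --> (1 + -1 : R) by exact: cvgD.
have prc := superexp_cvg_seq P s prod_cvg.
(* [k1] to [k5] treat the five terms over [D] in [rho_hat_sub], in that order; [k6] is their sum
   divided by [D]. *)
have k1 := superexp_cvgM s_cvg th2_cvg A0.
have k2 := superexp_cvgN (superexp_cvgM s_cvg th_cvg m0).
have k3 := superexp_cvgM s_cvg (superexp_cvgD s_cvg
  (superexp_cvgM s_cvg (superexp_cvg_seq P s c1) th_cvg) (superexp_cvgN th2_cvg)) b1_cvg0.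
have k4 := superexp_cvgN (superexp_cvgM s_cvg (superexp_cvgM s_cvg th_cvg prc) b2_cvg0).
have k5 := superexp_cvgN (superexp_cvgM s_cvg (superexp_cvgM s_cvg prc th_cvg)
  (superexp_cvgD s_cvg
    (superexp_cvgM s_cvg (superexp_cvgM s_cvg (superexp_cvg_cst P s 2) th_cvg) b1_cvg0)
    (superexp_cvgN (superexp_cvgM s_cvg th2_cvg b2_cvg0)))).
have k6 := superexp_cvgM s_cvg (superexp_cvgD s_cvg (superexp_cvgD s_cvg
  (superexp_cvgD s_cvg (superexp_cvgD s_cvg k1 k2) k3) k4) k5)
  (superexp_cvgV s_cvg D_lim_neq0 D_cvg).
have := superexp_cvgD s_cvg (superexp_cvgD s_cvg A0 k6) (superexp_cvgN theta_hat_equiv).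
rewrite !(mulr0, oppr0, addr0, mul0r).
apply: (superexp_cvg_ext_small s_cvg).
apply: superexp_small_sub (superexp_smallU s_cvg S_neq0 (superexp_small_eq0 D_lim_neq0 D_cvg)).
apply: filterS near_scale => n [n0 qn0 tr cE p0] w /= neq.
have [S0|/eqP S0] := EM (S n w = 0); first by left.
right; apply: contrapT => /eqP D0; move/eqP: neq; apply.
have p1 : 1 + theta n * rho n != 0 by move: p0; rewrite mulf_eq0 negb_or => /andP[].
have B1 : xn n w * xl n w / S n w = b1 n w * (q n / n%:R).
  by rewrite /b1; field; rewrite qn0 n0 kN S0.
have B2 : xl n w ^+ 2 / S n w = b2 n w * (q n / n%:R).
  by rewrite /b2; field; rewrite qn0 n0 kN S0.
have DE : 1 - th n w ^+ 2 + 2 * th n w * (xn n w * xl n w / S n w) -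
    th n w ^+ 2 * (xl n w ^+ 2 / S n w) = D n w.
  by rewrite B1 B2 /D; ring.
have MS : M' n w / S n w = M' n w / q n * (IS n w / kappa n) * (q n / n%:R).
  by field; rewrite qn0 n0 kN S0.
have := rho_hat_sub tr S0 p1; rewrite /= DE => /(_ D0) ->.
rewrite B1 B2 MS cE.
set m := M' n w / q n * _; set z := th n w - _.
move: (D n w) D0 (b1 n w) (b2 n w) m z (th n w) => D' D0 B1' B2' m z h.
by field; rewrite qn0 n0 D0.
Qed.

(** * Compensator and moment generating function of the driving martingale *)

Variables (L : R -> R) (KL : R).
Hypothesis mL : measurable_fun setT L.
Hypothesis expL : forall x : R,
  (\int[P]_w (expR (x * V 0%N w))%:E = (expR (L x))%:E)%E.
Hypothesis L_ge0 : forall x, 0 <= L x.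
Hypothesis KL_ge0 : 0 <= KL.
Hypothesis L_taylor : forall x, `|x| <= 1 -> `|L x - s2 / 2 * x ^+ 2| <= KL * `|x| ^+ 3.

Let measurable_X (a b : R) k : measurable_fun setT (X_ar a b V k).
Proof. exact: (past_measurable_fun mV (@past_measurable_X _ _ _ V a b k k (leqnn k))). Qed.

Let measurable_X_mart (a b : R) k : measurable_fun setT (X_mart V a b k).
Proof.
rewrite (_ : X_mart V a b k = fun w => \sum_(i < k) X_ar a b V i w * V i w).
  by apply: measurable_sum => i; apply: measurable_funM; [exact: measurable_X|exact: mV].
by apply/funext => w; rewrite /X_mart big_mkord.
Qed.

Lemma X_max_small (t e : R) : 0 < e -> superexp_small P s (fun n =>
  [set w | exists2 k, (k < n)%N & e < `|t * s n / q n * xnk n k w|]).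
Proof.
move=> e0; have e20 : 0 < e / 2 by lra.
have := superexp_smallU s_cvg
  (ar_max_small mV indep idV C_ge1 mgfV kappa_gt0 kappa_cvg lambda_gt0 lambda_cvg
    rate g1_gt0 theta_gap t e20)
  (ar_max_small mV indep idV C_ge1 mgfV kappa_gt0 kappa_cvg lambda_gt0 lambda_cvg
    rate g2_gt0 rho_gap t e20).
apply: superexp_small_sub.
have gy := ar_gap kappa_gt0 g1_gt0 theta_gap.
have gz := ar_gap kappa_gt0 g2_gt0 rho_gap.
have h12 : (1 : R) < 2 by lra.
move/cvgr_gt : diff_cvg => /(_ _ h12) d12.
apply: filterS3 gy gz d12 => n [y1 _] [z1 _] d1 w /= [k kn ek].
have d0 : 0 < theta n - rho n by lra.
have tr : theta n - rho n != 0 by rewrite gt_eqF.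
set u := t * s n / q n in ek *.
set y := eps_ar (theta n) V k w; set z := eps_ar (rho n) V k w.
have Xle : `|u * xnk n k w| <= `|u * y| + `|u * z|.
  rewrite X_arE// !normrM -mulrDr ler_wpM2l//.
  rewrite normfV (ger0_norm (ltW d0)) ler_pdivrMr//.
  apply: le_trans (ler_normB _ _) _; rewrite !normrM -/y -/z.
  apply: (@le_trans _ _ (`|y| + `|z|)); last by rewrite ler_peMr ?addr_ge0//; lra.
  by rewrite lerD// ler_piMl// ltW.
have [h|h] := ltP (e / 2) `|u * y|; first by left; exists k.
by right; exists k => //; rewrite -/z; lra.
Qed.

Let compensator (t : R) n w := \sum_(0 <= k < n) L (t * s n / q n * xnk n k w).

(** When all arguments of [L] are at most [e1] in absolute value, the cubic Taylor remainder is at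
    most [KL * e1] times the sum of their squares, which is itself controlled by [energy_cvg]. *)
Lemma compensator_cvg (t : R) : superexp_cvg P s
  (fun n w => compensator t n w / s n) (s2 * energy_lim * t ^+ 2 / 2).
Proof.
have h1 := superexp_cvgM s_cvg energy_cvg (superexp_cvg_cst P s (s2 / 2 * t ^+ 2)).
suff h2 : superexp_cvg P s (fun n w => compensator t n w / s n -
    X_energy V (theta n) (rho n) n w / (n%:R * kappa n) * (s2 / 2 * t ^+ 2)) 0.
  have := superexp_cvgD s_cvg h1 h2; rewrite addr0.
  rewrite (_ : energy_lim * _ = s2 * energy_lim * t ^+ 2 / 2); last by field.
  by apply: superexp_cvg_ext; apply: nearW => n w; rewrite addrC subrK.
move=> e e0.
have E0 := energy_lim_gt0.
(* [energy_lim + 1] bounds the normalised energy off a negligible event; the last [+ 1] keeps the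
   denominator positive when [KL] or [t] is 0. *)
pose e1 := Num.min 1 (e / (KL * t ^+ 2 * (energy_lim + 1) + 1)).
have c0 : 0 <= KL * t ^+ 2 * (energy_lim + 1).
  by apply: mulr_ge0; [rewrite mulr_ge0 ?sqr_ge0|rewrite addr_ge0 ?ltW].
have e10 : 0 < e1 by rewrite lt_min ltr01 divr_gt0//; lra.
have e11 : e1 <= 1 by rewrite ge_min lexx.
have e1e : e1 * (KL * t ^+ 2 * (energy_lim + 1)) <= e.
  have : e1 * (KL * t ^+ 2 * (energy_lim + 1) + 1) <= e.
    by rewrite -ler_pdivlMr ?ge_min ?lexx ?orbT//; lra.
  by lra.
apply: superexp_small_sub (superexp_smallU s_cvg (X_max_small t e10) (energy_cvg ltr01)).
apply: filterS (nbhs_infty_gt 0) => n n0 w /= H.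
set S := X_energy V (theta n) (rho n) n w / (n%:R * kappa n) in H *.
have [h|h] := ltP 1 `|S - energy_lim|; first by right.
left; apply: contrapT => nX.
have uX k : (k < n)%N -> `|t * s n / q n * xnk n k w| <= e1.
  by move=> kn; rewrite leNgt; apply/negP => hk; apply: nX; exists k.
move: H; apply/negP; rewrite -leNgt subr0.
have sn := s_gt0 n.
have nk : 0 < n%:R * kappa n by rewrite mulr_gt0 ?ltr0n.
have u2 := sqr_tilt kappa_gt0 lambda_gt0 t n0.
set u := t * s n / q n in uX u2.
have SE : S * (s2 / 2 * t ^+ 2) = (\sum_(0 <= k < n) s2 / 2 * (u * xnk n k w) ^+ 2) / s n.
  under eq_bigr do rewrite exprMn mulrCA.
  rewrite -mulr_sumr u2 -mulr_sumr /S /X_energy; field.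
  by rewrite kN pnatr_eq0 -lt0n n0 gt_eqF.
rewrite SE -mulrBl -sumrB normrM normfV (gtr0_norm sn) ler_pdivrMr//.
apply: le_trans (ler_norm_sum _ _ _) _.
apply: (@le_trans _ _ (\sum_(0 <= k < n) KL * e1 * (u ^+ 2 * xnk n k w ^+ 2))).
  rewrite !big_nat; apply: ler_sum => k /= kn.
  have hk := uX k kn.
  apply: le_trans (L_taylor (le_trans hk e11)) _.
  rewrite -mulrA ler_wpM2l// exprS -exprMn -[leRHS]mulrC real_normK ?num_real// mulrC.
  by rewrite ler_wpM2r ?sqr_ge0.
rewrite -!mulr_sumr u2.
have S1 : S <= energy_lim + 1 by have := ler_norm (S - energy_lim); lra.
rewrite (_ : _ * _ = e1 * (KL * t ^+ 2 * S) * s n); last first.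
  by rewrite /S /X_energy; field; rewrite kN pnatr_eq0 -lt0n n0.
rewrite ler_wpM2r ?(ltW sn)//; apply: le_trans e1e.
by rewrite ler_wpM2l ?(ltW e10)// ler_wpM2l// mulr_ge0 ?sqr_ge0.
Qed.

(** Only the order of the exponent matters here, so Young's inequality with [l = 0] separates the
    two AR(1) martingales. The doubling in the statement and the one in Young's inequality give the
    factor 4; since [|theta n|, |rho n| < 1 < theta n - rho n], the coefficients stay below
    [4 * |t|]. *)
Lemma X_mart_sqr_mgf (t : R) : exists C0 : R, \forall n \near \oo,
  (\int[P]_w (expR (2 * (t * s n / q n * X_mart V (theta n) (rho n) n w)))%:E <=
   (expR (C0 * s n))%:E)%E.
Proof.
pose Cy := 4 * C ^+ 2 * (4 * `|t|) ^+ 2 / - gamma1.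
pose Cz := 4 * C ^+ 2 * (4 * `|t|) ^+ 2 / - gamma2.
exists (Num.max Cy Cz).
have gy := ar_gap kappa_gt0 g1_gt0 theta_gap.
have gz := ar_gap kappa_gt0 g2_gt0 rho_gap.
have h12 : (1 : R) < 2 by lra.
move/cvgr_gt : diff_cvg => /(_ _ h12) d12.
have hMy := ar_mart_mgf mV indep idV C_ge1 mgfV kappa_gt0 kappa_cvg lambda_gt0 lambda_cvg
  rate g1_gt0 theta_gap (4 * `|t|).
have hMz := ar_mart_mgf mV indep idV C_ge1 mgfV kappa_gt0 kappa_cvg lambda_gt0 lambda_cvg
  rate g2_gt0 rho_gap (4 * `|t|).
apply: filterS3 (filterI gy gz) (filterI d12 near_n0) (filterI hMy hMz) =>
  n [[y1 _] [z1 _]] [d1 [n0 qn0 tr]] [My Mz].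
have d0 : 0 < theta n - rho n by lra.
have coef (x : R) : `|x| < 1 -> `|4 * t * x / (theta n - rho n)| <= 4 * `|t|.
  move=> x1; rewrite !normrM (ger0_norm (ler0n _ 4)) normfV (gtr0_norm d0).
  rewrite ler_pdivrMr// ler_pM// ?mulr_ge0//; lra.
have c1 := coef _ y1; have c2 := coef (- rho n); rewrite normrN in c2.
have {My} := My _ c1; have {Mz} := Mz _ (c2 z1).
set a1 := 4 * t * theta n / _; set a2 := 4 * t * - rho n / _ => Mz My.
have mf (r a : R) : measurable_fun setT (fun w => expR (a * s n * (ar_mart V r n w / q n))).
  apply: measurableT_comp => //; apply: measurable_funM => //.
  by apply: measurable_funM => //; exact: (measurable_ar_mart mV).
apply: le_trans (@le_integral_dominated _ _ _ P
  (fun w => expR (2 * (t * s n / q n * X_mart V (theta n) (rho n) n w)))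
  (fun w => expR (a1 * s n * (ar_mart V (theta n) n w / q n)))
  (fun w => expR (a2 * s n * (ar_mart V (rho n) n w / q n)))
  2^-1 2^-1 0 set0 _ (mf _ _) (mf _ _) measurable0 _ _ _ _ _ _ _) _ => //.
- apply: measurableT_comp => //; apply: measurable_funM => //.
  by apply: measurable_funM => //; exact: measurable_X_mart.
- move=> w; rewrite mul0r addr0.
  set A := a1 * s n * _; set B := a2 * s n * _.
  have -> : 2 * (t * s n / q n * X_mart V (theta n) (rho n) n w) = A / 2 + B / 2.
    by rewrite /A /B /a1 /a2 X_martE//; field; rewrite qn0.
  apply: le_trans (expRD_le_half _ _ 0) _.
  by rewrite oppr0 expR0 !mul1r !(mulrC 2) !divfK.
- rewrite mul0e adde0.
  apply: (@le_trans _ _ ((2^-1)%:E * (expR (Cy * s n))%:E + (2^-1)%:E * (expR (Cz * s n))%:E)%E).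
    by apply: leeD; apply: lee_wpmul2l; rewrite ?lee_fin.
  rewrite -!EFinM -EFinD lee_fin.
  have e1 : expR (Cy * s n) <= expR (Num.max Cy Cz * s n).
    by rewrite ler_expR ler_wpM2r ?(ltW (s_gt0 n))// le_max lexx.
  have e2 : expR (Cz * s n) <= expR (Num.max Cy Cz * s n).
    by rewrite ler_expR ler_wpM2r ?(ltW (s_gt0 n))// le_max lexx orbT.
  by lra.
Qed.

Lemma X_mart_mgf (t e : R) : 0 < e -> \forall n \near \oo,
  ((expR (s n * (s2 * energy_lim * t ^+ 2 / 2 - e)))%:E <=
   \int[P]_w (expR (t * s n * (X_mart V (theta n) (rho n) n w / q n)))%:E)%E /\
  (\int[P]_w (expR (t * s n * (X_mart V (theta n) (rho n) n w / q n)))%:E <=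
   (expR (s n * (s2 * energy_lim * t ^+ 2 / 2 + e)))%:E)%E.
Proof.
move=> e0; have [C0 HC0] := X_mart_sqr_mgf t.
have mM n : measurable_fun setT (fun w => t * s n / q n * X_mart V (theta n) (rho n) n w).
  by apply: measurable_funM => //; exact: measurable_X_mart.
have mQ n : measurable_fun setT (compensator t n).
  rewrite (_ : compensator t n = fun w => \sum_(k < n) L (t * s n / q n * xnk n k w)).
    apply: measurable_sum => k; apply: measurableT_comp => //.
    by apply: measurable_funM => //; exact: measurable_X.
  by apply/funext => w; rewrite /compensator big_mkord.
have Q0 n w : 0 <= compensator t n w by apply: sumr_ge0.
have D1 : \forall n \near \oo, (\int[P]_w (expR (t * s n / q n * X_mart V (theta n) (rho n) n w -
    compensator t n w))%:E = 1)%E.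
  apply: nearW => n.
  apply: (mgf_exp_mart mV indep idV (X := X_ar (theta n) (rho n) V) _ n mL expL) => i j ij.
  exact: past_measurable_X.
have := mgf_tilt s_gt0 s_cvg mM mQ Q0 D1 HC0 (compensator_cvg t) e0.
by apply: filterS => n; under eq_integral do rewrite mulrAC -mulrA.
Qed.

Let measurable_theta_hat (a b : R) n : measurable_fun setT (theta_hat a b V n).
Proof.
apply: measurable_funM; last apply: measurable_funV.
  by apply: measurable_sum => k; apply: measurable_funM; exact: measurable_X.
by apply: measurable_sum => k; apply: measurable_funX; exact: measurable_X.
Qed.

Let measurable_rho_hat (a b : R) n : measurable_fun setT (rho_hat a b V n).
Proof.
have me k : measurable_fun setT (eps_hat a b V n k).
  case: k => [|k]; first exact: measurable_cst.
  apply: measurable_funB; first exact: measurable_X.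
  by apply: measurable_funM; [exact: measurable_theta_hat|exact: measurable_X].
apply: measurable_funM; last apply: measurable_funV.
  by apply: measurable_sum => k; apply: measurable_funM; exact: me.
by apply: measurable_sum => k; apply: measurable_funX; exact: me.
Qed.

Local Notation J x := (- ((gamma1 + gamma2) ^+ 3 * x ^+ 2) / (16 * gamma1 * gamma2)).

(** Only [b ^+ 2] enters the variance [b ^+ 2 * (s2 * energy_lim)], so the opposite signs of the two
    coefficients lead to the same rate function. *)
Lemma equiv_mart_LDP (Z : nat -> T -> R) (b : R) :
  (forall n, measurable_fun setT (Z n)) -> b ^+ 2 = mart_coef ^+ 2 ->
  superexp_cvg P s (fun n w => Z n w - b * (M n w / q n)) 0 ->
  LDP P Z s (fun x => J x).
Proof.
move=> mZ bE ZM.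
have v0 : 0 < b ^+ 2 * (s2 * energy_lim).
  rewrite bE; apply: mulr_gt0; last exact: mulr_gt0.
  by rewrite exprn_gt0// invr_gt0; exact: mulr_gt0.
rewrite (_ : (fun x : R => _) = (fun x => x ^+ 2 / (2 * (b ^+ 2 * (s2 * energy_lim))))); last first.
  apply/funext => x; rewrite bE /mart_coef /energy_lim.
  have : G != 0 := G_neq0; rewrite {1}/G oppr_eq0 /G => gN.
  field.
  by rewrite gN (lt_eqF gamma1_lt0) (lt_eqF gamma2_lt0) (gt_eqF s2_gt0).
apply: (quadratic_LDP s_gt0 s_cvg v0 _ mZ _ ZM) => [n|t e e0].
  by apply: measurable_funM => //; apply: measurable_funM => //; exact: measurable_X_mart.
have := X_mart_mgf (t * b) e0; apply: filterS => n.
rewrite (_ : s2 * energy_lim * _ / 2 = b ^+ 2 * (s2 * energy_lim) * t ^+ 2 / 2); last by field.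
have tE w : t * b * s n * (M n w / q n) = t * s n * (b * (M n w / q n)) by ring.
by under eq_integral do rewrite tE.
Qed.

Lemma theta_hat_LDP : LDP P (fun n w => Zt n w) s (fun x => J x).
Proof.
apply: equiv_mart_LDP erefl theta_hat_equiv => n.
by apply: measurable_funM => //; apply: measurable_funB.
Qed.

Lemma rho_hat_LDP : LDP P (fun n w => Zr n w) s (fun x => J x).
Proof.
apply: equiv_mart_LDP (sqrrN _) rho_hat_equiv => n.
by apply: measurable_funM => //; apply: measurable_funB.
Qed.

End model.

(** * Goodness of the rate function, cumulant of the innovations, conclusion *)

Lemma sqr_good_rate {R : realType} (a : R) : 0 < a -> good_rate_function (fun x => a * x ^+ 2).
Proof.
move=> a0; split=> [x|b]; first by rewrite mulr_ge0 ?sqr_ge0// ltW.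
have [b0|b0] := ltP b 0.
  rewrite (_ : mkset _ = set0); first exact: compact0.
  apply/seteqP; split => // x /= xb.
  have : 0 <= a * x ^+ 2 by rewrite mulr_ge0 ?sqr_ge0// ltW.
  by move=> /le_trans/(_ xb)/(lt_le_trans b0); rewrite ltxx.
rewrite (_ : mkset _ = `[- Num.sqrt (b / a), Num.sqrt (b / a)]%classic).
  exact: segment_compact.
have ba : 0 <= b / a by rewrite divr_ge0// ltW.
have ab x : (a * x ^+ 2 <= b) = (`|x| <= Num.sqrt (b / a)).
  rewrite -[RHS]ler_sqr ?nnegrE ?sqrtr_ge0// sqr_sqrtr// real_normK ?num_real//.
  by rewrite ler_pdivlMr// mulrC.
by apply/seteqP; split => x /=; rewrite in_itv/= -ler_norml ab.
Qed.

Section innovation_cumulant.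
Context {R : realType} {d : measure_display} {T : measurableType d}.
Variables (P : probability T R) (W : T -> R) (t0 s2 : R).
Hypotheses (mW : measurable_fun setT W) (t0_gt0 : 0 < t0).
Hypothesis W_exp : (\int[P]_w (expR (t0 * W w ^+ 2))%:E < +oo)%E.
Hypothesis W_mean : (\int[P]_w (W w)%:E = 0)%E.
Hypothesis W_var : (\int[P]_w (W w ^+ 2)%:E = s2%:E)%E.

Definition cumulant (x : R) : R := ln (fine (\int[P]_w (expR (x * W w))%:E)%E).

(** The integral is finite by the Gaussian tail and at least 1 by centring, so neither [fine] nor
    [ln] takes a default value. *)
Lemma expR_cumulant x : (\int[P]_w (expR (x * W w))%:E = (expR (cumulant x))%:E)%E.
Proof.
rewrite /cumulant (EFin_Rintegral (integrable_exp_lin mW t0_gt0 W_exp x)) /= lnK//.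
rewrite posrE; apply: lt_le_trans ltr01 _.
exact: (E_exp_lin_ge1 mW t0_gt0 W_exp W_mean).
Qed.

Lemma cumulant_ge0 x : 0 <= cumulant x.
Proof.
rewrite -ler_expR expR0 -lee_fin -expR_cumulant.
rewrite (EFin_Rintegral (integrable_exp_lin mW t0_gt0 W_exp x)) lee_fin.
exact: (E_exp_lin_ge1 mW t0_gt0 W_exp W_mean).
Qed.

Lemma cumulant_taylor : exists2 K : R, 0 <= K & forall x : R, `|x| <= 1 ->
  `|cumulant x - s2 / 2 * x ^+ 2| <= K * `|x| ^+ 3.
Proof.
have [K K0 HK] := E_exp_lin_taylor mW t0_gt0 W_exp W_mean W_var.
exists K => // x x1; have := HK x x1.
have -> : Rintegral P setT (fun w => expR (x * W w)) = expR (cumulant x).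
  apply: EFin_inj; rewrite -expR_cumulant.
  by rewrite (EFin_Rintegral (integrable_exp_lin mW t0_gt0 W_exp x)).
by rewrite !ler_expR ler_distl.
Qed.

Lemma measurable_cumulant : measurable_fun setT cumulant.
Proof.
have : measurable_fun setT (fun x : R => \int[P]_w (expR (x * W w))%:E)%E.
  apply: (measurable_integral_innov P (fun=> mW) (g := fun p => expR (p.1 * p.2))).
    by apply: measurableT_comp => //; apply: measurable_funM.
  by move=> p; exact: expR_ge0.
under eq_fun do rewrite expR_cumulant.
move/measurable_EFinP => /(measurableT_comp (@measurable_ln R)).
by apply: eq_measurable_fun => x _ /=; rewrite expRK.
Qed.

End innovation_cumulant.

Theorem theorem2p2 (R : realType) (d : measure_display) (T : measurableType d)
  (P : probability T R) (V : nat -> T -> R) (sigma2 : R)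
  (kappa lambda : nat -> R) (gamma1 gamma2 : R) :
  (forall k, measurable_fun setT (V k)) ->
  mutually_independent P V ->
  identically_distributed P V ->
  ('E_P[V 0%N] = 0%E)%E ->
  0 < sigma2 ->
  ('E_P[fun w => (V 0%N w ^+ 2)%R] = sigma2%:E)%E ->
  (exists2 t0 : R, 0 < t0 & ('E_P[fun w => expR (t0 * V 0%N w ^+ 2)%R] < +oo)%E) ->
  (forall n, 0 < kappa n) -> kappa @ \oo --> +oo ->
  gamma1 < 0 -> gamma2 < 0 ->
  (* (H-II) *)
  (forall n, 0 < lambda n) -> {homo lambda : m n / (m <= n)%N >-> m <= n} ->
  lambda @ \oo --> +oo ->
  (fun n => n%:R / (lambda n ^+ 6 * kappa n ^+ 6)) @ \oo --> +oo ->
  (fun n => n%:R / (lambda n ^+ 2 * kappa n ^+ 11)) @ \oo --> +oo ->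
  (fun n => n%:R * lambda n ^+ 2 / (kappa n ^+ 7 * ln n%:R ^+ 2)) @ \oo --> +oo ->
  (* Chen--Ledoux condition C-L(lambda_n) *)
  (fun n => ((lambda n ^+ 2)^-1)%:E *
     elog (n%:R%:E * P [set w | (lambda n * Num.sqrt n%:R < `|V 0%N w| ^+ 4)%R]))%E
     @ \oo --> -oo%E ->
  let theta n := 1 + gamma1 / kappa n in
  let rho n := -1 - gamma2 / kappa n in
  let theta_star n := (theta n + rho n) / (1 + theta n * rho n) in
  let rho_star n := theta n * rho n * theta_star n in
  let c n := Num.sqrt (n%:R / kappa n) / lambda n in
  let J x := - ((gamma1 + gamma2) ^+ 3 * x ^+ 2) / (16 * gamma1 * gamma2) in
  good_rate_function J /\
  LDP P (fun n w => c n * (theta_hat (theta n) (rho n) V n w - theta_star n))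
      (fun n => lambda n ^+ 2) J /\
  LDP P (fun n w => c n * (rho_hat (theta n) (rho n) V n w - rho_star n))
      (fun n => lambda n ^+ 2) J.
Proof.
rewrite unlock => mV indep idV mean s20 var [t0 t00 tail] kappa0 kappaoo g1 g2.
move=> lambda0 _ lambdaoo rate _ _ _ theta rho theta_star rho_star c J.
have [C C1 mgfV] := mgf_quad_le (mV 0%N) t00 tail mean.
have [C' C'1 mgfV2] := mgf_sqr_centered (mV 0%N) t00 tail var.
have [K K0 taylor] := cumulant_taylor (mV 0%N) t00 tail mean var.
have mL := measurable_cumulant (mV 0%N) t00 tail mean.
have expL := expR_cumulant (mV 0%N) t00 tail mean.
have L0 := cumulant_ge0 (mV 0%N) t00 tail mean.
have g12 : 0 < gamma1 * gamma2 by rewrite nmulr_rgt0.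
split; [|split].
- rewrite (_ : J = fun x => (- (gamma1 + gamma2)) ^+ 3 / (16 * (gamma1 * gamma2)) * x ^+ 2).
    by apply: sqr_good_rate; apply: divr_gt0; [apply: exprn_gt0; lra|exact: mulr_gt0].
  by apply/funext => x; rewrite /J; field; rewrite !lt_eqF.
- exact: (theta_hat_LDP mV indep idV C1 mgfV C'1 mgfV2 s20 kappa0 kappaoo lambda0
    lambdaoo rate g1 g2 mL expL L0 K0 taylor).
- exact: (rho_hat_LDP mV indep idV C1 mgfV C'1 mgfV2 s20 kappa0 kappaoo lambda0
    lambdaoo rate g1 g2 mL expL L0 K0 taylor).
Qed.
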